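(* There exists an absolute constant $c>0$ such that the following holds. Let $n\geq 1$ and let $X$ be a random variable taking values in $\{0,\ldots,n\}$ with $\mathbb{P}(X=0)\,\mathbb{P}(X=n)>0$, mean $\mu$, variance $\sigma^2$ (with $\sigma>0$) and probability generating function $f_X$. Let $\delta>0$, $R\geq1$, and set $X^{\ast}:=(X-\mu)\sigma^{-1}$. If all zeros $\zeta\in\mathbb{C}$ of $f_X$ satisfy $|\arg(\zeta)|\geq\delta$ and $R^{-1}\leq|\zeta|\leq R$, then $$\sup_{t\in\mathbb{R}}\left|\mathbb{P}(X^{\ast}\leq t)-\mathbb{P}(Z\leq t)\right|\leq c\,\delta^{-1}R^{\pi/\delta}\,n^{-1/2},$$ where $Z$ is a standard Gaussian random variable.
   Context: For a random variable $X$ with values in $\{0,\ldots,n\}$, its probability generating function is the polynomial $f_X(z)=\sum_{k=0}^n\mathbb{P}(X=k)z^k$, $z\in\mathbb{C}$. For $z\in\mathbb{C}\setminus\{0\}$ write $z=re^{i\theta}$ with $r>0$ and $\theta\in[-\pi,\pi]$; then $\arg(z)=\theta$ (so $|\arg(z)|\in[0,\pi]$ is well defined). When $n\ge 1$, the condition $\mathbb{P}(X=0)\mathbb{P}(X=n)>0$ guarantees $\sigma>0$. *)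

(* Defs.v *)
From HB Require Import structures.
From mathcomp Require Import all_boot all_order all_algebra.
From mathcomp Require Import all_classical all_reals all_analysis.
From mathcomp Require Import complex.

Set Implicit Arguments.
Unset Strict Implicit.
Unset Printing Implicit Defensive.

Import Order.TTheory GRing.Theory Num.Theory numFieldNormedType.Exports.

Local Open Scope classical_set_scope.
Local Open Scope complex_scope.
Local Open Scope ring_scope.

Definition is_arg (R : realType) (z : R[i]) (theta : R) : Prop :=
  - pi <= theta <= pi /\
  exists2 r : R, 0 < r & z = r%:C * (cos theta +i* sin theta).

(* On the negative real axis both [pi] and [- pi] satisfy [is_arg], so there
   [arg] is an arbitrary one of the two; [`|arg z|] does not depend on this
   choice (see [norm_argE]). By convention [arg 0 = 0]. *)
Definition arg (R : realType) (z : R[i]) : R := xget 0 [set theta | is_arg z theta].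

Lemma is_arg_exists (R : realType) (z : R[i]) :
  z != 0 -> exists theta, is_arg z theta.
Proof.
case: z => a b z0.
set r := Num.sqrt (a ^+ 2 + b ^+ 2).
have ab0 : 0 < a ^+ 2 + b ^+ 2.
  rewrite lt_def addr_ge0 ?sqr_ge0// andbT paddr_eq0 ?sqr_ge0// !sqrf_eq0.
  by apply: contra z0 => /andP[/eqP -> /eqP ->].
have r0 : 0 < r by rewrite sqrtr_gt0.
have rE : r ^+ 2 = a ^+ 2 + b ^+ 2 by rewrite sqr_sqrtr// ltW.
have ar1 : -1 <= a / r <= 1.
  rewrite ler_pdivlMr// ler_pdivrMr// mulN1r mul1r -ler_norml -sqrtr_sqr.
  by rewrite /r ler_sqrt ?(ltW ab0)// -[leLHS]addr0 lerD2l sqr_ge0.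
have cosE : cos (acos (a / r)) = a / r by rewrite acosK.
have sinE : sin (acos (a / r)) = `|b| / r.
  rewrite sin_acos// expr_div_n rE -{1}(divff (lt0r_neq0 ab0)) -mulrBl.
  rewrite addrAC subrr add0r sqrtrM ?sqr_ge0// sqrtr_sqr sqrtrV ?ltW//.
have pi0 := pi_ge0 R.
have polarE : r%:C * (a / r +i* (b / r)) = a +i* b.
  by simpc; rewrite ![r * _]mulrC !divfK// gt_eqF.
have acge := acos_ge0 ar1; have acle := acos_lepi ar1.
have [b0|b0] := leP 0 b.
- exists (acos (a / r)); split.
    by rewrite acle andbT (le_trans _ acge)// oppr_le0.
  by exists r => //; rewrite cosE sinE ger0_norm// polarE.
- exists (- acos (a / r)); split.
    by rewrite lerN2 acle /= (le_trans _ pi0)// oppr_le0.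
  by exists r => //; rewrite cosN sinN cosE sinE ltr0_norm// mulNr opprK polarE.
Qed.

Lemma norm_argE (R : realType) (z : R[i]) (theta : R) :
  is_arg z theta -> `|arg z| = `|theta|.
Proof.
move=> h; rewrite /arg; case: xgetP => [t _ /= ht|/(_ theta)//].
case: z h ht => a b h ht.
have modE s : is_arg (a +i* b) s ->
    0 < Num.sqrt (a ^+ 2 + b ^+ 2) /\ a = Num.sqrt (a ^+ 2 + b ^+ 2) * cos s.
  move=> [_ [r r0]]; simpc => -[-> ->].
  by rewrite !exprMn -mulrDr cos2Dsin2 mulr1 sqrtr_sqr gtr0_norm.
have cst : cos t = cos theta.
  have [nz e] := modE _ h; have [_ e'] := modE _ ht.
  by apply: (mulfI (lt0r_neq0 nz)); rewrite -e -e'.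
have norm_cos s : is_arg (a +i* b) s -> `|s| = acos (cos s).
  move=> [/andP[s1 s2] _]; have -> : cos s = cos `|s| by rewrite cos_norm.
  by rewrite cosK// in_itv/= normr_ge0 /= ler_norml s1.
by rewrite (norm_cos _ ht) (norm_cos _ h) cst.
Qed.

Section distribution.
Context (R : realType) (d : measure_display) (T : measurableType d).
Variables (P : probability T R) (X : {RV P >-> R}).

Definition pgf (n : nat) : {poly R[i]} :=
  \poly_(k < n.+1) (fine (P [set w | X w = k%:R]))%:C.

Definition mean : R := fine 'E_P[X].

Definition stddev : R := Num.sqrt (fine 'V_P[X]).

Definition standardized (w : T) : R := (X w - mean) * stddev^-1.

End distribution.

(* Main.v *)
Require Import Defs.
From HB Require Import structures.
From mathcomp Require Import all_boot all_order all_algebra.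
From mathcomp Require Import all_classical all_reals all_analysis.
From mathcomp Require Import measurable_realfun.
From mathcomp Require Import complex.
From mathcomp Require Import ring lra.
Set Implicit Arguments.
Unset Strict Implicit.
Unset Printing Implicit Defensive.

Import Order.TTheory GRing.Theory Num.Theory numFieldNormedType.Exports.
Local Open Scope classical_set_scope.
Local Open Scope complex_scope.
Local Open Scope ring_scope.

Local Notation Re := complex.Re.
Local Notation Im := complex.Im.

(** Let [f] be the generating function, [m z = z f'(z) / f(z)], and let [d] be
    the smaller of [delta] and [pi / 2]; then [mu = m 1] and
    [sigma^2 = m' 1].  The proof bounds the distance to the normal law by
    [C / (r sigma)], where [r] is comparable to [delta], and bounds [sigma] from
    below by a multiple of [sqrt n R^(- pi / delta)].

    The geometric input is a reflection argument.  For [0 < y0 < d] the quotient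
    [f (exp (-2 i y0) z) / f z] is holomorphic in the sector
    [0 <= arg z <= y0].  It has modulus 1 on the ray [arg z = y0], because [f] is
    real, modulus at most 1 on the positive axis, because the coefficients are
    nonnegative, and it tends to modulus 1 at infinity.  By the maximum principle
    [|f (t exp (i y))|] decreases across the ray [y = y0], which says that
    [Im (m z) >= 0] in the upper half of the sector ([reflection_le],
    [Im_mean_ge0]).

    Take a disc [|z - 1| <= r] inside the sector and put [h = z - 1].  On its
    boundary the real part of [(r^2 - h^2) (m z - mu) / h] equals
    [2 Im h Im (m z)], hence is nonnegative, and so it is nonnegative in the
    whole disc, with value [r^2 sigma^2] at the centre.  Schwarz's lemma then
    controls the Taylor expansion of [m] at 1 by [sigma^2] alone, without any
    further moment: [|m z - mu - sigma^2 h| <= 6 sigma^2 |h|^2 / r]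
    ([disc_schwarz], [disc_mean_taylor]).  This estimate is used twice.

    First, along the unit circle it is a differential inequality for the
    characteristic function, which is therefore within
    [O (sigma^2 t^3 / r) exp (- sigma^2 t^2 / 4)] of the Gaussian one for
    [t <= r / 10] ([charfun_estimate]).  A smoothing inequality with explicit
    band-limited kernels ([smoothing_inequality]) turns this into the bound
    [C / (r sigma)].

    Second, it bounds the third cumulant by a multiple of [sigma^2 / r].
    Multiplying the variable of [f] by [x > 0] preserves the sector, so the same
    bound holds for all tilted laws, and it limits how fast their variance can
    grow as [x] decreases from 1.  Since all zeros lie in
    [R^-1 <= |z| <= R], a tilt by about [R^-1] moves the mean, which may be
    assumed at least [n / 2] by reversing the coefficients, by a fixed multiple of
    [n delta]; this forces [sigma^2 >= c n R^(- 2 pi / delta)]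
    ([kap1_variation], [variance_lower_bound]).  When [delta > pi / 2] the zeros
    have nonpositive real part and the variance is bounded zero by zero
    ([kap2_half_plane]). *)

(** * Maximum principle for quotients of polynomials *)
Section maximum_principle.
Context {R : realType}.
Implicit Types (x y s e c : R) (z : R * R) (K : set (R * R)) (P Q : {poly R[i]}).

Definition pt z : R[i] := z.1 +i* z.2.

Definition sqn (w : R[i]) : R := Re w ^+ 2 + Im w ^+ 2.

(** The four-point star average, up to a factor 4: [cross u - 4 u] is a discrete
    Laplacian, so that a maximum principle needs no second derivative. *)
Definition cross (u : R * R -> R) x y s : R :=
  u (x + s, y) + u (x - s, y) + u (x, y + s) + u (x, y - s).

Lemma near_cross x y (A : R * R -> Prop) : (\forall z \near (x, y), A z) ->
  exists2 s0, 0 < s0 & forall s, 0 < s < s0 ->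
    [/\ A (x + s, y), A (x - s, y), A (x, y + s) & A (x, y - s)].
Proof.
move=> /nbhs_ballP[e /= e0 eA]; exists e => // s /andP[s0 se].
have H a b : `|a| < e -> `|b| < e -> A (x + a, y + b).
  move=> ae be; apply: eA; split => /=; rewrite /ball /=.
    by rewrite opprD addNKr normrN.
  by rewrite opprD addNKr normrN.
have sE : `|s| < e by rewrite gtr0_norm.
have z0 : `|0 : R| < e by rewrite normr0.
split.
- by rewrite -[y]addr0; apply: H.
- by rewrite -[y]addr0; apply: H; rewrite ?normrN.
- by rewrite -[x]addr0; apply: H.
- by rewrite -[x]addr0; apply: H; rewrite ?normrN.
Qed.

(** If [u] exceeded [c] somewhere, then [u + e |z|^2], for a small positive [e],
    would have its maximum over [K] at an interior point; but there the discrete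
    Laplacian of the perturbation, [4 e s^2], outweighs the possible deficit
    [e s^2] of that of [u]. *)
Lemma cross_max_principle K (u : R * R -> R) c :
  compact K -> {within K, continuous u} ->
  (forall x y, K (x, y) -> u (x, y) <= c \/
    (\forall z \near (x, y), K z) /\
    forall e, 0 < e -> exists2 s0, 0 < s0 & forall s, 0 < s < s0 ->
      - (e * s ^+ 2) <= cross u x y s - 4 * u (x, y)) ->
  forall z, K z -> u z <= c.
Proof.
move=> cK cu int z1 Kz1; rewrite leNgt; apply/negP => cuz1.
pose q (z : R * R) := z.1 ^+ 2 + z.2 ^+ 2.
have cq : continuous q.
  move=> z; apply: cvgD; apply: cvgM;
    by [exact: cvg_fst|exact: cvg_snd].
have [z2 z2K qz2] : exists2 z2, z2 \in K & forall z, z \in K -> q z <= q z2.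
  apply: compact_EVT_max => //; first by exists z1.
  exact: continuous_subspaceT.
pose d := q z2 + 1.
have q0 z : 0 <= q z by rewrite addr_ge0 ?sqr_ge0.
have d0 : 0 < d by rewrite ltr_wpDl.
pose e := (u z1 - c) / (2 * d).
have e0 : 0 < e by rewrite divr_gt0 ?subr_gt0// mulr_gt0.
pose w z := u z + e * q z.
have [z0 z0K wz0] : exists2 z2, z2 \in K & forall z, z \in K -> w z <= w z2.
  apply: compact_EVT_max => //; first by exists z1.
  move=> z; apply: cvgD; first exact: cu.
  apply: cvgM; first exact: cvg_cst.
  exact: (continuous_subspaceT cq).
have qd z : K z -> e * q z <= (u z1 - c) / 2.
  move=> Kz.
  have -> : (u z1 - c) / 2 = e * d.
    by rewrite /e; field; rewrite gt_eqF.
  rewrite ler_pM2l// (le_trans (qz2 _ _)) ?inE// /d lerDl//.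
case: z0 z0K wz0 => x y; rewrite inE => Kxy wxy.
have uxy : c < u (x, y).
  have := wxy z1; rewrite inE => /(_ Kz1); rewrite /w => h.
  have := qd _ Kxy; have := mulr_ge0 (ltW e0) (q0 z1).
  lra.
case: (int x y Kxy) => [|[nK]]; first by rewrite leNgt uxy.
move=> /(_ e e0)[s1 s10 hs1].
have [s2 s20 hs2] := near_cross nK.
pose s := Num.min s1 s2 / 2.
have m0 : 0 < Num.min s1 s2 by rewrite lt_min s10.
have s0 : 0 < s by rewrite divr_gt0.
have sm : s < Num.min s1 s2 by rewrite /s; lra.
have [ss1 ss2] : s < s1 /\ s < s2.
  by move: sm; rewrite lt_min => /andP[].
have h1 := hs1 s; rewrite s0 ss1 in h1.
have := h1 isT; rewrite /cross.
have := hs2 s; rewrite s0 ss2 => /(_ isT)[k1 k2 k3 k4].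
have := wxy (x + s, y); rewrite inE => /(_ k1).
have := wxy (x - s, y); rewrite inE => /(_ k2).
have := wxy (x, y + s); rewrite inE => /(_ k3).
have := wxy (x, y - s); rewrite inE => /(_ k4).
rewrite /w /q /= => a1 a2 a3 a4 a5.
have : 0 < e * s ^+ 2 by rewrite mulr_gt0// exprn_gt0.
nra.
Qed.

Lemma cReD (a b : R[i]) : Re (a + b) = Re a + Re b.
Proof. by case: a b => [? ?] [? ?]. Qed.

Lemma cImD (a b : R[i]) : Im (a + b) = Im a + Im b.
Proof. by case: a b => [? ?] [? ?]. Qed.

Lemma cReB (a b : R[i]) : Re (a - b) = Re a - Re b.
Proof. by case: a b => [? ?] [? ?]. Qed.

Lemma cImB (a b : R[i]) : Im (a - b) = Im a - Im b.
Proof. by case: a b => [? ?] [? ?]. Qed.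

Lemma cReM (a b : R[i]) : Re (a * b) = Re a * Re b - Im a * Im b.
Proof. by case: a b => [? ?] [? ?]. Qed.

Lemma cImM (a b : R[i]) : Im (a * b) = Re a * Im b + Im a * Re b.
Proof. by case: a b => [? ?] [? ?]. Qed.

Lemma cReN (a : R[i]) : Re (- a) = - Re a. Proof. by case: a. Qed.

Lemma cImN (a : R[i]) : Im (- a) = - Im a. Proof. by case: a. Qed.

Lemma cReZ (k : R) (a : R[i]) : Re (k%:C * a) = k * Re a.
Proof. by rewrite cReM /= mul0r subr0. Qed.

Lemma cReJ (a : R[i]) : Re a^*%C = Re a. Proof. by case: a. Qed.

Lemma cImJ (a : R[i]) : Im a^*%C = - Im a. Proof. by case: a. Qed.

Lemma sqnM (a b : R[i]) : sqn (a * b) = sqn a * sqn b.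
Proof. by rewrite /sqn cReM cImM; ring. Qed.

Lemma sqn_ge0 (a : R[i]) : 0 <= sqn a.
Proof. by rewrite addr_ge0 ?sqr_ge0. Qed.

Lemma sqn_eq0 (a : R[i]) : (sqn a == 0) = (a == 0).
Proof.
by case: a => a b; rewrite /sqn paddr_eq0 ?sqr_ge0//= !sqrf_eq0 eq_complex.
Qed.

Lemma sqn_gt0 (a : R[i]) : (0 < sqn a) = (a != 0).
Proof. by rewrite lt_def sqn_ge0 andbT sqn_eq0. Qed.

Lemma invcE (a : R[i]) : a^-1 = (Re a / sqn a) -i* (Im a / sqn a).
Proof. by case: a. Qed.

Lemma continuous_horner P :
  continuous (fun z => Re P.[pt z]) /\ continuous (fun z => Im P.[pt z]).
Proof.
elim/poly_ind: P => [|P a [cR cI]].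
  split => z; under eq_fun do rewrite horner0; exact: cvg_cst.
have c1 : continuous (fun z : R * R => z.1) by move=> z; exact: cvg_fst.
have c2 : continuous (fun z : R * R => z.2) by move=> z; exact: cvg_snd.
split => z.
  under eq_fun do rewrite hornerMXaddC cReD cReM /=.
  apply: cvgD; last exact: cvg_cst.
  by apply: cvgB; apply: cvgM; [exact: cR|exact: c1|exact: cI|exact: c2].
under eq_fun do rewrite hornerMXaddC cImD cImM /=.
apply: cvgD; last exact: cvg_cst.
by apply: cvgD; apply: cvgM; [exact: cR|exact: c2|exact: cI|exact: c1].
Qed.

Lemma continuous_sqn_horner P : continuous (fun z => sqn P.[pt z]).
Proof.
have [cR cI] := continuous_horner P.
by move=> z; apply: cvgD; apply: cvgM; [exact: cR..|exact: cI|exact: cI].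
Qed.

Lemma continuous_Re_ratio P Q z : Q.[pt z] != 0 ->
  {for z, continuous (fun z => Re (P.[pt z] / Q.[pt z]))}.
Proof.
move=> Q0; have [cR cI] := continuous_horner P.
have [dR dI] := continuous_horner Q.
have cV : (sqn Q.[pt w])^-1 @[w --> z] --> (sqn Q.[pt z])^-1.
  by apply: cvgV; [rewrite sqn_eq0|exact: continuous_sqn_horner].
rewrite /prop_for /continuous_at; under eq_fun do rewrite cReM invcE /=.
rewrite cReM invcE /=.
apply: cvgB; apply: cvgM.
- exact: cR.
- by apply: cvgM => //; exact: dR.
- exact: cI.
- by apply: cvgN; apply: cvgM => //; exact: dI.
Qed.

Lemma pt_cross x y s : [/\ pt (x + s, y) = pt (x, y) + s%:C,
  pt (x - s, y) = pt (x, y) - s%:C,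
  pt (x, y + s) = pt (x, y) + 'i * s%:C &
  pt (x, y - s) = pt (x, y) - 'i * s%:C].
Proof. by rewrite /pt /=; split; simpc. Qed.

(** Dividing twice by [z - z0] gives [P / Q = c + g h + h^2 (H / Q)] with
    [h = z - z0].  The linear terms cancel over the four points, and so do the
    quadratic ones, up to the oscillation of [H / Q], since the squares of the
    four displacements sum to 0. *)
Lemma cross_Re_ratio P Q (a : R[i]) x y e : Q.[pt (x, y)] != 0 -> 0 < e ->
  exists2 s0, 0 < s0 & forall s, 0 < s < s0 ->
    `|cross (fun z => Re (a * (P.[pt z] / Q.[pt z]))) x y s
      - 4 * Re (a * (P.[pt (x, y)] / Q.[pt (x, y)]))| <= e * s ^+ 2.
Proof.
move=> Q0 e0; set z0 := pt (x, y).
pose c := P.[z0] / Q.[z0].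
have [G GE] : exists G, P - c *: Q = G * ('X - z0%:P).
  by apply/factor_theorem; rewrite /root !hornerE divfK// subrr.
pose g := G.[z0] / Q.[z0].
have [H HE] : exists H, G - g *: Q = H * ('X - z0%:P).
  by apply/factor_theorem; rewrite /root !hornerE divfK// subrr.
have expand h : Q.[z0 + h] != 0 ->
    P.[z0 + h] / Q.[z0 + h] = c + g * h + h ^+ 2 * (H.[z0 + h] / Q.[z0 + h]).
  move=> Qh; apply: (mulIf Qh); rewrite divfK//.
  have h1 : P.[z0 + h] - c * Q.[z0 + h] = G.[z0 + h] * h.
    by have := congr1 (horner^~ (z0 + h)) GE; rewrite !hornerE [z0 + h]addrC addrK.
  have h2 : G.[z0 + h] - g * Q.[z0 + h] = H.[z0 + h] * h.
    by have := congr1 (horner^~ (z0 + h)) HE; rewrite !hornerE [z0 + h]addrC addrK.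
  rewrite [RHS]mulrDl -(mulrA (h ^+ 2)) divfK//.
  have -> : P.[z0 + h] = G.[z0 + h] * h + c * Q.[z0 + h] by rewrite -h1 subrK.
  have -> : G.[z0 + h] = H.[z0 + h] * h + g * Q.[z0 + h] by rewrite -h2 subrK.
  by move: c g {GE HE h1 h2} => c g; ring.
pose rho z := Re ((a *: H).[pt z] / Q.[pt z]).
have crho : {for (x, y), continuous rho} by apply: continuous_Re_ratio.
have near_rho : \forall z \near (x, y),
    `|rho (x, y) - rho z| <= e / 4 /\ Q.[pt z] != 0.
  near=> z; split.
    near: z; apply: (@cvgr_dist_le _ _ _ _ _ rho (rho (x, y))) => //.
    by rewrite divr_gt0.
  rewrite -sqn_gt0; near: z.
  apply: (@cvgr_gt _ _ _ _ _ (sqn Q.[pt (x, y)])); rewrite ?sqn_gt0//.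
  exact: continuous_sqn_horner.
have [s0 s00 hs] := near_cross near_rho.
exists s0 => // s ss0; have [[r1 q1] [r2 q2] [r3 q3] [r4 q4]] := hs s ss0.
move: r1 q1 r2 q2 r3 q3 r4 q4; rewrite /cross /rho.
have [-> -> -> ->] := pt_cross x y s; rewrite -/z0 => r1 q1 r2 q2 r3 q3 r4 q4.
rewrite !expand// -/c.
have E (b w h : R[i]) : Re (a * (c + b + h * (H.[w] / Q.[w]))) =
    Re (a * (c + b)) + Re (h * ((a *: H).[w] / Q.[w])).
  by rewrite -cReD hornerZ; congr (Re _); rewrite !mulrDr; congr (_ + _);
    rewrite mulrCA !mulrA.
have sq1 : (s%:C) ^+ 2 = (s ^+ 2)%:C :> R[i] by rewrite rmorphXn.
have sq2 : (- s%:C) ^+ 2 = (s ^+ 2)%:C :> R[i] by rewrite sqrrN rmorphXn.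
have sq3 : ('i * s%:C) ^+ 2 = (- s ^+ 2)%:C :> R[i].
  by rewrite exprMn sqr_i mulN1r rmorphN rmorphXn.
have sq4 : (- ('i * s%:C)) ^+ 2 = (- s ^+ 2)%:C :> R[i].
  by rewrite sqrrN sq3.
have F h : Re (a * (c + g * h)) = Re (a * c) + Re (a * g * h).
  by rewrite mulrDr cReD (mulrA a g).
rewrite !E sq1 sq2 sq3 sq4 !cReZ !F !mulrN !cReN.
move: r1 r2 r3 r4.
set r0 := Re (_.[z0] / _); set r1 := Re _; set r2 := Re _; set r3 := Re _.
set r4 := Re _ => h1 h2 h3 h4.
rewrite [X in `|X|](_ : _ = s ^+ 2 * ((r1 - r0) + (r2 - r0) - (r3 - r0)
  - (r4 - r0))); last by ring.
rewrite normrM ger0_norm ?sqr_ge0// mulrC ler_wpM2r ?sqr_ge0//.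
move: h1 h2 h3 h4; rewrite !ler_norml => /andP[? ?] /andP[? ?] /andP[? ?].
by move=> /andP[? ?]; apply/andP; split; lra.
Unshelve. all: end_near. Qed.

(** The four-point defect of [|F|^2] is bounded below by that of
    [2 Re (conj (F z0) F)], which is harmonic: this is why the modulus of a
    rational function has no interior maximum. *)
Lemma max_modulus K P Q c : compact K -> 0 <= c ->
  (forall z, K z -> Q.[pt z] != 0) ->
  (forall z, K z -> sqn P.[pt z] <= c * sqn Q.[pt z] \/
                    (\forall w \near z, K w)) ->
  forall z, K z -> sqn P.[pt z] <= c * sqn Q.[pt z].
Proof.
move=> cK c0 Q0 bnd z Kz.
have sV (w : R[i]) : sqn w^-1 = (sqn w)^-1.
  have [->|w0] := eqVneq w 0.
    by rewrite invr0 /sqn /= expr0n /= addr0 invr0.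
  apply: (@mulIf _ (sqn w)); first by rewrite sqn_eq0.
  rewrite mulVf ?sqn_eq0// -sqnM mulVf// /sqn /=.
  by rewrite expr1n expr0n addr0.
pose u z := sqn P.[pt z] / sqn Q.[pt z].
have uE w : u w = sqn (P.[pt w] / Q.[pt w]) by rewrite sqnM sV.
have qg w : K w -> 0 < sqn Q.[pt w] by move=> /Q0; rewrite sqn_gt0.
rewrite -ler_pdivrMr ?qg// -/(u z).
apply: (cross_max_principle cK) Kz.
  apply: continuous_in_subspaceT => w; rewrite inE => Kw.
  apply: cvgM; first exact: continuous_sqn_horner.
  by apply: cvgV; [rewrite sqn_eq0 Q0|exact: continuous_sqn_horner].
move=> x y Kxy; have [h|h] := bnd _ Kxy.
  by left; rewrite ler_pdivrMr// qg.
right; split=> // e e0.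
pose v := P.[pt (x, y)] / Q.[pt (x, y)].
have [s0 s00 hs] := @cross_Re_ratio P Q v^*%C x y (e / 2) (Q0 _ Kxy)
  (divr_gt0 e0 (ltr0Sn _ _)).
exists s0 => // s /hs; rewrite ler_norml => /andP[+ _].
rewrite /cross !uE -/v.
have sq (w : R[i]) : 2 * Re (v^*%C * w) - sqn v <= sqn w.
  rewrite cReM cReJ cImJ /sqn -subr_ge0.
  have -> : Re w ^+ 2 + Im w ^+ 2 - (2 * (Re v * Re w - - Im v * Im w) -
    (Re v ^+ 2 + Im v ^+ 2)) = (Re w - Re v) ^+ 2 + (Im w - Im v) ^+ 2 by ring.
  by rewrite addr_ge0 ?sqr_ge0.
have -> : Re (v^*%C * v) = sqn v by rewrite cReM cReJ cImJ /sqn; ring.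
have := sq (P.[pt (x + s, y)] / Q.[pt (x + s, y)]).
have := sq (P.[pt (x - s, y)] / Q.[pt (x - s, y)]).
have := sq (P.[pt (x, y + s)] / Q.[pt (x, y + s)]).
have := sq (P.[pt (x, y - s)] / Q.[pt (x, y - s)]).
lra.
Qed.

Lemma max_Re K P Q : compact K ->
  (forall z, K z -> Q.[pt z] != 0) ->
  (forall z, K z -> Re (P.[pt z] / Q.[pt z]) <= 0 \/
                    (\forall w \near z, K w)) ->
  forall z, K z -> Re (P.[pt z] / Q.[pt z]) <= 0.
Proof.
move=> cK Q0 bnd; apply: cross_max_principle => //.
  apply: continuous_in_subspaceT => w; rewrite inE => Kw.
  exact: continuous_Re_ratio (Q0 _ Kw).
move=> x y Kxy; have [h|h] := bnd _ Kxy; [by left|right; split=> // e e0].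
have [s0 s00 hs] := @cross_Re_ratio P Q 1 x y e (Q0 _ Kxy) e0.
exists s0 => // s /hs; rewrite ler_norml => /andP[+ _].
by rewrite /cross !mul1r.
Qed.

End maximum_principle.

(** * Reflection in a ray of a zero-free sector *)
Section reflection.
Context {R : realType}.
Implicit Types (p : {poly R}) (P Q : {poly R[i]}) (t x y s d : R).

Definition cis y : R[i] := cos y +i* sin y.

Lemma cisD x y : cis (x + y) = cis x * cis y.
Proof. by rewrite /cis cosD sinD; simpc; congr (_ +i* _); ring. Qed.

Lemma cisN x : cis (- x) = (cis x)^*%C.
Proof. by rewrite /cis cosN sinN. Qed.

Lemma norm_cis x : `|cis x| = 1.
Proof. by rewrite normc_def /= cos2Dsin2 sqrtr1. Qed.

Definition polyRC p : {poly R[i]} := map_poly (real_complex R) p.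

Lemma polyRCB p q : polyRC (p - q) = polyRC p - polyRC q.
Proof. exact: rmorphB. Qed.

Lemma polyRCM p q : polyRC (p * q) = polyRC p * polyRC q.
Proof. exact: rmorphM. Qed.

Lemma polyRCX : polyRC 'X = 'X. Proof. exact: map_polyX. Qed.

Lemma polyRCC x : polyRC x%:P = x%:C%:P. Proof. exact: map_polyC. Qed.

Lemma polyRCZ x p : polyRC (x *: p) = x%:C *: polyRC p.
Proof. exact: map_polyZ. Qed.

Lemma polyRC_conj p (z : R[i]) : (polyRC p).[z^*%C] = ((polyRC p).[z])^*%C.
Proof.
rewrite !horner_coef rmorph_sum /=; apply: eq_bigr => i _.
by rewrite rmorphM rmorphXn /= coef_map conjc_real.
Qed.

Lemma horner_polyRC p x : (polyRC p).[x%:C] = (p.[x])%:C.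
Proof. exact: horner_map. Qed.

Lemma sqnE (z : R[i]) : (sqn z)%:C = `|z| ^+ 2.
Proof. exact: add_Re2_Im2. Qed.

Lemma sqn_le (z w : R[i]) : (sqn z <= sqn w) = (`|z| <= `|w|).
Proof. by rewrite -lecR !sqnE ler_sqr// ?nnegrE. Qed.

Lemma sqnJ (z : R[i]) : sqn z^*%C = sqn z.
Proof. by rewrite /sqn cReJ cImJ sqrrN. Qed.

Lemma norm_polyRC p (z : R[i]) : (forall k, 0 <= p`_k) ->
  `|(polyRC p).[z]| <= (polyRC p).[`|z|].
Proof.
move=> p0; rewrite !horner_coef; apply: le_trans (ler_norm_sum _ _ _) _.
apply: ler_sum => i _; rewrite normrM normrX coef_map /= ger0_norm//.
by rewrite ler0c.
Qed.

Lemma is_derive_horner_cis P t y :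
  is_derive y 1 (fun y => Re P.[t%:C * cis y])
    (Re ('i * (t%:C * cis y) * P^`().[t%:C * cis y])) /\
  is_derive y 1 (fun y => Im P.[t%:C * cis y])
    (Im ('i * (t%:C * cis y) * P^`().[t%:C * cis y])).
Proof.
elim/poly_ind: P => [|P a [dR dI]].
  rewrite deriv0 horner0 mulr0 /=.
  by split; under eq_fun do rewrite horner0; exact: is_derive_cst.
have dc : is_derive y 1 (fun y => Re (t%:C * cis y)) (- (t * sin y)).
  under eq_fun do rewrite /= mul0r subr0.
  by apply: is_derive_eq; rewrite /GRing.scale /= mulrN.
have ds : is_derive y 1 (fun y => Im (t%:C * cis y)) (t * cos y).
  under eq_fun do rewrite /= mul0r addr0.
  exact: is_derive_eq.
split.
  under eq_fun do rewrite hornerMXaddC cReD cReM.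
  apply: is_derive_eq.
  rewrite derivD derivM derivX derivC !hornerE !(cReM, cImM, cReD, cImD) /= /GRing.scale /=.
  ring.
under eq_fun do rewrite hornerMXaddC cImD cImM.
apply: is_derive_eq.
rewrite derivD derivM derivX derivC !hornerE !(cReM, cImM, cReD, cImD) /= /GRing.scale /=.
ring.
Qed.

(** A one-sided maximum at 0 suffices for the sign of the derivative. *)
Lemma derive_le0_right (D : R -> R) (e l : R) : is_derive (0 : R) (1 : R) D l -> 0 < e ->
  (forall s, 0 < s < e -> D s <= D 0) -> l <= 0.
Proof.
move=> [dD <-] e0 De; rewrite leNgt; apply/negP => l0.
have /cvgr_gt /(_ _ l0) := dD.
move=> [e1 /= e10 h1].
pose s := Num.min e e1 / 2.
have m0 : 0 < Num.min e e1 by rewrite lt_min e0.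
have s0 : 0 < s by rewrite divr_gt0.
have : s < Num.min e e1 by rewrite /s; lra.
rewrite lt_min => /andP[se se1].
have := h1 s; rewrite /= sub0r normrN gtr0_norm// gt_eqF// => /(_ se1 isT).
rewrite addr0 /GRing.scale /= mulr1 pmulr_rgt0 ?invr_gt0// subr_gt0.
by rewrite ltNge De// s0.
Qed.

(** The modulus as an element of [R]: the norm of [R[i]] takes its values in
    [R[i]], where the order is only partial. *)
Definition md (z : R[i]) : R := Num.sqrt (sqn z).

Lemma mdE (z : R[i]) : `|z| = (md z)%:C.
Proof. exact: normc_def. Qed.

Lemma md_ge0 (z : R[i]) : 0 <= md z. Proof. exact: sqrtr_ge0. Qed.

Lemma sqr_md (z : R[i]) : md z ^+ 2 = sqn z.
Proof. by rewrite sqr_sqrtr ?sqn_ge0. Qed.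

Lemma mdM (z w : R[i]) : md (z * w) = md z * md w.
Proof. by apply: complexI; rewrite rmorphM /= -!mdE normrM. Qed.

Lemma mdX (z : R[i]) n : md (z ^+ n) = md z ^+ n.
Proof. by apply: complexI; rewrite rmorphXn /= -!mdE normrX. Qed.

Lemma mdN (z : R[i]) : md (- z) = md z.
Proof. by apply: complexI; rewrite -!mdE normrN. Qed.

Lemma le_mdD (z w : R[i]) : md (z + w) <= md z + md w.
Proof. by rewrite -lecR rmorphD /= -!mdE ler_normD. Qed.

Lemma md_real x : md x%:C = `|x|.
Proof. by rewrite /md /sqn /= expr0n addr0 sqrtr_sqr. Qed.

Lemma md_cis x : md (cis x) = 1.
Proof. by apply: complexI; rewrite -mdE norm_cis. Qed.

Lemma md_sum n (F : 'I_n -> R[i]) : md (\sum_(i < n) F i) <= \sum_(i < n) md (F i).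
Proof.
rewrite -lecR rmorph_sum /= -mdE; apply: le_trans (ler_norm_sum _ _ _) _.
by apply: ler_sum => i _; rewrite mdE.
Qed.

(** Far from the origin the leading term dominates, so a polynomial has almost
    constant modulus on large circles. *)
Lemma horner_same_circle p n (eta : R) : (forall k, 0 <= p`_k) -> size p = n.+2 ->
  0 < eta -> exists2 M, 1 <= M & forall z w : R[i], md z = md w -> M <= md z ->
    sqn (polyRC p).[w] <= (1 + eta) * sqn (polyRC p).[z].
Proof.
move=> p0 sp eta0; pose S := \sum_(i < n.+1) p`_i; pose a := p`_n.+1.
have a0 : 0 < a.
  rewrite lt_def p0 andbT /a.
  have : lead_coef p != 0 by rewrite lead_coef_eq0 -size_poly_eq0 sp.
  by rewrite lead_coefE sp.
have S0 : 0 <= S by apply: sumr_ge0 => i _; exact: p0.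
pose k := Num.min (1 / 2) (eta / 16).
have k0 : 0 < k by rewrite lt_min !divr_gt0.
have [k1 k2] : k <= 1 / 2 /\ k <= eta / 16.
  by rewrite /k !ge_min !lexx orbT.
exists (Num.max 1 (S / (k * a))); first by rewrite le_max lexx.
move=> z w zw; rewrite ge_max => /andP[z1].
rewrite ler_pdivrMr ?mulr_gt0// => Sz.
have E v : (polyRC p).[v] =
    \sum_(i < n.+1) (p`_i)%:C * v ^+ i + a%:C * v ^+ n.+1.
  rewrite horner_coef size_map_inj_poly//; last exact: complexI.
  by rewrite sp big_ord_recr /= coef_map; congr (_ + _); apply: eq_bigr => i _;
    rewrite coef_map.
have low v : md v = md z ->
    md (\sum_(i < n.+1) (p`_i)%:C * v ^+ i) <= S * md z ^+ n.
  move=> vz; apply: le_trans (md_sum _) _; rewrite /S mulr_suml; apply: ler_sum => i _.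
  rewrite mdM md_real ger0_norm// mdX vz ler_wpM2l// ler_weXn2l//.
  by rewrite -ltnS.
pose A := a * md z ^+ n.+1; pose B := S * md z ^+ n.
have BA : B <= k * A.
  rewrite /B /A exprS; apply: le_trans (_ : md z * (k * a) * md z ^+ n <= _).
    by rewrite ler_wpM2r ?exprn_ge0 ?md_ge0.
  by rewrite le_eqVlt; apply/orP; left; apply/eqP; ring.
have A0 : 0 <= A by rewrite mulr_ge0 ?exprn_ge0 ?md_ge0 ?ltW.
have B0 : 0 <= B by rewrite mulr_ge0 ?exprn_ge0 ?md_ge0.
have up : md (polyRC p).[w] <= A + B.
  rewrite E; apply: le_trans (le_mdD _ _) _; rewrite addrC lerD ?low//.
  by rewrite mdM mdX md_real gtr0_norm// -zw.
have dn : A - B <= md (polyRC p).[z].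
  have := le_mdD (polyRC p).[z] (- \sum_(i < n.+1) (p`_i)%:C * z ^+ i).
  rewrite mdN E addrAC subrr add0r mdM md_real gtr0_norm// mdX -/A.
  have := low z erefl; rewrite -/B -E; lra.
have kA : k * A <= 1 / 2 * A by rewrite ler_wpM2r.
have AB : 0 <= A - B by lra.
rewrite -!sqr_md; apply: (@le_trans _ _ ((A + B) ^+ 2)).
  by rewrite ler_sqr ?nnegrE ?md_ge0// addr_ge0.
apply: (@le_trans _ _ ((1 + eta) * (A - B) ^+ 2)); last first.
  rewrite ler_wpM2l//; first by rewrite addr_ge0 ?ltW.
  by rewrite ler_sqr ?nnegrE ?md_ge0.
rewrite -subr_ge0.
have -> : (1 + eta) * (A - B) ^+ 2 - (A + B) ^+ 2 =
  eta * (A - B) ^+ 2 - 4 * A * B by ring.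
have h1 : (A / 2) ^+ 2 <= (A - B) ^+ 2.
  by rewrite ler_sqr ?nnegrE//; lra.
have h2 : A * B <= A * (k * A) by rewrite ler_wpM2l.
have h3 : A * A * k <= A * A * (eta / 16) by rewrite ler_wpM2l// mulr_ge0.
have h4 : eta * (A / 2) ^+ 2 <= eta * (A - B) ^+ 2 by rewrite ler_wpM2l// ltW.
nra.
Qed.

Definition sector_free d p := [/\ forall k, 0 <= p`_k, 0 < p`_0 &
  forall t y, 0 < t -> `|y| < d -> (polyRC p).[t%:C * cis y] != 0].

Lemma polar_form (z : R[i]) : z != 0 ->
  exists t, exists2 y, 0 < t /\ - pi <= y <= pi & z = t%:C * cis y.
Proof.
by move=> /is_arg_exists[y [ypi [t t0 zE]]]; exists t; exists y.
Qed.

(** The quotient [p (exp (-2 i y0) z) / p z] is holomorphic in the sector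
    [0 <= arg z <= y0], of modulus 1 on the ray [arg z = y0] by conjugation, at
    most 1 on the positive axis since the coefficients are nonnegative, and
    tends to modulus 1 at infinity. *)
Lemma reflection_le d p n y0 t y : sector_free d p -> size p = n.+2 ->
  d <= pi / 2 -> 0 < y0 < d -> 0 < t -> 0 <= y <= y0 ->
  sqn (polyRC p).[t%:C * cis (2 * y0 - y)] <= sqn (polyRC p).[t%:C * cis y].
Proof.
move=> [p0 p00 pz] sp dpi /andP[y00 y0d] t0 /andP[yge0 yley0].
have pi0 := pi_gt0 R.
have cy0 : 0 < cos y0 by apply: cos_gt0_pihalf; lra.
have sy0 : 0 < sin y0 by apply: sin_gt0_pi; lra.
pose Q := polyRC p; pose rot : {poly R[i]} := (cis (- (2 * y0))) *: 'X.
pose P := Q \Po rot.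
have PE z : P.[z] = Q.[cis (- (2 * y0)) * z].
  by rewrite horner_comp hornerZ hornerX.
have dE u : (2 * y0 - u) = - (- (2 * y0) + u) by ring.
have refl (u v : R) : sqn Q.[u%:C * cis (2 * y0 - v)] = sqn P.[u%:C * cis v].
  rewrite PE dE cisN -{1}(conjc_real u) -rmorphM polyRC_conj sqnJ cisD.
  by congr (sqn Q.[_]); ring.
rewrite refl -/Q.
suff H eta : 0 < eta -> sqn P.[t%:C * cis y] <= (1 + eta) * sqn Q.[t%:C * cis y].
  apply/ler_addgt0Pr => e e0.
  pose s := sqn Q.[t%:C * cis y].
  have s0 : 0 <= s := sqn_ge0 _.
  have := H (e / (1 + s)); rewrite divr_gt0 ?ltr_wpDr// => /(_ isT) h.
  apply: (le_trans h); rewrite -/s mulrDl mul1r lerD2l -mulrA ler_piMr ?ltW//.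
  by rewrite mulrC ltr_pdivrMr ?ltr_wpDr// mul1r ltrDr.
move=> eta0; have [M M1 hM] := horner_same_circle p0 sp eta0.
pose M' := Num.max M t.
(* The sector is truncated by a vertical line and not by an arc: the maximum
   principle is applied on a compact triangle. *)
pose K : set (R * R) := (`[0, M'] `*` `[0, M' * sin y0 / cos y0]) `&`
  [set z | z.2 * cos y0 - z.1 * sin y0 <= 0].
have M'0 : 0 < M' by rewrite lt_max t0 orbT.
have cK : compact K.
  apply: compact_closedI.
    by apply: compact_setX; exact: segment_compact.
  apply: (@closed_comp _ _ (fun z : R * R => z.2 * cos y0 - z.1 * sin y0)
    [set x | x <= 0]); last exact: closed_le.
  move=> z _; apply: cvgB; apply: cvgM;
    by [exact: cvg_snd|exact: cvg_fst|exact: cvg_cst].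
have KP x v : K (x, v) <-> [/\ 0 <= x <= M', 0 <= v & v * cos y0 <= x * sin y0].
  rewrite /K /= !in_itv /= subr_le0; split; first by move=> [[-> /andP[-> _]] ->].
  move=> [/andP[x0 xM] v0 vx]; rewrite x0 xM v0 vx; split=> //; split=> //=.
  rewrite ler_pdivlMr//; apply: (le_trans vx); rewrite ler_wpM2r//; exact: ltW.
have Karg z : K z -> pt z != 0 -> exists u v,
    [/\ 0 < u, 0 <= v <= y0 & pt z = u%:C * cis v].
  case: z => x v /KP[/andP[x0 xM] v0 vx] /polar_form[u [w [u0 /andP[w1 w2]]]].
  rewrite /pt /cis /=; simpc => -[xE vE]; exists u, w; split=> //.
    2: by rewrite xE vE; simpc.
  have sw : 0 <= sin w by move: v0; rewrite vE pmulr_rge0.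
  have cw : 0 <= cos w by move: x0; rewrite xE pmulr_rge0.
  have w0 : 0 <= w.
    rewrite leNgt; apply/negP => wlt.
    have : 0 < sin (- w) \/ - w = pi.
      have [|h] := ltP (- w) pi; last by right; apply/eqP; rewrite eq_le h; lra.
      by move=> h; left; apply: sin_gt0_pi; lra.
    case=> [|wpi]; first by rewrite sinN; lra.
    by move: cw; rewrite -cosN wpi cospi; lra.
  rewrite w0 /= leNgt; apply/negP => wy0.
  have : 0 < sin (w - y0) by apply: sin_gt0_pi; lra.
  rewrite sinB => h; move: vx; rewrite xE vE -subr_ge0.
  have -> : u * cos w * sin y0 - u * sin w * cos y0 =
    - (u * (sin w * cos y0 - cos w * sin y0)) by ring.
  by rewrite oppr_ge0 pmulr_rle0// leNgt h.
have pos0 : Q.[0] != 0.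
  rewrite horner_coef0 coef_map /=; apply/eqP => -[] /eqP.
  by rewrite gt_eqF.
have Q0 z : K z -> Q.[pt z] != 0.
  move=> Kz; have [->//|z0] := eqVneq (pt z) 0.
  have [u [v [u0 /andP[v0 v1] ->]]] := Karg _ Kz z0.
  by apply: pz => //; rewrite ger0_norm//; lra.
have := @max_modulus R K P Q (1 + eta) cK _ Q0 _ (t * cos y, t * sin y).
rewrite /pt /= (_ : (t * cos y) +i* (t * sin y) = t%:C * cis y); last by simpc.
apply=> //; first by rewrite addr_ge0// ltW.
- move=> [x v] Kxv; have /KP[/andP[x0 xM] v0 vx] := Kxv.
  have [v00|vpos] := eqVneq v 0.
    left; rewrite v00 PE /pt /=; apply: (@le_trans _ _ (1 * sqn Q.[x +i* 0])).
      rewrite mul1r sqn_le /Q; apply: le_trans (norm_polyRC _ p0) _.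
      rewrite normrM norm_cis mul1r complexr0 ger0_norm ?ler0c// horner_polyRC.
      by apply: real_ler_norm; rewrite complex_real.
    by rewrite ler_wpM2r ?sqn_ge0// lerDl ltW.
  have [vx'|vx'] := eqVneq (v * cos y0) (x * sin y0).
    left; rewrite -/(pt (x, v)); apply: (@le_trans _ _ (1 * sqn Q.[pt (x, v)])); last first.
      by rewrite ler_wpM2r ?sqn_ge0// lerDl ltW.
    have -> : pt (x, v) = (v / sin y0)%:C * cis y0.
      rewrite /pt /cis /=; simpc; congr (_ +i* _); last by rewrite divfK ?gt_eqF.
      by rewrite mulrAC vx' mulfK ?gt_eqF.
    rewrite -(refl (v / sin y0) y0) mul1r (_ : 2 * y0 - y0 = y0)//; ring.
  have [xM'|xM'] := eqVneq x M'.
    left; rewrite -/(pt (x, v)) PE; apply: hM; first by rewrite mdM md_cis mul1r.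
    apply: (@le_trans _ _ M'); first by rewrite le_max lexx.
    rewrite -xM' -[leLHS]ger0_norm// -sqrtr_sqr ler_sqrt ?sqn_ge0//.
    by rewrite /sqn /= lerDl sqr_ge0.
  right.
  have vpos' : 0 < v by rewrite lt_def vpos.
  have vx2 : v * cos y0 < x * sin y0 by rewrite lt_def eq_sym vx'.
  have x0' : 0 < x.
    by rewrite -(pmulr_lgt0 _ sy0); apply: lt_trans vx2; rewrite mulr_gt0.
  have xM2 : x < M' by rewrite lt_def eq_sym xM'.
  have c1 : continuous (fun z : R * R => z.1) by move=> z; exact: cvg_fst.
  have c2 : continuous (fun z : R * R => z.2) by move=> z; exact: cvg_snd.
  have c3 : continuous (fun z : R * R => z.1 * sin y0 - z.2 * cos y0).
    by move=> z; apply: cvgB; apply: cvgM;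
      [exact: cvg_fst|exact: cvg_cst|exact: cvg_snd|exact: cvg_cst].
  near=> w; rewrite [w]surjective_pairing; apply/KP; split.
  + apply/andP; split; apply: ltW; near: w.
      exact: (cvgr_gt _ (c1 (x, v))).
    exact: (cvgr_lt _ (c1 (x, v))).
  + by apply: ltW; near: w; exact: (cvgr_gt _ (c2 (x, v))).
  + rewrite -subr_ge0; apply: ltW; near: w.
    by apply: (cvgr_gt _ (c3 (x, v))); rewrite /= subr_gt0.
- apply/KP; split.
  + rewrite mulr_ge0 ?(ltW t0)//=; last by apply: cos_ge0_pihalf; lra.
    apply: (@le_trans _ _ t); last by rewrite le_max lexx orbT.
    by rewrite ler_piMr ?cos_le1// ltW.
  + by rewrite mulr_ge0 ?(ltW t0)//; apply: sin_ge0_pi; lra.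
  + rewrite -!mulrA ler_pM2l// -subr_ge0.
    have -> : cos y * sin y0 - sin y * cos y0 = sin (y0 - y).
      by rewrite sinB; ring.
    by apply: sin_ge0_pi; lra.
Unshelve. all: end_near. Qed.

Lemma is_derive_sym_diff (A : R -> R) y l : is_derive y 1 A l ->
  is_derive (0 : R) (1 : R) (fun s => A (y + s) - A (y - s)) (2 * l).
Proof.
move=> dA.
have h1 : is_derive (0 : R) (1 : R) (fun s => A (y + s)) l.
  have dA' : is_derive (y + 0) 1 A l by rewrite addr0.
  have := @is_derive1_comp _ A (fun s => y + s) 0 l 1 dA'.
  rewrite mulr1; apply.
  by apply: is_derive_eq; rewrite add0r mulr1.
have h2 : is_derive (0 : R) (1 : R) (fun s => A (y - s)) (- l).
  have dA' : is_derive (y - 0) 1 A l by rewrite subr0.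
  have := @is_derive1_comp _ A (fun s => y - s) 0 l (- 1) dA'.
  rewrite mulrN1; apply.
  by apply: is_derive_eq; rewrite add0r ?mulr1 ?mulrN1.
by apply: is_derive_eq; ring.
Qed.

(** By reflection, [|p|^2] at argument [y + s] is at most its value at [y - s];
    hence its derivative in the argument is nonpositive at [y], and this derivative is
    [-2 Im (z p' conj p)]. *)
Lemma Im_mean_ge0 d p n t y z : sector_free d p -> size p = n.+2 ->
  d <= pi / 2 -> 0 < y < d -> 0 < t -> z = t%:C * cis y ->
  0 <= Im (z * (polyRC p)^`().[z] * ((polyRC p).[z])^*%C).
Proof.
move=> sf sp dpi yd t0 zE.
set P := polyRC p.
have [dR dI] := is_derive_horner_cis P t y.
pose A u := sqn P.[t%:C * cis u].
have dA : is_derive y 1 A (- 2 * Im (z * P^`().[z] * (P.[z])^*%C)).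
  rewrite /A /sqn; apply: is_derive_eq.
  rewrite -zE /GRing.scale /= !(cImM, cReM) cReJ cImJ /=; ring.
have := derive_le0_right (is_derive_sym_diff dA) (e := y).
have /andP[y0 _] := yd; rewrite y0 => /(_ isT) h.
suff : 2 * (- 2 * Im (z * P^`().[z] * P.[z]^*%C)) <= 0 by lra.
apply: h => s /andP[s0 sy]; rewrite addr0 subr0 subrr subr_le0 /A.
have := @reflection_le d p n y t (y - s) sf sp dpi yd t0.
rewrite (_ : 2 * y - (y - s) = y + s); last by ring.
by apply; lra.
Qed.

End reflection.

(** * Schwarz's lemma in a disc around 1 *)
Section disc.
Context {R : realType}.
Implicit Types (p g k : {poly R}) (P Q : {poly R[i]}) (t x y s d r : R).

(** The disc [|z - 1| <= r] is seen from the origin under the half-angle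
    [asin r]. *)
Lemma sector_disc d r (z : R[i]) : 0 < d <= pi / 2 -> 0 < r < sin d ->
  sqn (z - 1) <= r ^+ 2 ->
  exists t, exists2 y, 0 < t /\ `|y| < d & z = t%:C * cis y.
Proof.
move=> /andP[d0 dpi] /andP[r0 rd] zr.
have sd1 : sin d <= 1 := sin_le1 d.
have r2 : r ^+ 2 < 1 by rewrite expr_lt1 ?ltW//; lra.
have z0 : z != 0.
  apply/eqP => zE; move: zr; rewrite zE sub0r /sqn /= oppr0 expr0n addr0 sqrrN expr1n.
  by rewrite leNgt r2.
have [t [y [t0 /andP[y1 y2]] zE]] := polar_form z0.
exists t, y => //; split=> //; rewrite ltNge; apply/negP => dy.
have yE : sqn (z - 1) = (t - cos y) ^+ 2 + sin y ^+ 2.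
  rewrite zE /cis /sqn; simpc; rewrite /=.
  have := cos2Dsin2 y; nra.
have [yp|yp] := leP `|y| (pi / 2).
  have sy : sin d <= `|sin y|.
    have -> : `|sin y| = sin `|y|.
      have [y0|y0] := ger0P y.
        by rewrite ger0_norm// sin_ge0_pi//; lra.
      have : 0 <= sin (- y) by apply: sin_ge0_pi; lra.
      by move=> h; rewrite -normrN -sinN ger0_norm.
    have := pi_gt0 R => pi0.
    rewrite leNgt; apply/negP; rewrite ltr_sin ?in_itv /=; first by lra.
      by apply/andP; split; lra.
    by apply/andP; split; lra.
  have : r ^+ 2 < sin y ^+ 2.
    rewrite -(real_normK (num_real (sin y))).
    rewrite ltr_sqr ?nnegrE ?normr_ge0 ?(ltW r0)//; lra.
  by have := sqr_ge0 (t - cos y); lra.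
have cy : cos y <= 0.
  rewrite -cos_norm -(subrK (pi / 2) `|y|) cosDpihalf oppr_le0.
  have : `|y| <= pi by rewrite ler_norml y1.
  by move=> ypi; apply: sin_ge0_pi; lra.
have := cos2Dsin2 y; nra.
Qed.

Lemma horner_derivRC p (z : R[i]) : (polyRC p)^`().[z] = (polyRC p^`()).[z].
Proof. by rewrite deriv_map. Qed.

Lemma continuous_sqn_center : continuous (fun z : R * R => sqn (pt z - 1)).
Proof.
have := @continuous_sqn_horner R ('X - 1%:P).
by under eq_fun do rewrite !hornerE.
Qed.

Lemma compact_disc r : 0 < r ->
  compact [set z : R * R | sqn (pt z - 1) <= r ^+ 2].
Proof.
move=> r0; apply: (@subclosed_compact _ _ (`[1 - r, 1 + r] `*` `[- r, r])).
- apply: (@closed_comp _ _ (fun z : R * R => sqn (pt z - 1))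
    [set x | x <= r ^+ 2]); last exact: closed_le.
  by move=> w _; exact: continuous_sqn_center.
- by apply: compact_setX; exact: segment_compact.
- move=> [x y]; rewrite /sqn /pt /= subr0 !in_itv /= => h.
  have hx : `|x - 1| <= r.
    by rewrite -ler_sqr ?nnegrE ?(ltW r0)// real_normK ?num_real//; have := sqr_ge0 y; lra.
  have hy : `|y| <= r.
    rewrite -ler_sqr ?nnegrE ?(ltW r0)// real_normK ?num_real//.
    by have := sqr_ge0 (x - 1); lra.
  by move: hx hy; rewrite !ler_norml => /andP[? ?] /andP[? ?]; split;
    apply/andP; split; lra.
Qed.

Lemma disc_boundary r (w : R * R) : sqn (pt w - 1) <= r ^+ 2 ->
  sqn (pt w - 1) = r ^+ 2 \/ \forall v \near w, sqn (pt v - 1) <= r ^+ 2.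
Proof.
move=> h; have [wr|wr] := eqVneq (sqn (pt w - 1)) (r ^+ 2); first by left.
right; near=> v; apply: ltW; near: v.
by apply: (cvgr_lt _ (@continuous_sqn_center w)); rewrite lt_def eq_sym wr.
Unshelve. all: end_near. Qed.

(** On the circle [|h| = r], with [h = z - 1], one has [r^2 - h^2 = h (conj h - h)],
    so that [(r^2 - h^2) (m - mu) / h = - 2 i (Im h) (m - mu)], whose real part
    is [2 Im h Im m >= 0]; the sign then propagates inside. *)
Lemma disc_Re_ge0 d p n r g (mu : R) : sector_free d p -> size p = n.+2 ->
  0 < d <= pi / 2 -> 0 < r < sin d ->
  'X * p^`() - mu *: p = g * ('X - 1%:P) ->
  forall z : R[i], sqn (z - 1) <= r ^+ 2 ->
  0 <= Re ((((r ^+ 2)%:C%:P - ('X - 1%:P) ^+ 2) * polyRC g).[z] / (polyRC p).[z]).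
Proof.
move=> sf sp dpi rd gE z zr; have [p0 p00 pz] := sf.
have /andP[d0 dpi'] := dpi.
set P := _ * polyRC g; set Q := polyRC p.
pose K := [set z : R * R | sqn (pt z - 1) <= r ^+ 2].
have /andP[r0 rs] := rd; have cK : compact K := compact_disc r0.
have Q0 w : K w -> Q.[pt w] != 0.
  by move=> /(sector_disc dpi rd)[t [y [t0 yd] ->]]; exact: pz.
have zE : pt (Re z, Im z) = z by case: (z).
have Kz : K (Re z, Im z) by rewrite /K /= zE.
have := @max_Re R K (- P) Q cK Q0 _ (Re z, Im z) Kz.
rewrite zE hornerN mulNr cReN oppr_le0; apply=> w Kw.
have [wr|] := disc_boundary Kw; last by right.
left; set v := pt w; rewrite hornerN mulNr cReN oppr_le0.
have Qv := Q0 _ Kw.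
pose m := v * Q^`().[v] / Q.[v].
have gEv : v * Q^`().[v] - mu%:C * Q.[v] = (polyRC g).[v] * (v - 1).
  have := congr1 (fun q => (polyRC q).[v]) gE.
  rewrite polyRCB polyRCM polyRCX polyRCZ polyRCM polyRCB polyRCX polyRCC.
  by rewrite !hornerE -horner_derivRC.
have PE : P.[v] / Q.[v] = (v - 1)^*%C * (m - mu%:C) - (v - 1) * (m - mu%:C).
  have -> : m - mu%:C = (polyRC g).[v] * (v - 1) / Q.[v].
    by rewrite -gEv mulrBl mulfK.
  have -> : P.[v] = ((v - 1) * (v - 1)^*%C - (v - 1) ^+ 2) * (polyRC g).[v].
    rewrite /P !hornerE; congr ((_ - _) * _).
    rewrite -wr -/v; case: (v - 1) => a b; rewrite /sqn; simpc => /=.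
    by congr (_ +i* _); ring.
  by ring.
have ReE : Re (P.[v] / Q.[v]) = 2 * Im (v - 1) * Im m.
  rewrite PE cReB !cReM cReJ cImJ (cImB m) /=; ring.
have ImE : Im m = Im (v * Q^`().[v] * (Q.[v])^*%C) / sqn Q.[v].
  by rewrite /m !cImM invcE cReJ cImJ /=; ring.
have vd : sqn (v - 1) <= r ^+ 2 := Kw.
have [t [y [t0 yd] vE]] := sector_disc dpi rd vd.
have pi0 := pi_gt0 R.
have Imv : Im (v - 1) = t * sin y by rewrite vE /cis; simpc.
rewrite ReE ImE Imv.
have sq0 := sqn_ge0 Q.[v].
have [y0|y0|y0] := ltrgtP 0 y.
- have sy : 0 <= sin y by apply: sin_ge0_pi; move: yd; rewrite gtr0_norm//; lra.
  have h := Im_mean_ge0 sf sp dpi' _ t0 vE.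
  rewrite mulr_ge0//; first by rewrite !mulr_ge0// ltW.
  by rewrite divr_ge0// h// y0; move: yd; rewrite gtr0_norm.
- have sy : 0 <= sin (- y) by apply: sin_ge0_pi; move: yd; rewrite ltr0_norm//; lra.
  have vE' : v^*%C = t%:C * cis (- y).
    by rewrite vE /cis cosN sinN; simpc.
  have := Im_mean_ge0 sf sp dpi' _ t0 vE'.
  move: (yd); rewrite ltr0_norm// => yd'; rewrite yd' oppr_gt0 y0 => /(_ isT).
  rewrite -/Q horner_derivRC !polyRC_conj -horner_derivRC -!rmorphM /= cImJ.
  rewrite sinN in sy; rewrite oppr_ge0 => h.
  rewrite -mulrNN mulr_ge0//; last by rewrite -mulNr divr_ge0// oppr_ge0.
  by rewrite -mulrN -mulrN mulr_ge0// mulr_ge0// ltW.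
- by rewrite -y0 sin0 !(mulr0, mul0r).
Qed.

(** Schwarz's lemma for the Cayley transform [(F - F(1)) / (F + F(1))] of the
    function [F] of [disc_Re_ge0], whose value at 1 is [r^2 a] when [a] is the
    variance.  All divisions by [z - 1] and by [p] are cleared: [k] is the
    quotient of the numerator of [F - r^2 a] by [z - 1]. *)
Lemma disc_schwarz d p n r g k (mu a : R) : sector_free d p -> size p = n.+2 ->
  0 < d <= pi / 2 -> 0 < r < sin d -> 0 < a ->
  'X * p^`() - mu *: p = g * ('X - 1%:P) ->
  ((r ^+ 2)%:P - ('X - 1%:P) ^+ 2) * g - (r ^+ 2 * a) *: p = k * ('X - 1%:P) ->
  forall z : R[i], sqn (z - 1) <= r ^+ 2 ->
  r * md (polyRC k).[z] <=
  2 * (r ^+ 2 * a) * md (polyRC p).[z] + md (z - 1) * md (polyRC k).[z].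
Proof.
move=> sf sp dpi rd a0 gE kE z zr; have [p0 p00 pz] := sf.
have /andP[r0 rs] := rd.
set b := r ^+ 2 * a; have b0 : 0 < b by rewrite mulr_gt0 ?exprn_gt0.
set K := polyRC k; set Q := polyRC p.
set W := ((r ^+ 2)%:C%:P - ('X - 1%:P) ^+ 2) * polyRC g.
have WE v : W.[v] = b%:C * Q.[v] + K.[v] * (v - 1).
  have := congr1 (fun q => (polyRC q).[v]) kE.
  rewrite polyRCB polyRCM polyRCB polyRCC polyRCZ polyRCM expr2 polyRCM -expr2.
  rewrite polyRCB polyRCX polyRCC hornerD hornerN hornerZ hornerM -/W -/K -/Q.
  rewrite [in X in _ = X -> _]hornerM [in X in _ = X -> _]hornerXsubC.
  by move=> h; apply/eqP; rewrite [X in _ == X]addrC -subr_eq; exact/eqP.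
pose D := [set z : R * R | sqn (pt z - 1) <= r ^+ 2].
have D0 v : D v -> Q.[pt v] != 0.
  by move=> /(sector_disc dpi rd)[t [y [t0 yd] ->]]; exact: pz.
have ReW v : D v -> 0 <= Re (W.[pt v] * (Q.[pt v])^*%C).
  move=> Dv; have := disc_Re_ge0 sf sp dpi rd gE Dv; rewrite -/W -/Q.
  have -> : W.[pt v] / Q.[pt v] =
      ((sqn Q.[pt v])^-1)%:C * (W.[pt v] * (Q.[pt v])^*%C).
    by rewrite invcE; case: W.[_] Q.[_] => [? ?] [? ?]; rewrite /sqn /=; simpc;
      congr (_ +i* _); ring.
  by rewrite cReZ pmulr_rge0// invr_gt0 sqn_gt0 D0.
pose U := W + b%:C *: Q.
have UE v : sqn U.[v] = sqn W.[v] + 2 * b * Re (W.[v] * (Q.[v])^*%C) +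
    b ^+ 2 * sqn Q.[v].
  rewrite /U hornerD hornerZ /sqn cReD cImD !(cReM, cImM) cReJ cImJ /=.
  by ring.
have zE : pt (Re z, Im z) = z by case: (z).
have Dz : D (Re z, Im z) by rewrite /D /= zE.
have r20 : 0 < r ^+ 2 by rewrite exprn_gt0.
have U0 v : D v -> U.[pt v] != 0.
  move=> Dv; rewrite -sqn_gt0 UE ltr_wpDl//.
    by rewrite addr_ge0 ?sqn_ge0// !mulr_ge0 ?ReW// ltW.
  by rewrite mulr_gt0 ?exprn_gt0// sqn_gt0 D0.
have := @max_modulus R D K U (r ^+ 2)^-1 (compact_disc r0) _ U0 _ _ Dz.
rewrite zE invr_ge0 (ltW r20) => /(_ isT) => H.
have {H} H : sqn K.[z] <= (r ^+ 2)^-1 * sqn U.[z].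
  apply: H => v Dv; have [h|] := disc_boundary Dv; last by right.
  left; rewrite ler_pdivlMl// -h -sqnM mulrC.
  have -> : K.[pt v] * (pt v - 1) = W.[pt v] - b%:C * Q.[pt v].
    by rewrite WE [RHS]addrAC subrr add0r.
  rewrite UE; have : 0 <= 2 * b * Re (W.[pt v] * (Q.[pt v])^*%C).
    by rewrite !mulr_ge0 ?ReW// ltW.
  rewrite /sqn cReB cImB !(cReM, cImM) cReJ cImJ /=.
  lra.
have {}H : r * md K.[z] <= md U.[z].
  rewrite -ler_sqr ?nnegrE ?mulr_ge0 ?md_ge0 ?(ltW r0)// exprMn !sqr_md.
  by rewrite -ler_pdivlMl.
apply: (le_trans H); rewrite /U hornerD hornerZ WE addrAC.
apply: le_trans (le_mdD _ _) _; rewrite mdM [X in _ + X]mulrC lerD2r.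
rewrite -mulrDl mdM -rmorphD md_real ger0_norm ?addr_ge0 ?(ltW b0)//.
by rewrite (_ : b + b = 2 * b)//; ring.
Qed.

(** At [z = 1] Schwarz's lemma bounds the derivative of [F], which encodes the
    second derivative of [m]. *)
Lemma disc_schwarz_center d p n r g k (mu a : R) : sector_free d p -> size p = n.+2 ->
  0 < d <= pi / 2 -> 0 < r < sin d -> 0 < a ->
  'X * p^`() - mu *: p = g * ('X - 1%:P) ->
  ((r ^+ 2)%:P - ('X - 1%:P) ^+ 2) * g - (r ^+ 2 * a) *: p = k * ('X - 1%:P) ->
  `|k.[1]| <= 2 * r * a * p.[1].
Proof.
move=> sf sp dpi rd a0 gE kE; have /andP[r0 rs] := rd.
have s1 : (1 : R[i]) = (1 : R)%:C by [].
have := disc_schwarz sf sp dpi rd a0 gE kE (z := 1).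
rewrite subrr {1}/sqn /= expr0n addr0 sqr_ge0 => /(_ isT).
rewrite [X in _ <= _ + X](_ : _ = 0); last first.
  by rewrite /md /sqn /= expr0n addr0 sqrtr0 mul0r.
rewrite addr0 s1 !horner_polyRC !md_real (ger0_norm (x := p.[1])); last first.
  by have [p0 _ _] := sf; rewrite horner_coef sumr_ge0// => i _; rewrite expr1n mulr1.
move=> h; rewrite -(ler_pM2l r0); apply: le_trans h _; lra.
Qed.

(** With [m z = z p' z / p z], this reads
    [|m z - mu - a (z - 1)| <= 6 a |z - 1|^2 / r]. *)
Lemma disc_mean_taylor d p n r g k (mu a : R) : sector_free d p -> size p = n.+2 ->
  0 < d <= pi / 2 -> 0 < r < sin d -> 0 < a ->
  'X * p^`() - mu *: p = g * ('X - 1%:P) ->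
  ((r ^+ 2)%:P - ('X - 1%:P) ^+ 2) * g - (r ^+ 2 * a) *: p = k * ('X - 1%:P) ->
  forall z : R[i], md (z - 1) <= r / 2 ->
  md (z * (polyRC p^`()).[z] - (mu%:C + a%:C * (z - 1)) * (polyRC p).[z]) <=
  6 * a / r * md (z - 1) ^+ 2 * md (polyRC p).[z].
Proof.
move=> sf sp dpi rd a0 gE kE z zr; have /andP[r0 rs] := rd.
have h0 := md_ge0 (z - 1).
have K := disc_schwarz sf sp dpi rd a0 gE kE (z := z).
have {}K : r * md (polyRC k).[z] <=
  2 * (r ^+ 2 * a) * md (polyRC p).[z] + md (z - 1) * md (polyRC k).[z].
  apply: K; rewrite -sqr_md ler_sqr ?nnegrE ?(ltW r0)//; lra.
have gz := congr1 (fun q => (polyRC q).[z]) gE.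
have kz := congr1 (fun q => (polyRC q).[z]) kE.
move: gz; rewrite polyRCB !polyRCM polyRCX polyRCZ polyRCB polyRCX polyRCC.
rewrite hornerD hornerN !hornerM hornerZ hornerX hornerXsubC => gz.
move: kz; rewrite polyRCB polyRCM polyRCB polyRCC polyRCZ polyRCM expr2 polyRCM -expr2.
rewrite polyRCB polyRCX polyRCC hornerD hornerN hornerZ hornerM.
rewrite [in X in X - _ = _ -> _]hornerD hornerN hornerM !hornerXsubC hornerC -expr2.
rewrite [in X in _ = X -> _]hornerM hornerXsubC => kz.
have s1 : (1 : R)%:C = 1 :> R[i] by []. rewrite !s1 in gz kz.
move: K gz kz; set f := (polyRC p).[z]; set f' := (polyRC _^`()).[z].
set gg := (polyRC g).[z]; set kk := (polyRC k).[z].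
set h := z - 1; rewrite -/h in zr h0 * => K gz kz.
have E1 : z * f' - (mu%:C + a%:C * h) * f = h * (gg - a%:C * f).
  rewrite [LHS](_ : _ = (z * f' - mu%:C * f) - a%:C * h * f); last by ring.
  by rewrite gz; ring.
have E2 : ((r ^+ 2)%:C - h ^+ 2) * (gg - a%:C * f) = h * kk + a%:C * h ^+ 2 * f.
  rewrite [LHS](_ : _ = ((r ^+ 2)%:C - h ^+ 2) * gg - (r ^+ 2)%:C * a%:C * f
    + a%:C * h ^+ 2 * f); last by ring.
  by rewrite -rmorphM kz; ring.
have M2 : 3 / 4 * r ^+ 2 <= md ((r ^+ 2)%:C - h ^+ 2).
  have := le_mdD ((r ^+ 2)%:C - h ^+ 2) (h ^+ 2).
  rewrite subrK md_real ger0_norm ?sqr_ge0// mdX.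
  have : md h ^+ 2 <= (r / 2) ^+ 2.
    by rewrite ler_sqr ?nnegrE// divr_ge0// ltW.
  lra.
have M1 : md (h * kk + a%:C * h ^+ 2 * f) <= md h * md kk + a * md h ^+ 2 * md f.
  by apply: le_trans (le_mdD _ _) _; rewrite !mdM md_real gtr0_norm.
have f0 := md_ge0 f; have k0 := md_ge0 kk; have g0 := md_ge0 (gg - a%:C * f).
have kb : md kk <= 4 * r * a * md f.
  have : md h * md kk <= r / 2 * md kk by rewrite ler_wpM2r.
  move=> hk; rewrite -(ler_pM2l r0); rewrite -/h in K.
  have -> : r * (4 * r * a * md f) = 2 * (2 * (r ^+ 2 * a) * md f) by ring.
  lra.
have gb : md (gg - a%:C * f) <= 6 * a / r * md h * md f.
  have r20 : 0 < 3 / 4 * r ^+ 2 by rewrite mulr_gt0 ?exprn_gt0// divr_gt0.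
  rewrite -(ler_pM2l r20).
  have -> : 3 / 4 * r ^+ 2 * (6 * a / r * md h * md f) =
      9 / 2 * r * a * md h * md f by field; rewrite gt_eqF.
  apply: (@le_trans _ _ (md ((r ^+ 2)%:C - h ^+ 2) * md (gg - a%:C * f))).
    by rewrite ler_wpM2r.
  rewrite -mdM E2; apply: (le_trans M1).
  have e1 : md h * md kk <= md h * (4 * r * a * md f) by rewrite ler_wpM2l.
  have e2 : a * md h * md f * md h <= a * md h * md f * (r / 2).
    by rewrite ler_wpM2l// !mulr_ge0// ltW.
  lra.
rewrite E1 mdM.
have -> : 6 * a / r * md h ^+ 2 * md f = md h * (6 * a / r * md h * md f) by ring.
by rewrite ler_wpM2l.
Qed.

End disc.

(** * Cumulants of tilted laws *)
Section cumulants.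
Context {R : realType}.
Implicit Types (p g : {poly R}) (t x y s d r : R).

(** The form in which monotonicity is used throughout: differential inequalities
    are integrated by exhibiting a monotone auxiliary function. *)
Lemma derive_ge0_le (f f' : R -> R) a b : a <= b ->
  (forall x, a <= x <= b -> is_derive x 1 f (f' x)) ->
  (forall x, a < x < b -> 0 <= f' x) -> f a <= f b.
Proof.
move=> ab df f0.
have H x : x \in `]a, b[ -> a <= x <= b.
  by rewrite in_itv /= => /andP[/ltW -> /ltW ->].
apply: (@ger0_derive1_le_cc R f a b); rewrite ?in_itv /= ?lexx ?ab//.
- by move=> x /H /df [].
- move=> x xab; have [_] := df _ (H _ xab); rewrite derive1E => ->.
  by apply: f0; rewrite in_itv in xab.
- apply: derivable_within_continuous => x; rewrite in_itv /= => xab.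
  by have [] := df _ xab.
Qed.

(** The derivation [z d/dz], the logarithmic derivative with respect to the tilt
    parameter. *)
Definition euler p : {poly R} := 'X * p^`().

(** First three cumulants of the law with weights proportional to
    [p_k x^k], that is, the successive images of [log p] under [z d/dz]. *)
Definition kap1 p x := (euler p).[x] / p.[x].
Definition kap2 p x := (euler (euler p)).[x] / p.[x] - kap1 p x ^+ 2.
Definition kap3 p x := (euler (euler (euler p))).[x] / p.[x]
  - 3 * kap1 p x * ((euler (euler p)).[x] / p.[x]) + 2 * kap1 p x ^+ 3.

Lemma is_derive_ratio p q x : p.[x] != 0 ->
  is_derive x 1 (fun x => q.[x] / p.[x])
   (q^`().[x] / p.[x] - q.[x] * p^`().[x] / p.[x] ^+ 2).
Proof.
move=> p0; apply: is_derive_eq.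
by rewrite /GRing.scale /=; ring.
Qed.

Lemma horner_gt0 p x : (forall k, 0 <= p`_k) -> 0 < p`_0 -> 0 <= x -> 0 < p.[x].
Proof.
move=> p0 p00 x0; rewrite horner_coef.
have : (0 < size p)%N by rewrite lt0n size_poly_eq0; apply: contraTneq p00 => ->;
  rewrite coef0 ltxx.
case: (size p) => // n _; rewrite big_ord_recl /= expr0 mulr1 ltr_pwDl//.
by apply: sumr_ge0 => i _; rewrite mulr_ge0// exprn_ge0.
Qed.

Lemma coef_euler p i : (euler p)`_i = p`_i *+ i.
Proof. by rewrite coefXM; case: i => [|i]; rewrite ?mulr0n// coef_deriv. Qed.

Lemma size_euler p : (size (euler p) <= size p)%N.
Proof.
rewrite /euler mulrC; have [->|p0] := eqVneq p 0; first by rewrite deriv0 mul0r.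
have [->|d0] := eqVneq (p^`()) 0; first by rewrite mul0r size_poly0.
by rewrite size_mulX// lt_size_deriv.
Qed.

Lemma euler_comp p x : euler (p \Po (x *: 'X)) = euler p \Po (x *: 'X).
Proof.
rewrite /euler deriv_comp derivZ derivX comp_polyM comp_polyX.
by rewrite alg_polyC -!mul_polyC; ring.
Qed.

(** The variance is the weighted mean of [(i - mu)^2]; the two extreme weights
    are positive and their points cannot both equal [mu]. *)
Lemma kap2_gt0 p n : (forall k, 0 <= p`_k) -> 0 < p`_0 -> size p = n.+2 ->
  0 < kap2 p 1.
Proof.
move=> p0 p00 sp; have A0 := horner_gt0 p0 p00 ler01.
have pn : 0 < p`_n.+1.
  rewrite lt_def p0 andbT; have := lead_coefE p; rewrite sp /= => <-.
  by rewrite lead_coef_eq0 -size_poly_eq0 sp.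
set mu := kap1 p 1.
have E : kap2 p 1 = (\sum_(i < n.+2) p`_i * (i%:R - mu) ^+ 2) / p.[1].
  apply: (mulIf (lt0r_neq0 A0)); rewrite divfK ?lt0r_neq0//.
  have s1 : (size (euler p) <= n.+2)%N by rewrite -sp size_euler.
  have s2 : (size (euler (euler p)) <= n.+2)%N by rewrite (leq_trans (size_euler _)).
  have -> : kap2 p 1 * p.[1] = (euler (euler p)).[1] - 2 * mu * (euler p).[1]
      + mu ^+ 2 * p.[1].
    rewrite /kap2 -/mu; have -> : (euler p).[1] = mu * p.[1].
      by rewrite /mu /kap1 divfK ?lt0r_neq0.
    by rewrite mulrBl divfK ?lt0r_neq0//; ring.
  rewrite (horner_coef_wide 1 s1) (horner_coef_wide 1 s2).
  rewrite (@horner_coef_wide _ n.+2 p 1) ?sp// !mulr_sumr.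
  rewrite -sumrB -big_split /=; apply: eq_bigr => i _.
  rewrite !coef_euler expr1n -(mulr_natr (p`_i *+ i)) -(mulr_natr p`_i); ring.
rewrite E divr_gt0//.
have ge i : 0 <= p`_i * (i%:R - mu) ^+ 2 by rewrite mulr_ge0 ?sqr_ge0.
rewrite big_ord_recl big_ord_recr /=.
have [m0|m0] := eqVneq mu 0.
  rewrite ltr_wpDl ?ge// ltr_wpDl ?sumr_ge0// m0 subr0.
  by rewrite mulr_gt0// exprn_gt0.
rewrite ltr_pwDl ?addr_ge0 ?sumr_ge0//.
by rewrite sub0r sqrrN mulr_gt0// lt_def sqr_ge0 sqrf_eq0 m0.
Qed.

(** Tilting dilates the zeros, so it preserves zero-free sectors. *)
Lemma sector_free_comp d p x : sector_free d p -> 0 < x ->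
  sector_free d (p \Po (x *: 'X)).
Proof.
move=> [p0 p00 pz] x0.
have cE k : (p \Po (x *: 'X))`_k = p`_k * x ^+ k.
  rewrite comp_polyE coef_sum; under eq_bigr do rewrite exprZn scalerA coefZ coefXn.
  have [ks|ks] := ltnP k (size p).
    rewrite (bigD1 (Ordinal ks)) //= eqxx mulr1 big1 ?addr0// => i /negP ik.
    by have [e|] := eqVneq k i; [case: ik; apply/eqP/val_inj|rewrite mulr0].
  rewrite nth_default// mul0r big1// => i _; have [e|] := eqVneq k i.
    by have := ltn_ord i; rewrite -e ltnNge ks.
  by rewrite mulr0.
split.
- by move=> k; rewrite cE mulr_ge0// exprn_ge0// ltW.
- by rewrite cE mulr1.
move=> t y t0 yd; rewrite /polyRC map_comp_poly /= map_polyZ map_polyX /=.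
rewrite horner_comp hornerZ hornerX mulrA -rmorphM.
by apply: pz => //; rewrite mulr_gt0.
Qed.

Lemma size_comp_scale p x : x != 0 -> size (p \Po (x *: 'X)) = size p.
Proof. by move=> x0; rewrite size_comp_poly2// size_scale// size_polyX. Qed.

Lemma kap_comp p x : 
  [/\ kap1 (p \Po (x *: 'X)) 1 = kap1 p x, kap2 (p \Po (x *: 'X)) 1 = kap2 p x
    & kap3 (p \Po (x *: 'X)) 1 = kap3 p x].
Proof.
have h q : (q \Po (x *: 'X)).[1] = q.[x].
  by rewrite horner_comp hornerZ hornerX mulr1.
by rewrite /kap1 /kap2 /kap3 /kap1 !euler_comp !h.
Qed.

(** The polynomial [g] is the numerator of [(m z - mu) / (z - 1)]. *)
Lemma mean_quotient p : p.[1] != 0 -> exists2 g : {poly R},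
  'X * p^`() - kap1 p 1 *: p = g * ('X - 1%:P) & g.[1] = kap2 p 1 * p.[1].
Proof.
move=> p1.
have [g gE] : exists g, 'X * p^`() - kap1 p 1 *: p = g * ('X - 1%:P).
  by apply/factor_theorem; rewrite /root !hornerE /kap1 /euler !hornerE divfK// subrr.
exists g => //; have := congr1 (fun q => (euler q).[1]) gE.
rewrite -/(euler p) /euler !poly.derivE !hornerE subrr mulr0 add0r => <-.
rewrite /kap2 /kap1 /euler !poly.derivE !hornerE /=.
by field.
Qed.

(** The second derivative of [m] at 1 is [kap3 - kap2]. *)
Lemma kap3_le d p n r : sector_free d p -> size p = n.+2 ->
  0 < d <= pi / 2 -> 0 < r < sin d ->
  `|kap3 p 1 - kap2 p 1| <= 4 / r * kap2 p 1.
Proof.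
move=> sf sp dpi rd; have [p0 p00 _] := sf; have /andP[r0 _] := rd.
have A0 := horner_gt0 p0 p00 ler01.
have a0 := kap2_gt0 p0 p00 sp.
have [g gE g1] := mean_quotient (lt0r_neq0 A0).
have [k kE] : exists k, ((r ^+ 2)%:P - ('X - 1%:P) ^+ 2) * g
    - (r ^+ 2 * kap2 p 1) *: p = k * ('X - 1%:P).
  apply/factor_theorem; rewrite /root !hornerE g1 subrr expr0n subr0.
  by apply/eqP; ring.
have := disc_schwarz_center sf sp dpi rd a0 gE kE.
have k1 : k.[1] = r ^+ 2 * (g^`().[1] - kap2 p 1 * (euler p).[1]).
  have := congr1 (fun q => (q^`()).[1]) kE.
  rewrite !poly.derivE !hornerE !subrr !(mulr0, mul0r, add0r, subr0, addr0) => <-.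
  by rewrite /=; ring.
have g'1 : (kap3 p 1 - kap2 p 1) * p.[1] = 2 * (g^`().[1] - kap2 p 1 * (euler p).[1]).
  have eB a b : euler (a - b) = euler a - euler b by rewrite /euler derivB mulrBr.
  have eZ a b : euler (a *: b) = a *: euler b by rewrite /euler derivZ scalerAr.
  have := congr1 (fun q => (euler (euler q)).[1]) gE.
  rewrite -/(euler p) !eB !eZ hornerD hornerN hornerZ.
  have -> : (euler (euler (g * ('X - 1%:P)))).[1] = 2 * g^`().[1] + g.[1].
    rewrite /euler !poly.derivE !hornerE !subrr !(mulr0, mul0r, addr0, add0r) /=; ring.
  rewrite g1 => /eqP; rewrite subr_eq => /eqP e3.
  have e2 : (euler (euler p)).[1] = (kap2 p 1 + kap1 p 1 ^+ 2) * p.[1].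
    by rewrite /kap2 subrK divfK ?lt0r_neq0.
  have e1 : (euler p).[1] = kap1 p 1 * p.[1] by rewrite divfK ?lt0r_neq0.
  rewrite e1 /kap3 e3 e2; field.
  by rewrite lt0r_neq0.
rewrite k1 normrM (ger0_norm (sqr_ge0 r)) => H.
rewrite -(ler_pM2r A0) -{1}(gtr0_norm A0) -normrM g'1 normrM (ger0_norm (ler0n _ 2)).
rewrite -(ler_pM2l (exprn_gt0 2 r0)).
set u := `|_| in H *; have -> : r ^+ 2 * (4 / r * kap2 p 1 * p.[1]) =
  2 * (2 * r * kap2 p 1 * p.[1]) by field; rewrite gt_eqF.
lra.
Qed.

Lemma is_derive_kap1 p x : (forall k, 0 <= p`_k) -> 0 < p`_0 -> 0 < x ->
  is_derive x 1 (kap1 p) (kap2 p x / x).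
Proof.
move=> p0 p00 x0; have A0 := lt0r_neq0 (horner_gt0 p0 p00 (ltW x0)).
apply: trigger_derive (is_derive_ratio (euler p) A0) _.
rewrite /kap2 /kap1 /euler !poly.derivE !hornerE /=; field.
by rewrite A0 lt0r_neq0.
Qed.

Lemma is_derive_kap2 p x : (forall k, 0 <= p`_k) -> 0 < p`_0 -> 0 < x ->
  is_derive x 1 (kap2 p) (kap3 p x / x).
Proof.
move=> p0 p00 x0; have A0 := lt0r_neq0 (horner_gt0 p0 p00 (ltW x0)).
have d1 := is_derive_kap1 p0 p00 x0.
have d2 := is_derive_ratio (euler (euler p)) A0.
rewrite /kap2; apply: is_derive_eq.
rewrite /kap3 /kap2 /kap1 /GRing.scale /= /euler !poly.derivE !hornerE /=; field.
by rewrite A0 lt0r_neq0.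
Qed.

(** Harnack inequality: the local bound [kap3 >= - (4 / r - 1) kap2], valid at
    every tilt since tilting preserves zero-free sectors, integrates to
    [kap2 x <= x^(1 - 4 / r) kap2 1] for [x <= 1], and then to a bound on the
    variation of the tilted mean. *)
Lemma kap1_variation d p n r x : sector_free d p -> size p = n.+2 ->
  0 < d <= pi / 2 -> 0 < r < sin d -> 0 < x <= 1 ->
  kap1 p 1 - kap1 p x <=
  kap2 p 1 * (x `^ (- (4 / r - 1)) - 1) / (4 / r - 1).
Proof.
move=> sf sp dpi rd /andP[x0 x1]; have [p0 p00 _] := sf; have /andP[r0 rs] := rd.
pose b := 4 / r - 1; rewrite -/b.
have b0 : 0 < b.
  by rewrite subr_gt0 ltr_pdivlMr// mul1r; have := sin_le1 d; lra.
have kap3_ge y : 0 < y -> 0 <= kap3 p y + b * kap2 p y.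
  move=> y0; have := kap3_le (sector_free_comp sf y0) _ dpi rd.
  rewrite size_comp_scale ?lt0r_neq0// => /(_ _ sp).
  have [_ -> ->] := kap_comp p y.
  by rewrite ler_norml /b => /andP[+ _]; lra.
pose H y := kap2 p y * y `^ b.
have kap2_le y : 0 < y <= 1 -> kap2 p y <= kap2 p 1 * y `^ (- b).
  move=> /andP[y0 y1].
  have : H y <= H 1.
    apply: (@derive_ge0_le _ (fun y => y `^ (b - 1) * (kap3 p y + b * kap2 p y))) => //.
      move=> u /andP[yu _]; have u0 : 0 < u := lt_le_trans y0 yu.
      have d2 := is_derive_kap2 p0 p00 u0; have d3 := is_derive1_powR b u0.
      rewrite /H; apply: is_derive_eq; rewrite /GRing.scale /=.
      have -> : u `^ b = u `^ (b - 1) * u.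
        by rewrite -{3}(powRr1 (ltW u0)) -powRD ?subrK// (gt_eqF u0) implybT.
      by field; rewrite lt0r_neq0.
    move=> u /andP[yu _]; have u0 : 0 < u := lt_trans y0 yu.
    by rewrite mulr_ge0 ?powR_ge0// kap3_ge.
  rewrite /H powR1 mulr1 => h.
  by rewrite powRN ler_pdivlMr// powR_gt0.
pose G y := - (kap1 p y + kap2 p 1 / b * y `^ (- b)).
have : G x <= G 1.
  apply: (@derive_ge0_le _ (fun y => (kap2 p 1 * y `^ (- b) - kap2 p y) / y)) => //.
    move=> u /andP[yu _]; have u0 : 0 < u := lt_le_trans x0 yu.
    have d2 := is_derive_kap1 p0 p00 u0; have d3 := is_derive1_powR (- b) u0.
    rewrite /G; apply: is_derive_eq; rewrite /GRing.scale /=.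
    have -> : u `^ (- b) = u `^ (- b - 1) * u.
      by rewrite -{3}(powRr1 (ltW u0)) -powRD ?subrK// (gt_eqF u0) implybT.
    by field; rewrite !lt0r_neq0.
  move=> u /andP[xu u1]; have u0 : 0 < u := lt_trans x0 xu.
  by rewrite divr_ge0 ?(ltW u0)// subr_ge0 kap2_le// u0 ltW.
rewrite /G powR1 lerN2.
have -> : kap2 p 1 * (x `^ (- b) - 1) / b =
  kap2 p 1 / b * x `^ (- b) - kap2 p 1 / b * 1 by ring.
lra.
Qed.

End cumulants.

(** * Mean and variance as sums over the zeros *)
Section roots.
Context {R : realType}.
Implicit Types (p g : {poly R}) (t x y s d r rho : R).

Lemma prod_XsubC_logderiv (l : seq R[i]) (x : R[i]) : x \notin l ->
  let q := \prod_(z <- l) ('X - z%:P) in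
  [/\ q.[x] != 0, q^`().[x] = q.[x] * (\sum_(z <- l) (x - z)^-1) &
   q^`()^`().[x] = q.[x] * ((\sum_(z <- l) (x - z)^-1) ^+ 2
      - \sum_(z <- l) (x - z) ^- 2)].
Proof.
elim: l => [|z l IH] /=.
  rewrite !big_nil !poly.derivE !hornerE oner_eq0; split=> //; ring.
rewrite inE negb_or => /andP[xz xl]; have [q0 q1 q2] := IH xl.
rewrite !big_cons; set q := \prod_(j <- l) _ in q0 q1 q2 *.
have xz0 : x - z != 0 by rewrite subr_eq0.
have dq : (('X - z%:P) * q)^`() = q + ('X - z%:P) * q^`().
  by rewrite derivM derivXsubC mul1r.
have dqq : (('X - z%:P) * q)^`()^`() = q^`() + q^`() + ('X - z%:P) * q^`()^`().
  by rewrite dq derivD derivM derivXsubC mul1r addrA.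
rewrite dqq dq !hornerD !hornerM !hornerXsubC q1 q2; split.
- by rewrite mulf_neq0.
- by field.
- by field.
Qed.

(** The logarithmic derivative of a split polynomial is the sum of the
    [1 / (x - z)] over its zeros. *)
Lemma roots_cumulants p n x : size p = n.+2 -> p.[x] != 0 ->
  exists l : seq R[i], [/\ size l = n.+1, forall z, z \in l -> root (polyRC p) z,
    (kap1 p x)%:C = \sum_(z <- l) x%:C / (x%:C - z) &
    (kap2 p x)%:C = \sum_(z <- l) - (x%:C * z) / (x%:C - z) ^+ 2].
Proof.
move=> sp px.
have sP : size (polyRC p) = n.+2.
  by rewrite size_map_inj_poly//; exact: complexI.
have [l lE] := closed_field_poly_normal (polyRC p).
have lc0 : lead_coef (polyRC p) != 0 by rewrite lead_coef_eq0 -size_poly_eq0 sP.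
exists l.
have rE z : root (polyRC p) z = (z \in l).
  by rewrite lE rootZ// root_prod_XsubC.
have xl : x%:C \notin l.
  by rewrite -rE /root horner_polyRC; apply: contra px => /eqP[->].
have [q0 q1 q2] := prod_XsubC_logderiv xl.
move: lE q0 q1 q2; set q := \prod_(z <- l) _; set c := lead_coef _ => lE q0 q1 q2.
have e0 : (p.[x])%:C = c * q.[x%:C].
  by rewrite -horner_polyRC lE hornerZ.
have e1 : (p^`().[x])%:C = c * q^`().[x%:C].
  by rewrite -horner_polyRC -horner_derivRC lE derivZ hornerZ.
have e2 : (p^`()^`().[x])%:C = c * q^`()^`().[x%:C].
  by rewrite -horner_polyRC -horner_derivRC /polyRC -deriv_map -/(polyRC p) lE !derivZ hornerZ.
have fr (a b : R) : (a / b)%:C = a%:C / b%:C :> R[i] by rewrite rmorphM fmorphV.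
have k1 : (kap1 p x)%:C = \sum_(z <- l) x%:C / (x%:C - z).
  rewrite -mulr_sumr /kap1 /euler fr hornerM hornerX rmorphM /= e0 e1 q1.
  by field; rewrite lc0 q0.
split=> //.
- by have := sP; rewrite lE size_scale// size_prod_XsubC => -[].
- by move=> z; rewrite rE.
have -> : \sum_(z <- l) - (x%:C * z) / (x%:C - z) ^+ 2 =
    x%:C * (\sum_(z <- l) (x%:C - z)^-1) - x%:C ^+ 2 * (\sum_(z <- l) (x%:C - z)^-2).
  rewrite !mulr_sumr -sumrB big_seq [RHS]big_seq; apply: eq_bigr => z zl.
  have : x%:C - z != 0.
    by rewrite subr_eq0; apply: contraNneq xl => ->.
  by move=> h; field.
have -> : (kap2 p x)%:C = x%:C ^+ 2 * ((p^`()^`().[x])%:C / (p.[x])%:C) +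
    x%:C * ((p^`().[x])%:C / (p.[x])%:C) - x%:C ^+ 2 * ((p^`().[x])%:C / (p.[x])%:C) ^+ 2.
  have cM (a b : R) : (a * b)%:C = a%:C * b%:C :> R[i] by rewrite rmorphM.
  have -> : kap2 p x = x * x * (p^`()^`().[x] / p.[x]) + x * (p^`().[x] / p.[x]) -
      (x * x) * ((p^`().[x] / p.[x]) * (p^`().[x] / p.[x])).
    rewrite /kap2 /kap1.
    have -> : (euler (euler p)).[x] = x * (p^`().[x] + x * p^`()^`().[x]).
      by rewrite /euler derivM derivX mul1r hornerM hornerD hornerM hornerX.
    have -> : (euler p).[x] = x * p^`().[x] by rewrite /euler hornerM hornerX.
    by field.
  have fV (b : R) : (b^-1)%:C = (b%:C)^-1 :> R[i] by rewrite fmorphV.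
  by rewrite rmorphB rmorphD /= !cM !fV !expr2.
rewrite e0 e1 e2 q1 q2; field.
by rewrite lc0 q0.
Qed.

(** Among the points [z] of given modulus, [Re (x / (x - z))] is largest at
    [z = - |z|], as long as [x < |z|]. *)
Lemma Re_inv_le (z : R[i]) x : 0 < x < md z -> Re (x%:C / (x%:C - z)) <= x / (x + md z).
Proof.
move=> /andP[x0 xa]; set a := md z in xa *.
have a0 : 0 < a := lt_trans x0 xa.
have aE : a ^+ 2 = Re z ^+ 2 + Im z ^+ 2 by rewrite sqr_md.
have ca : - a <= Re z.
  have : `|Re z| <= a by rewrite -sqrtr_sqr ler_sqrt ?sqn_ge0// lerDl sqr_ge0.
  by rewrite ler_norml => /andP[].
have D0 : 0 < sqn (x%:C - z).
  rewrite sqn_gt0 subr_eq0; apply/eqP => h; move: xa; rewrite /a -h md_real.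
  by rewrite gtr0_norm// ltxx.
have DE : sqn (x%:C - z) = x ^+ 2 - 2 * x * Re z + a ^+ 2.
  by rewrite /sqn cReB cImB /= aE; ring.
have -> : Re (x%:C / (x%:C - z)) = x * ((x - Re z) / sqn (x%:C - z)).
  by rewrite cReZ invcE; congr (_ * (_ / _)); rewrite cReB.
rewrite DE in D0 *; rewrite ler_pdivlMr ?addr_gt0//.
have -> : x * ((x - Re z) / (x ^+ 2 - 2 * x * Re z + a ^+ 2)) * (x + a) =
  x * ((x - Re z) * (x + a) / (x ^+ 2 - 2 * x * Re z + a ^+ 2)) by ring.
rewrite -[leRHS]mulr1 ler_pM2l// ler_pdivrMr// mul1r -subr_ge0.
have -> : x ^+ 2 - 2 * x * Re z + a ^+ 2 - (x - Re z) * (x + a) =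
  (a - x) * (a + Re z) by ring.
by rewrite mulr_ge0//; lra.
Qed.

Lemma Re_sum_seq (l : seq R[i]) (F : R[i] -> R[i]) :
  Re (\sum_(z <- l) F z) = \sum_(z <- l) Re (F z).
Proof. by elim: l => [|z l IH]; rewrite ?big_nil// !big_cons cReD IH. Qed.

Lemma sum_seq_le (l : seq R[i]) (F : R[i] -> R) (c : R) :
  (forall z, z \in l -> F z <= c) -> \sum_(z <- l) F z <= (size l)%:R * c.
Proof.
elim: l => [|z l IH] h; first by rewrite big_nil mul0r.
rewrite big_cons /= -natr1 mulrDl mul1r addrC lerD//.
  by apply: IH => w wl; apply: h; rewrite inE wl orbT.
by apply: h; rewrite inE eqxx.
Qed.

(** Below the smallest modulus of a zero, every zero contributes at most
    [x / (x + rho^-1)] to the tilted mean. *)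
Lemma kap1_le_below_zeros p n rho x : size p = n.+2 -> p.[x] != 0 -> 0 < rho ->
  (forall z, root (polyRC p) z -> rho^-1 <= md z) -> 0 < x < rho^-1 ->
  kap1 p x <= n.+1%:R * (x / (x + rho^-1)).
Proof.
move=> sp px rho0 hr /andP[x0 xr]; have [l [sl rl k1 _]] := roots_cumulants sp px.
have -> : kap1 p x = Re (kap1 p x)%:C by [].
rewrite k1 Re_sum_seq -sl; apply: sum_seq_le => z /rl /hr zr.
apply: le_trans (Re_inv_le _) _; first by rewrite x0 (lt_le_trans xr).
have ri : 0 < rho^-1 by rewrite invr_gt0.
rewrite ler_wpM2l ?(ltW x0)// lef_pV2 ?posrE ?lerD2l// addr_gt0//.
exact: lt_le_trans zr.
Qed.

(** When no zero has positive real part, each zero contributes a positive amount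
    [Re (- z / (1 - z)^2)], of order at least [rho^-2], to the variance. *)
Lemma kap2_half_plane p n rho : size p = n.+2 -> p.[1] != 0 -> 1 <= rho ->
  (forall z, root (polyRC p) z -> Re z <= 0 /\ rho^-1 <= md z <= rho) ->
  n.+1%:R / (8 * rho ^+ 2) <= kap2 p 1.
Proof.
move=> sp p1 rho1 hr; have [l [sl rl _ k2]] := roots_cumulants sp p1.
have rho0 : 0 < rho by lra.
have -> : kap2 p 1 = Re (kap2 p 1)%:C by [].
rewrite k2 Re_sum_seq -lerN2 -sumrN -sl -mulrN; apply: sum_seq_le => z /rl /hr.
move=> [z0 /andP[z1 z2]]; rewrite lerN2; set a := md z in z1 z2.
have a0 : 0 < a by apply: lt_le_trans z1; rewrite invr_gt0.
have aE : a ^+ 2 = Re z ^+ 2 + Im z ^+ 2 by rewrite sqr_md.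
have ca : - a <= Re z.
  have : `|Re z| <= a by rewrite -sqrtr_sqr ler_sqrt ?sqn_ge0// lerDl sqr_ge0.
  by rewrite ler_norml => /andP[].
set D := sqn (1 - z).
have DE : D = 1 - 2 * Re z + a ^+ 2.
  by rewrite /D /sqn cReB cImB /= aE; ring.
have D0 : 0 < D by rewrite DE; nra.
have -> : Re (- (1%:C * z) / (1%:C - z) ^+ 2) = (2 * a ^+ 2 - (1 + a ^+ 2) * Re z) / D ^+ 2.
  have sD : sqn ((1 - z) ^+ 2) = D ^+ 2 by rewrite !expr2 sqnM.
  rewrite mul1r cReM invcE sD cReN cImN expr2 cReM cImM cReB cImB /=.
  by rewrite aE; field; rewrite gt_eqF.
apply: (@le_trans _ _ (2 * a ^+ 2 / (1 + a) ^+ 4)); last first.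
  have Da : D <= (1 + a) ^+ 2 by rewrite DE; nra.
  have D2 : D ^+ 2 <= (1 + a) ^+ 4.
    by rewrite (exprM (1 + a) 2 2) ler_sqr// nnegrE ?sqr_ge0// ltW.
  apply: ler_pM; rewrite ?mulr_ge0 ?invr_ge0 ?exprn_ge0 ?addr_ge0 ?(ltW a0)//.
    by rewrite lerDl -mulrN mulr_ge0 ?oppr_ge0// addr_ge0 ?sqr_ge0.
  by rewrite lef_pV2 ?posrE ?exprn_gt0// addr_gt0.
rewrite -div1r ler_pdivrMr ?mulr_gt0 ?exprn_gt0// mulrAC ler_pdivlMr ?exprn_gt0 ?addr_gt0//.
have h1 : (1 + a) ^+ 2 <= 4 * rho * a.
  have : 1 <= rho * a by rewrite mulrC -ler_pdivrMr// div1r.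
  by nra.
have : (1 + a) ^+ 4 <= (4 * rho * a) ^+ 2.
  by rewrite (exprM (1 + a) 2 2) ler_sqr// nnegrE ?sqr_ge0// !mulr_ge0 ?ltW.
rewrite !exprMn mul1r; lra.
Qed.

(** Concavity of the sine: the difference increases, then decreases. *)
Lemma jordan_sin x : 0 <= x <= pi / 2 -> 2 / pi * x <= sin x.
Proof.
have pi0 := pi_gt0 R.
move=> /andP[x0 xpi]; rewrite -subr_ge0.
have dg (u : R) : is_derive u 1 (fun u => sin u - 2 / pi * u) (cos u - 2 / pi).
  by apply: is_derive_eq; rewrite /GRing.scale /= mulr1.
have cos_mono (u v : R) : 0 <= u -> u <= v -> v <= pi / 2 -> cos v <= cos u.
  move=> u0 uv vp; rewrite leNgt; apply/negP; rewrite ltr_cos ?in_itv /=; first by lra.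
    by apply/andP; split; lra.
  by apply/andP; split; lra.
have [c|c] := leP (2 / pi) (cos x).
  have := @derive_ge0_le _ (fun u => sin u - 2 / pi * u) (fun u => cos u - 2 / pi) 0 x x0.
  rewrite sin0 mulr0 subr0; apply=> // u /andP[u0 ux].
  by have := cos_mono u x (ltW u0) (ltW ux) xpi; lra.
have := @derive_ge0_le _ (fun u => - (sin u - 2 / pi * u)) (fun u => - (cos u - 2 / pi)) x (pi / 2) xpi.
have -> : 2 / pi * (pi / 2) = 1 :> R by rewrite mulrA divfK ?gt_eqF// divff.
rewrite sin_pihalf subrr oppr0 oppr_le0; apply=> u /andP[u0 ux].
by have := cos_mono x u x0 (ltW u0) (ltW ux); lra.
Qed.

(** This radius is chosen so that the Harnack exponent [4 / r - 1] is exactly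
    [2 pi / d]. *)
Lemma radius_lt_sin d : 0 < d <= pi / 2 -> 0 < 4 * d / (2 * pi + d) < sin d.
Proof.
have pi0 := pi_gt0 R; move=> /andP[d0 dp].
have pd : 0 < 2 * pi + d by lra.
rewrite divr_gt0 ?mulr_gt0//=.
apply: (@lt_le_trans _ _ (2 / pi * d)); last by apply: jordan_sin; rewrite ltW.
rewrite ltr_pdivrMr// -subr_gt0.
have -> : 2 / pi * d * (2 * pi + d) - 4 * d = 2 * d ^+ 2 / pi.
  by move: (@pi R) (pi0) => q q0; field; rewrite gt_eqF.
by rewrite divr_gt0// mulr_gt0// exprn_gt0.
Qed.

(** The tilt [x = 1 / (rho (1 + d))] brings the mean down from at least half
    of the degree to at most the degree over [2 + d], a loss of order [d] times
    the degree, while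
    [x^(- 2 pi / d) <= rho^(2 pi / d) exp (2 pi)] in the Harnack inequality. *)
Lemma variance_lower_bound_upper_mean d p n rho : sector_free d p -> size p = n.+2 ->
  0 < d <= pi / 2 -> 1 <= rho ->
  (forall z, root (polyRC p) z -> rho^-1 <= md z) ->
  n.+1%:R / 2 <= kap1 p 1 ->
  expR (- (2 * pi)) / 2 * n.+1%:R <= kap2 p 1 * rho `^ (2 * pi / d).
Proof.
move=> sf sp dpi rho1 hr mu2; have [p0 p00 _] := sf; have /andP[d0 dp] := dpi.
have pi0 := pi_gt0 R; have pi2 := pi_ge2 R.
have rho0 : 0 < rho by lra.
pose r := 4 * d / (2 * pi + d).
have pd : 0 < 2 * pi + d by lra.
have /andP[r0 rd] : 0 < r < sin d by exact: radius_lt_sin.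
have rE : 4 / r - 1 = 2 * pi / d by rewrite /r; move: (@pi R) (pd) => q pd0; field; rewrite !gt_eqF.
pose x := (rho * (1 + d))^-1.
have q0 : 0 < rho * (1 + d) by rewrite mulr_gt0//; lra.
have x0 : 0 < x by rewrite invr_gt0.
have xr : x < rho^-1.
  by rewrite ltf_pV2 ?posrE// ltr_pMr//; lra.
have x1 : x <= 1.
  by rewrite invf_le1// (le_trans rho1)// ler_peMr//; lra.
have := kap1_variation sf sp dpi (r := r) (x := x).
rewrite r0 rd x0 x1 rE => /(_ isT isT).
have px : p.[x] != 0 by rewrite lt0r_neq0// horner_gt0// ltW.
have := kap1_le_below_zeros sp px rho0 hr; rewrite x0 xr => /(_ isT).
have -> : x / (x + rho^-1) = (2 + d)^-1.
  by rewrite /x; field; rewrite !gt_eqF//; lra.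
set b := 2 * pi / d => k1 k2.
have b0 : 0 < b by rewrite !divr_gt0// mulr_gt0.
have k20 := kap2_gt0 p0 p00 sp.
have xb : x `^ (- b) <= rho `^ b * expR (2 * pi).
  rewrite /x -powR_inv1 ?(ltW q0)// -powRrM mulrNN mul1r powRM; [|lra..].
  rewrite ler_wpM2l ?powR_ge0// /powR gt_eqF; last by lra.
  rewrite ler_expR -[leRHS](divfK (lt0r_neq0 d0)) -/b.
  by rewrite ler_wpM2l ?(ltW b0)//; apply: le_ln1Dx; lra.
have N0 : 0 <= n.+1%:R :> R by [].
have h1 : n.+1%:R * (d / 8) <= kap1 p 1 - kap1 p x.
  apply: (@le_trans _ _ (n.+1%:R / 2 - n.+1%:R / (2 + d))); last by lra.
  have -> : n.+1%:R / 2 - n.+1%:R / (2 + d) = n.+1%:R * (d / (2 * (2 + d))) :> R.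
    by field; rewrite gt_eqF//; lra.
  have pi4 := pihalf_lt2 R.
  rewrite ler_wpM2l// ler_wpM2l ?(ltW d0)// lef_pV2 ?posrE ?mulr_gt0//; lra.
have h2 : n.+1%:R * (d / 8) <= kap2 p 1 * (rho `^ b * expR (2 * pi)) / b.
  apply: (le_trans h1); apply: (le_trans k2).
  rewrite ler_pM2r ?invr_gt0// ler_pM2l//; lra.
rewrite expRN (_ : _ / 2 * _ = n.+1%:R / 2 / expR (2 * pi)); last by ring.
rewrite ler_pdivrMr ?expR_gt0//.
move: h2; rewrite ler_pdivlMr// /b.
have -> : n.+1%:R * (d / 8) * (2 * pi / d) = n.+1%:R * (pi / 4) :> R.
  by field; rewrite gt_eqF.
move=> h2; rewrite -(mulrA (kap2 p 1)); apply: (le_trans _ h2).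
rewrite ler_wpM2l//; lra.
Qed.

End roots.

(** * Lower bound for the variance *)
Section variance.
Context {R : realType}.
Implicit Types (p g : {poly R}) (t x y s d r rho : R).

Definition zeros_in d rho p := forall z, root (polyRC p) z ->
  d <= `|arg z| /\ rho^-1 <= md z <= rho.

Lemma arg_polar t y : 0 < t -> `|y| <= pi -> `|arg (t%:C * cis y)| = `|y|.
Proof.
move=> t0 yp; apply: norm_argE; split; last by exists t.
by rewrite -ler_norml.
Qed.

Lemma zeros_in_sector_free d rho p : zeros_in d rho p -> d <= pi ->
  (forall k, 0 <= p`_k) -> 0 < p`_0 -> sector_free d p.
Proof.
move=> pz dpi p0 p00; split=> // t y t0 yd; apply/negP => /pz[+ _].
by rewrite (arg_polar t0 (ltW (lt_le_trans yd dpi))) leNgt yd.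
Qed.

Lemma sector_freeW d d' p : d' <= d -> sector_free d p -> sector_free d' p.
Proof. by move=> dd [? ? h]; split=> // t y t0 yd; apply: h => //; lra. Qed.

(** The generating function of [n + 1 - X], the polynomial having degree
    [n + 1]. *)
Definition rev_poly n p : {poly R} := \poly_(i < n.+2) p`_(n.+1 - i).

Lemma rev_sum (V : nmodType) n (F : nat -> V) :
  \sum_(i < n.+2) F (n.+1 - i)%N = \sum_(i < n.+2) F i.
Proof. by rewrite [RHS](reindex_inj rev_ord_inj); apply: eq_bigr => i _ /=; rewrite subSS. Qed.

Lemma moments_1 p n : (size p <= n.+2)%N ->
  [/\ p.[1] = \sum_(i < n.+2) p`_i, (euler p).[1] = \sum_(i < n.+2) p`_i * i%:R &
      (euler (euler p)).[1] = \sum_(i < n.+2) p`_i * i%:R ^+ 2].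
Proof.
move=> sp; have s1 := leq_trans (size_euler p) sp.
have s2 := leq_trans (size_euler (euler p)) s1.
rewrite (horner_coef_wide 1 sp) (horner_coef_wide 1 s1) (horner_coef_wide 1 s2).
split; apply: eq_bigr => i _; rewrite expr1n mulr1// !coef_euler.
  by rewrite mulr_natr.
by rewrite -(mulr_natr (p`_i *+ i)) -(mulr_natr p`_i); ring.
Qed.

(** The zeros become their inverses, so the hypotheses are symmetric under
    reversal, while the mean is replaced by its complement and the variance is
    unchanged: the mean may be assumed to be at least half of the degree. *)
Lemma rev_poly_facts d rho p n : sector_free d p -> size p = n.+2 -> 1 <= rho ->
  (forall z, root (polyRC p) z -> rho^-1 <= md z <= rho) ->
  [/\ sector_free d (rev_poly n p), size (rev_poly n p) = n.+2,
    forall z, root (polyRC (rev_poly n p)) z -> rho^-1 <= md z,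
    kap1 (rev_poly n p) 1 = n.+1%:R - kap1 p 1 &
    kap2 (rev_poly n p) 1 = kap2 p 1].
Proof.
move=> [p0 p00 pz] sp rho1 hr.
have rho0 : 0 < rho by lra.
have pn : 0 < p`_n.+1.
  rewrite lt_def p0 andbT; have := lead_coefE p; rewrite sp /= => <-.
  by rewrite lead_coef_eq0 -size_poly_eq0 sp.
have sq : size (rev_poly n p) = n.+2.
  by rewrite size_poly_eq// subnn gt_eqF.
have qE z : z != 0 -> (polyRC (rev_poly n p)).[z] = z ^+ n.+1 * (polyRC p).[z^-1].
  move=> z0; rewrite (@horner_coef_wide _ n.+2); last first.
    by rewrite size_map_inj_poly ?sq//; exact: complexI.
  rewrite (@horner_coef_wide _ n.+2 (polyRC p)); last first.
    by rewrite size_map_inj_poly ?sp//; exact: complexI.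
  rewrite mulr_sumr -[RHS](@rev_sum _ n (fun i => z ^+ n.+1 * ((polyRC p)`_i * z^-1 ^+ i))).
  apply: eq_bigr => i _; rewrite !coef_map /= coef_poly ltn_ord.
  have iN : (i <= n.+1)%N by rewrite -ltnS.
  have zN : z ^+ n.+1 = z ^+ (n.+1 - i) * z ^+ i by rewrite -exprD subnK.
  by rewrite exprVn mulrCA zN mulrAC divff ?mul1r// expf_neq0.
have cq k : 0 <= (rev_poly n p)`_k by rewrite coef_poly; case: ifP.
have q0 : (polyRC (rev_poly n p)).[0] != 0.
  rewrite horner_coef0 coef_map /= coef_poly subn0; apply/eqP => -[] /eqP.
  by rewrite gt_eqF.
have A0 := horner_gt0 p0 p00 ler01.
have [a0 a1 a2] := moments_1 (eq_leq sp).
have [b0 b1 b2] := moments_1 (eq_leq sq).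
have cE (i : 'I_n.+2) : (rev_poly n p)`_i = p`_(n.+1 - i) by rewrite coef_poly ltn_ord.
have nE (i : 'I_n.+2) : i%:R = n.+1%:R - (n.+1 - i)%:R :> R.
  by rewrite natrB ?subKr// -ltnS.
have B0 : (rev_poly n p).[1] = p.[1].
  rewrite b0 a0 -(@rev_sum _ n (fun i => p`_i)).
  by apply: eq_bigr => i _; rewrite cE.
have B1 : (euler (rev_poly n p)).[1] = n.+1%:R * p.[1] - (euler p).[1].
  rewrite b1 a0 a1 mulr_sumr -sumrB.
  rewrite -(@rev_sum _ n (fun i => n.+1%:R * p`_i - p`_i * i%:R)).
  by apply: eq_bigr => i _; rewrite cE {1}nE; ring.
have B2 : (euler (euler (rev_poly n p))).[1] =
    n.+1%:R ^+ 2 * p.[1] - 2 * n.+1%:R * (euler p).[1] + (euler (euler p)).[1].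
  rewrite b2 a0 a1 a2 !mulr_sumr -sumrB -big_split /=.
  rewrite -(@rev_sum _ n (fun i => n.+1%:R ^+ 2 * p`_i - 2 * n.+1%:R * (p`_i * i%:R)
     + p`_i * i%:R ^+ 2)).
  by apply: eq_bigr => i _; rewrite cE {1}nE; ring.
split=> //.
- split=> //; first by rewrite coef_poly subn0.
  move=> t y t0 yd; have z0 : t%:C * cis y != 0.
    by rewrite -sqn_gt0 -sqr_md mdM md_real md_cis mulr1 exprn_gt0// gtr0_norm.
  rewrite qE// mulf_neq0 ?expf_neq0//.
  have -> : (t%:C * cis y)^-1 = (t^-1)%:C * cis (- y).
    apply: (mulfI z0); rewrite divff// mulrACA -rmorphM -cisD /= divff ?gt_eqF//.
    by rewrite subrr /cis cos0 sin0 mul1r.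
  by apply: pz; rewrite ?invr_gt0// normrN.
- move=> z; have [->|z0] := eqVneq z 0; first by rewrite /root (negbTE q0).
  rewrite /root qE// mulf_eq0 expf_eq0 (negbTE z0) andbF /= => /hr/andP[_].
  have mz : 0 < md z by rewrite lt_def md_ge0 andbT /md sqrtr_eq0 -ltNge sqn_gt0.
  have -> : md z^-1 = (md z)^-1.
    apply: (mulfI (lt0r_neq0 mz)); rewrite -mdM !divff ?(lt0r_neq0 mz)//.
    by rewrite (_ : 1 = (1 : R)%:C)// md_real normr1.
  by move=> h; rewrite -[leRHS]invrK lef_pV2 ?posrE ?invr_gt0.
- by rewrite /kap1 B0 B1; field; rewrite gt_eqF.
- by rewrite /kap2 /kap1 B0 B1 B2; field; rewrite gt_eqF.
Qed.

Lemma variance_lower_bound d rho p n : zeros_in d rho p -> (forall k, 0 <= p`_k) -> 0 < p`_0 ->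
  size p = n.+2 -> 0 < d <= pi -> 1 <= rho ->
  expR (- (2 * pi)) / 2 * n.+1%:R <= kap2 p 1 * rho `^ (2 * pi / d).
Proof.
move=> pz p0 p00 sp /andP[d0 dpi] rho1.
have sf := zeros_in_sector_free pz dpi p0 p00.
have hr z : root (polyRC p) z -> rho^-1 <= md z <= rho by move=> /pz[].
have rho0 : 0 < rho by lra.
have A0 := horner_gt0 p0 p00 ler01.
have pi2 := pi_ge2 R.
have [dp|dp] := leP d (pi / 2).
  have dd : 0 < d <= pi / 2 by rewrite d0.
  have [m|m] := leP (n.+1%:R / 2) (kap1 p 1).
    by apply: variance_lower_bound_upper_mean => // z /hr/andP[].
  have [sf' sp' hr' k1 k2] := rev_poly_facts sf sp rho1 hr.
  by rewrite -k2; apply: variance_lower_bound_upper_mean => //; rewrite k1; lra.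
have : n.+1%:R / (8 * rho ^+ 2) <= kap2 p 1.
  apply: kap2_half_plane => //; first by rewrite gt_eqF.
  move=> z rz; have [h1 h2] := pz z rz; split=> //.
  have z0 : z != 0.
    rewrite -sqn_gt0 -sqr_md exprn_gt0//.
    by have /andP[h _] := h2; apply: lt_le_trans h; rewrite invr_gt0.
  have [t [y [t0 yp] zE]] := polar_form z0.
  rewrite zE cReZ /=; rewrite pmulr_rle0//.
  have yp' : `|y| <= pi by rewrite ler_norml.
  have dy : d <= `|y| by rewrite -(arg_polar t0 yp') -zE.
  rewrite -cos_norm -(subrK (pi / 2) `|y|) cosDpihalf oppr_le0.
  by apply: sin_ge0_pi; lra.
rewrite ler_pdivrMr ?mulr_gt0 ?exprn_gt0// => h.
have e1 : rho ^+ 2 <= rho `^ (2 * pi / d).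
  rewrite -powR_mulrn ?(ltW rho0)// ler_powR//.
  by rewrite ler_pdivlMr// ler_pM2l.
have e2 : expR (- (2 * pi)) <= 1 / 4 :> R.
  rewrite expRN div1r lef_pV2 ?posrE ?expR_gt0//.
  by apply: le_trans (expR_ge1Dx _); lra.
have k20 := kap2_gt0 p0 p00 sp.
apply: (@le_trans _ _ (kap2 p 1 * rho ^+ 2)); last by rewrite ler_pM2l.
apply: (@le_trans _ _ (1 / 8 * n.+1%:R)); last by lra.
by rewrite ler_wpM2r//; lra.
Qed.

End variance.

(** * Characteristic function near the origin *)
Section charfun.
Context {R : realType}.
Implicit Types (p g : {poly R}) (t x y s d r rho : R).

Lemma mean_taylor d p n r : sector_free d p -> size p = n.+2 ->
  0 < d <= pi / 2 -> 0 < r < sin d ->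
  forall z : R[i], md (z - 1) <= r / 2 ->
  md (z * (polyRC p^`()).[z]
      - ((kap1 p 1)%:C + (kap2 p 1)%:C * (z - 1)) * (polyRC p).[z]) <=
  6 * kap2 p 1 / r * md (z - 1) ^+ 2 * md (polyRC p).[z].
Proof.
move=> sf sp dpi rd; have [p0 p00 _] := sf.
have A0 := horner_gt0 p0 p00 ler01.
have [g gE g1] := mean_quotient (lt0r_neq0 A0).
have [k kE] : exists k, ((r ^+ 2)%:P - ('X - 1%:P) ^+ 2) * g
    - (r ^+ 2 * kap2 p 1) *: p = k * ('X - 1%:P).
  apply/factor_theorem; rewrite /root !hornerE g1 subrr expr0n subr0.
  by apply/eqP; ring.
exact: disc_mean_taylor sf sp dpi rd (kap2_gt0 p0 p00 sp) gE kE.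
Qed.

Lemma sin_le t : 0 <= t -> sin t <= t.
Proof.
move=> t0; have := @derive_ge0_le _ (fun u => u - sin u) (fun u => 1 - cos u) 0 t t0.
rewrite sin0 subr0 subr_ge0; apply=> u _.
by rewrite subr_ge0 cos_le1.
Qed.

Lemma cos_ge t : 0 <= t -> 1 - t ^+ 2 / 2 <= cos t.
Proof.
move=> t0; have := @derive_ge0_le _ (fun u => cos u - (1 - u ^+ 2 / 2))
  (fun u => u - sin u) 0 t t0.
rewrite cos0 expr0n mul0r subr0 subrr subr_ge0; apply=> u.
  move=> _; apply: is_derive_eq; rewrite /GRing.scale /=; lra.
by move=> /andP[u0 _]; rewrite subr_ge0 sin_le// ltW.
Qed.

Lemma sin_ge t : 0 <= t -> t - t ^+ 3 / 6 <= sin t.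
Proof.
move=> t0; have := @derive_ge0_le _ (fun u => sin u - (u - u ^+ 3 / 6))
  (fun u => cos u - (1 - u ^+ 2 / 2)) 0 t t0.
rewrite sin0 expr0n mul0r subr0 subrr subr_ge0; apply=> u.
  move=> _; apply: is_derive_eq; rewrite /GRing.scale /=; lra.
by move=> /andP[u0 _]; rewrite subr_ge0 cos_ge// ltW.
Qed.

Lemma md_le_abs (z : R[i]) : md z <= `|Re z| + `|Im z|.
Proof.
rewrite -ler_sqr ?nnegrE ?md_ge0 ?addr_ge0// sqr_md /sqn.
rewrite sqrrD !real_normK ?num_real//.
by have := mulr_ge0 (normr_ge0 (Re z)) (normr_ge0 (Im z)); lra.
Qed.

Lemma cis_taylor1 t : 0 <= t -> md (cis t - 1) <= t.
Proof.
move=> t0; rewrite -ler_sqr ?nnegrE ?md_ge0// sqr_md /sqn /= subr0.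
by have := cos2Dsin2 t; have := cos_ge t0; nra.
Qed.

Lemma cis_taylor2 t : 0 <= t <= 1 -> md (cis t - 1 - 'i * t%:C) <= 2 / 3 * t ^+ 2.
Proof.
move=> /andP[t0 t1]; apply: le_trans (md_le_abs _) _.
rewrite !cReB !cImB cReM cImM /= !(mul0r, mul1r, mulr0, subr0, add0r, addr0, subrr, oppr0, sub0r).
rewrite ler0_norm; last by rewrite subr_le0 cos_le1.
rewrite ler0_norm; last by rewrite subr_le0 sin_le.
have := cos_ge t0; have := sin_ge t0.
have : t ^+ 3 <= t ^+ 2 by rewrite ler_wiXn2l.
lra.
Qed.

(** A planar curve [D] with [|D'| <= 3 K t^2 |D|] and [D 0 = 1] stays within
    [exp (K t^3) - 1] of 1.  The two coordinates are kept separate, since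
    derivatives are real. *)
Lemma gronwall_cubic_rate (D1 D2 D1' D2' : R -> R) (K T : R) : 0 <= K -> 0 <= T ->
  D1 0 = 1 -> D2 0 = 0 ->
  (forall t, 0 <= t <= T -> is_derive t 1 D1 (D1' t)) ->
  (forall t, 0 <= t <= T -> is_derive t 1 D2 (D2' t)) ->
  (forall t, 0 < t < T -> D1' t ^+ 2 + D2' t ^+ 2 <=
     (3 * K * t ^+ 2) ^+ 2 * (D1 t ^+ 2 + D2 t ^+ 2)) ->
  `|D1 T - 1| <= expR (K * T ^+ 3) - 1 /\ `|D2 T| <= expR (K * T ^+ 3) - 1.
Proof.
move=> K0 T0 D10 D20 dD1 dD2 bnd.
pose N t := D1 t ^+ 2 + D2 t ^+ 2.
pose H t := K * t ^+ 3.
have dH t : is_derive t 1 H (3 * K * t ^+ 2).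
  by apply: is_derive_eq; rewrite /GRing.scale /=; ring.
have N_le t : 0 <= t <= T -> N t <= expR (2 * H t).
  move=> /andP[t0 tT].
  have := @derive_ge0_le _ (fun u => - (expR (- (2 * H u)) * N u))
    (fun u => - (expR (- (2 * H u)) * (2 * (D1 u * D1' u + D2 u * D2' u)
       - 2 * (3 * K * u ^+ 2) * N u))) 0 t t0.
  have H0 : H 0 = 0 by rewrite /H expr0n mulr0.
  have N1 : N 0 = 1 by rewrite /N D10 D20 expr1n expr0n addr0.
  rewrite lerN2 H0 N1 mulr0 oppr0 expR0 mulr1 expRN [(expR _)^-1 * _]mulrC.
  rewrite ler_pdivrMr ?expR_gt0// mul1r; apply.
    move=> u /andP[u0 ut]; have uT : 0 <= u <= T by rewrite u0 (le_trans ut).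
    have d1 := dD1 u uT; have d2 := dD2 u uT; have d3 := dH u.
    rewrite /N; apply: is_derive_eq; rewrite /GRing.scale /=; ring.
  move=> u /andP[u0 ut]; have uT : 0 < u < T by rewrite u0 (lt_le_trans ut).
  rewrite oppr_ge0 mulr_ge0_le0 ?expR_ge0// subr_le0.
  rewrite -mulrA ler_pM2l//.
  have N0 : 0 <= N u by rewrite addr_ge0 ?sqr_ge0.
  have e0 : 0 <= 3 * K * u ^+ 2 by rewrite mulr_ge0 ?sqr_ge0 ?mulr_ge0.
  apply: (le_trans (ler_norm _)).
  rewrite -ler_sqr ?nnegrE ?(mulr_ge0 e0 N0)// real_normK ?num_real//.
  apply: (@le_trans _ _ (N u * (D1' u ^+ 2 + D2' u ^+ 2))).
    rewrite -subr_ge0 /N.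
    have -> : (D1 u ^+ 2 + D2 u ^+ 2) * (D1' u ^+ 2 + D2' u ^+ 2) -
      (D1 u * D1' u + D2 u * D2' u) ^+ 2 = (D1 u * D2' u - D2 u * D1' u) ^+ 2 by ring.
    exact: sqr_ge0.
  rewrite exprMn mulrC [leRHS](_ : _ = (3 * K * u ^+ 2) ^+ 2 * N u * N u); last by ring.
  by rewrite ler_wpM2r// bnd.
have D'_le (D' : R -> R) t : 0 < t < T -> D' t ^+ 2 <= D1' t ^+ 2 + D2' t ^+ 2 ->
    `|D' t| <= 3 * K * t ^+ 2 * expR (H t).
  move=> tT; have /andP[t0 tT'] := tT => h.
  have e0 : 0 <= 3 * K * t ^+ 2 by rewrite mulr_ge0 ?sqr_ge0 ?mulr_ge0.
  rewrite -ler_sqr ?nnegrE ?(mulr_ge0 e0 (expR_ge0 _))// real_normK ?num_real//.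
  apply: (le_trans h); apply: (le_trans (bnd t tT)).
  rewrite [leRHS]exprMn ler_wpM2l ?sqr_ge0// -expRM_natl.
  by apply: N_le; rewrite !ltW.
have dE t : is_derive t 1 (fun u => expR (H u)) (3 * K * t ^+ 2 * expR (H t)).
  by have d3 := dH t; apply: is_derive_eq; rewrite /GRing.scale /=; ring.
have main (D D' : R -> R) : (forall t, 0 <= t <= T -> is_derive t 1 D (D' t)) ->
    (forall t, 0 < t < T -> D' t ^+ 2 <= D1' t ^+ 2 + D2' t ^+ 2) ->
    `|D T - D 0| <= expR (H T) - 1.
  move=> dD h; rewrite ler_norml.
  have h1 := @derive_ge0_le _ (fun u => expR (H u) + D u)
    (fun u => 3 * K * u ^+ 2 * expR (H u) + D' u) 0 T T0.
  have h2 := @derive_ge0_le _ (fun u => expR (H u) - D u)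
    (fun u => 3 * K * u ^+ 2 * expR (H u) - D' u) 0 T T0.
  have H0 : expR (H 0) = 1 by rewrite /H expr0n mulr0 expR0.
  have {}h1 : 1 + D 0 <= expR (H T) + D T.
    rewrite -H0; apply: h1 => u uT; first by apply: is_deriveD => //; exact: dD.
    by have := D'_le D' u uT (h u uT); rewrite ler_norml => /andP[]; lra.
  have {}h2 : 1 - D 0 <= expR (H T) - D T.
    rewrite -H0; apply: h2 => u uT; first by apply: is_deriveB => //; exact: dD.
    by have := D'_le D' u uT (h u uT); rewrite ler_norml => /andP[]; lra.
  by apply/andP; split; lra.
split.
  by rewrite -{1}D10; apply: main dD1 _ => t _; rewrite lerDl sqr_ge0.
by rewrite -[D2 T]subr0 -D20; apply: main dD2 _ => t _; rewrite lerDr sqr_ge0.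
Qed.

Lemma cisX t k : cis t ^+ k = cis (t * k%:R) :> R[i].
Proof.
elim: k => [|k IH]; first by rewrite expr0 mulr0 /cis cos0 sin0.
by rewrite exprS IH -cisD -natr1 mulrDr mulr1 addrC.
Qed.

Lemma centered_charfunE p n (mu t : R) : (size p <= n)%N ->
  (polyRC p).[cis t] * cis (- (mu * t)) =
  (\sum_(i < n) p`_i * cos (t * (i%:R - mu))) +i*
  (\sum_(i < n) p`_i * sin (t * (i%:R - mu))).
Proof.
move=> sp; rewrite (@horner_coef_wide _ n); last first.
  by rewrite size_map_inj_poly//; exact: complexI.
have cD (a b c d' : R) : (a + c) +i* (b + d') = (a +i* b) + (c +i* d') by [].
elim: n {sp} => [|n IH]; first by rewrite !big_ord0 mul0r.
rewrite !big_ord_recr /= mulrDl IH cD coef_map cisX -mulrA -cisD; congr (_ + _).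
rewrite (_ : t * n%:R + - (mu * t) = t * (n%:R - mu)); last by ring.
by rewrite /cis; simpc.
Qed.

(** With [phi t = p (exp (i t)) exp (- i mu t)], the derivative of
    [phi t exp (sigma^2 t^2 / 2)] is [i (m z - mu - i sigma^2 t)] times itself,
    where [m z = z p' z / p z] at [z = exp (i t)]; the Taylor bound on [m] makes
    the logarithmic derivative at most [7 sigma^2 t^2 / r].  Up to [t = r / 10]
    the resulting factor [exp (7/3 sigma^2 t^3 / r)] is at most
    [exp (sigma^2 t^2 / 4)], which leaves half of the Gaussian decay. *)
Lemma charfun_estimate d p n r t : sector_free d p -> size p = n.+2 ->
  0 < d <= pi / 2 -> 0 < r < sin d -> p.[1] = 1 -> 0 <= t <= r / 10 ->
  let mu := kap1 p 1 in let s2 := kap2 p 1 in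
  let e := 7 / 3 * s2 / r * t ^+ 3 * expR (- (s2 * t ^+ 2 / 4)) in
  `|\sum_(i < n.+2) p`_i * cos (t * (i%:R - mu)) - expR (- (s2 * t ^+ 2 / 2))| <= e /\
  `|\sum_(i < n.+2) p`_i * sin (t * (i%:R - mu))| <= e.
Proof.
move=> sf sp dpi rd p1 /andP[t0 tr] mu s2 e.
have [p0 p00 _] := sf; have /andP[r0 rs] := rd.
have r1 : r < 1 by have := sin_le1 d; lra.
have a0 : 0 < s2 by apply: kap2_gt0 sp.
pose P := polyRC p.
pose phi u := P.[1%:C * cis u] * cis (- (mu * u)).
pose W u := 'i * (1%:C * cis u) * P^`().[1%:C * cis u]
  - 'i * mu%:C * P.[1%:C * cis u] + (s2 * u)%:C * P.[1%:C * cis u].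
pose G u := expR (s2 * u ^+ 2 / 2).
pose D1 u := G u * Re (phi u); pose D2 u := G u * Im (phi u).
have dG (u : R) : is_derive u 1 G (s2 * u * G u).
  by rewrite /G; apply: is_derive_eq; rewrite /GRing.scale /=; field.
have dphi (u : R) : is_derive u 1 D1 (G u * Re (W u * cis (- (mu * u)))) /\
    is_derive u 1 D2 (G u * Im (W u * cis (- (mu * u)))).
  have [dR dI] := is_derive_horner_cis P 1 u.
  have dg := dG u.
  split.
    rewrite /D1 /phi; under eq_fun do rewrite cReM /=.
    apply: is_derive_eq; rewrite /W /GRing.scale /=.
    set z := 1%:C * cis u; rewrite !(cReM, cImM, cReD, cImD, cReB, cImB, cReN, cImN) /=; ring.
  rewrite /D2 /phi; under eq_fun do rewrite cImM /=.
  apply: is_derive_eq; rewrite /W /GRing.scale /=.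
  set z := 1%:C * cis u; rewrite !(cReM, cImM, cReD, cImD, cReB, cImB, cReN, cImN) /=; ring.
pose K := 7 / 3 * s2 / r.
have K0 : 0 <= K by rewrite !mulr_ge0 ?invr_ge0// ltW.
have W_le u : 0 < u < t -> md (W u) <= 3 * K * u ^+ 2 * md P.[1%:C * cis u].
  move=> /andP[u0 ut].
  have one1 : 1%:C * cis u = cis u by rewrite mul1r.
  rewrite /W one1; set z := cis u.
  have zt1 : md (z - 1) <= u by apply: cis_taylor1; exact: ltW.
  have zt2 : md (z - 1 - 'i * u%:C) <= 2 / 3 * u ^+ 2.
    by apply: cis_taylor2; apply/andP; split; lra.
  have := mean_taylor sf sp dpi rd (z := z); rewrite -horner_derivRC -/P -/mu -/s2.
  have -> : (md (z - 1) <= r / 2) = true by apply: (le_trans zt1); lra.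
  move=> /(_ isT) h.
  have -> : 'i * z * P^`().[z] - 'i * mu%:C * P.[z] + (s2 * u)%:C * P.[z] =
    'i * ((z * P^`().[z] - (mu%:C + s2%:C * (z - 1)) * P.[z])
      + s2%:C * (z - 1 - 'i * u%:C) * P.[z]).
    have ii : ('i * 'i : R[i]) = -1 by rewrite -expr2 sqr_i.
    rewrite [RHS](_ : _ = 'i * z * P^`().[z] - 'i * mu%:C * P.[z]
      - ('i * 'i) * (s2%:C * u%:C * P.[z])); last by ring.
    have cM : (s2 * u)%:C = s2%:C * u%:C :> R[i] by rewrite rmorphM.
    by rewrite ii mulN1r opprK cM.
  rewrite mdM; have -> : md ('i : R[i]) = 1.
    by rewrite /md /sqn /= expr0n expr1n add0r sqrtr1.
  rewrite mul1r; apply: le_trans (le_mdD _ _) _.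
  rewrite !mdM md_real (gtr0_norm a0).
  have f0 := md_ge0 P.[z].
  have q1 : md (z - 1) ^+ 2 <= u ^+ 2 by rewrite ler_sqr ?nnegrE ?md_ge0// ltW.
  apply: (@le_trans _ _ ((6 * s2 / r * u ^+ 2 + s2 * (2 / 3 * u ^+ 2)) * md P.[z])).
    rewrite [leRHS]mulrDl lerD//.
      apply: (le_trans h); rewrite ler_wpM2r// ler_wpM2l// !mulr_ge0 ?invr_ge0 ?(ltW a0)//.
      exact: ltW.
    by rewrite ler_wpM2r// ler_wpM2l// ltW.
  rewrite ler_wpM2r// /K.
  have : s2 * u ^+ 2 <= s2 / r * u ^+ 2.
    rewrite ler_wpM2r ?sqr_ge0// ler_peMr ?(ltW a0)//.
    by rewrite invf_ge1// ltW.
  have : 0 <= s2 * u ^+ 2 by rewrite mulr_ge0 ?sqr_ge0// ltW.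
  lra.
have phi0 : phi 0 = 1.
  by rewrite /phi mul1r mulr0 oppr0 /cis cos0 sin0 mulr1 horner_polyRC p1.
have G0 : G 0 = 1 by rewrite /G expr0n mulr0 mul0r expR0.
have [|||b1 b2] := @gronwall_cubic_rate D1 D2 _ _ K t K0 t0 _ _
   (fun u _ => (dphi u).1) (fun u _ => (dphi u).2).
- by rewrite /D1 phi0 G0 mulr1.
- by rewrite /D2 phi0 G0 mulr0.
- move=> u ut.
  have h := W_le u ut.
  have -> : (G u * Re (W u * cis (- (mu * u)))) ^+ 2 +
     (G u * Im (W u * cis (- (mu * u)))) ^+ 2 = (G u * md (W u)) ^+ 2.
    rewrite !exprMn sqr_md -mulrDr; congr (_ * _).
    by rewrite -/(sqn _) sqnM -[sqn (cis _)]sqr_md md_cis expr1n mulr1.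
  have -> : D1 u ^+ 2 + D2 u ^+ 2 = (G u * md P.[1%:C * cis u]) ^+ 2.
    rewrite /D1 /D2 !exprMn sqr_md -mulrDr; congr (_ * _).
    by rewrite -/(sqn _) sqnM -[sqn (cis _)]sqr_md md_cis expr1n mulr1.
  have e0 : 0 <= 3 * K * u ^+ 2 by rewrite mulr_ge0 ?sqr_ge0// mulr_ge0.
  have GP : 0 <= G u * md P.[1%:C * cis u] by rewrite mulr_ge0 ?md_ge0 ?expR_ge0.
  have GW : 0 <= G u * md (W u) by rewrite mulr_ge0 ?md_ge0 ?expR_ge0.
  rewrite -exprMn ler_sqr ?nnegrE ?(mulr_ge0 e0 GP)//.
  by rewrite mulrCA ler_wpM2l ?expR_ge0.

have E := @centered_charfunE p n.+2 mu t (eq_leq sp).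
have Rphi : Re (phi t) = \sum_(i < n.+2) p`_i * cos (t * (i%:R - mu)).
  by rewrite /phi mul1r E.
have Iphi : Im (phi t) = \sum_(i < n.+2) p`_i * sin (t * (i%:R - mu)).
  by rewrite /phi mul1r E.
rewrite -Rphi -Iphi.
have Gp : 0 < G t := expR_gt0 _.
have GV : expR (- (s2 * t ^+ 2 / 2)) = (G t)^-1 by rewrite expRN.
have H_le : K * t ^+ 3 <= s2 * t ^+ 2 / 4.
  rewrite /K exprS.
  have -> : 7 / 3 * s2 / r * (t * t ^+ 2) = s2 * t ^+ 2 * (7 / 3 * (t / r)) by ring.
  have -> : s2 * t ^+ 2 / 4 = s2 * t ^+ 2 * (1 / 4) by ring.
  rewrite ler_wpM2l ?mulr_ge0 ?sqr_ge0 ?(ltW a0)//.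
  have : t / r <= 1 / 10 by rewrite ler_pdivrMr//; lra.
  lra.
have eH : expR (K * t ^+ 3) - 1 <= K * t ^+ 3 * expR (K * t ^+ 3).
  have := expR_ge1Dx (- (K * t ^+ 3)); rewrite expRN -div1r.
  rewrite ler_pdivlMr ?expR_gt0//; lra.
have fin X : `|X| <= expR (K * t ^+ 3) - 1 ->
    `|X / G t| <= K * t ^+ 3 * expR (- (s2 * t ^+ 2 / 4)).
  move=> h; rewrite normrM normfV (gtr0_norm Gp) ler_pdivrMr//.
  apply: (le_trans h); apply: (le_trans eH); rewrite -[leRHS]mulrA.
  rewrite ler_wpM2l ?(mulr_ge0 K0 (exprn_ge0 _ t0))// /G -expRD ler_expR; lra.
split.
  rewrite GV; have -> : Re (phi t) - (G t)^-1 = (D1 t - 1) / G t.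
    by rewrite /D1; field; rewrite gt_eqF.
  exact: fin.
have -> : Im (phi t) = D2 t / G t by rewrite /D2; field; rewrite gt_eqF.
exact: fin.
Qed.

End charfun.

(** * The standard normal density *)
Section gaussian.
Context {R : realType}.
Implicit Types (x y s t a : R).
Notation mu := (@lebesgue_measure R).
Notation w := (@normal_pdf R 0 1).

Lemma normal_pdf01E x : w x = normal_peak 1 * expR (- (x ^+ 2 / 2)).
Proof.
rewrite normal_pdfE ?oner_neq0// /normal_fun subr0 expr1n.
by rewrite mulNr.
Qed.

Lemma is_derive_normal_pdf x : is_derive x 1 w (- (x * w x)).
Proof.
have -> : w = (fun x => normal_peak 1 * expR (- (x ^+ 2 / 2))).
  by apply/funext => y; exact: normal_pdf01E.
by apply: is_derive_eq; rewrite /GRing.scale /=; field.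
Qed.

Lemma continuous_normal_pdf01 : continuous w.
Proof. by apply: continuous_normal_pdf; exact: oner_neq0. Qed.

Lemma measurable_w : measurable_fun setT w.
Proof. exact: measurable_normal_pdf. Qed.

Lemma normal_pdf01_ge0 x : 0 <= w x. Proof. exact: normal_pdf_ge0. Qed.

(** Comparison with the normal density of variance 2. *)
Lemma integrable_normal_moment1 :
  mu.-integrable setT (EFin \o (fun x => w x * (1 + `|x|))).
Proof.
have mf : measurable_fun setT (fun x : R => w x * (1 + `|x|)).
  apply: measurable_funM; first exact: measurable_w.
  by apply: measurable_funD => //; exact: measurable_normr.
pose c := 2 * @normal_peak R 1 / normal_peak (Num.sqrt 2).
have s2 : Num.sqrt 2 != 0 :> R by rewrite sqrtr_eq0 -ltNge.
have k2 : 0 < @normal_peak R (Num.sqrt 2) by exact: normal_peak_gt0.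
have k1 : 0 <= @normal_peak R 1 by exact: normal_peak_ge0.
apply: (le_integrable measurableT _ _
  (integrableZl measurableT c (integrable_normal_pdf 0 (Num.sqrt 2)))).
  exact/measurable_EFinP.
move=> x _ /=; rewrite lee_fin.
rewrite ger0_norm; last by rewrite mulr_ge0 ?normal_pdf01_ge0// addr_ge0.
apply: le_trans (ler_norm _).
have -> : normal_pdf 0 (Num.sqrt 2) x = normal_peak (Num.sqrt 2) * expR (- (x ^+ 2 / 4)).
  rewrite normal_pdfE// /normal_fun subr0 sqr_sqrtr// mulNr.
  by congr (_ * expR (- (_ / _))); rewrite mulr2n; ring.
rewrite normal_pdf01E /c.
have -> : 2 * normal_peak 1 / normal_peak (Num.sqrt 2) *
    (normal_peak (Num.sqrt 2) * expR (- (x ^+ 2 / 4))) =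
    normal_peak 1 * (2 * expR (- (x ^+ 2 / 4))) by field; rewrite gt_eqF.
rewrite -mulrA ler_wpM2l//.
have -> : expR (- (x ^+ 2 / 2)) = expR (- (x ^+ 2 / 4)) * expR (- (x ^+ 2 / 4)).
  by rewrite -expRD; congr expR; field.
rewrite -mulrA [leRHS]mulrC ler_wpM2l ?expR_ge0// expRN mulrC ler_pdivrMr ?expR_gt0//.
have := expR_ge1Dx (x ^+ 2 / 4); rewrite -real_normK ?num_real//.
have := sqr_ge0 (`|x| - 1); lra.
Qed.

Lemma integrable_normal_le (f : R -> R) (c : R) : measurable_fun setT f ->
  (forall x, `|f x| <= c * (w x * (1 + `|x|))) ->
  mu.-integrable setT (EFin \o f).
Proof.
move=> mf fc; apply: (le_integrable measurableT _ _
  (integrableZl measurableT c integrable_normal_moment1)).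
  exact/measurable_EFinP.
by move=> x _ /=; rewrite lee_fin; apply: le_trans (fc x) (ler_norm _).
Qed.

(** Fundamental theorem of calculus on the whole line, for a primitive that
    vanishes at both ends. *)
Lemma Rintegral_derivative0 (h H : R -> R) : continuous h ->
  mu.-integrable setT (EFin \o h) -> (forall x, is_derive x 1 H (h x)) ->
  H n%:R @[n --> \oo] --> 0 -> H (- n%:R) @[n --> \oo] --> 0 ->
  (\int[mu]_x h x = 0)%R.
Proof.
move=> ch ih dH Hp Hm.
pose A (n : nat) := `[- n%:R, n%:R]%classic : set R.
pose f_ n := EFin \o (h \_ (A n)).
have mh : measurable_fun setT h by exact: continuous_measurable_fun.
have mA n : measurable (A n) by exact: measurable_itv.
have mf n : measurable_fun setT (f_ n).
  apply/measurable_EFinP; apply/(measurable_restrictT _ _).1 => //.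
  exact: measurable_funTS.
have [||||_ _ cvg1] := @dominated_convergence _ _ _ mu _ measurableT f_ (EFin \o h)
  (EFin \o (fun x => `|h x|)) mf.
- exact/measurable_EFinP.
- apply/aeW => x _; apply: cvg_near_cst; near=> n.
  rewrite /f_ /= patchE mem_set// /A /= in_itv /= -ler_norml.
  near: n; exact: nbhs_infty_ger.
- exact: integrable_norm.
- apply/aeW => x n _; rewrite /f_ /= patchE lee_fin; case: ifP => // _.
  by rewrite normr0.
have E n : (0 < n)%N -> (\int[mu]_x (f_ n x))%E = (H n%:R - H (- n%:R))%:E.
  move=> n0; have nn : - n%:R < n%:R :> R.
    by rewrite (@lt_trans _ _ 0) ?oppr_lt0 ?ltr0n.
  rewrite (_ : f_ n = (EFin \o h) \_ (A n)); last by rewrite restrict_EFin.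
  rewrite -integral_mkcond (@continuous_FTC2 _ h H)//.
  - exact: continuous_subspaceT.
  - have cH : continuous H.
      by move=> x; apply: differentiable_continuous; apply/derivable1_diffP; case: (dH x).
    split.
    + by move=> x _; case: (dH x).
    + by apply: cvg_at_right_filter; exact: cH.
    + by apply: cvg_at_left_filter; exact: cH.
  - by move=> x _; rewrite derive1E; case: (dH x).
have cvg2 : (\int[mu]_x (f_ n x))%E @[n --> \oo] --> (0 - 0 : R)%:E.
  apply: (@cvg_trans _ ((H n%:R - H (- n%:R))%:E @[n --> \oo])).
    apply: near_eq_cvg; near=> n; rewrite E//.
    near: n; exact: nbhs_infty_gt.
  by apply: cvg_EFin; [near=> n|apply: cvgB].
rewrite /Rintegral.
have := cvg_unique (@ereal_hausdorff R) cvg1 cvg2 => ->.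
by rewrite subrr.
Unshelve. all: end_near. Qed.

End gaussian.

(** * The characteristic function of the normal law *)
Section gaussian_cf.
Context {R : realType}.
Implicit Types (x y s t a : R).
Notation mu := (@lebesgue_measure R).
Notation w := (@normal_pdf R 0 1).

Lemma continuous_cos_affine s phi : continuous (fun x : R => cos (s * x + phi)).
Proof.
move=> x; apply: continuous_comp; last exact: continuous_cos.
by apply: cvgD; [apply: cvgM; [exact: cvg_cst|exact: cvg_id]|exact: cvg_cst].
Qed.

Lemma continuous_sin_affine s phi : continuous (fun x : R => sin (s * x + phi)).
Proof.
move=> x; apply: continuous_comp; last exact: continuous_sin.
by apply: cvgD; [apply: cvgM; [exact: cvg_cst|exact: cvg_id]|exact: cvg_cst].
Qed.

Lemma norm_cos_le1 x : `|cos x| <= 1.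
Proof. by rewrite ler_norml cos_geN1 cos_le1. Qed.

Lemma norm_sin_le1 x : `|sin x| <= 1.
Proof. by rewrite ler_norml sin_geN1 sin_le1. Qed.

Lemma integrable_RB (D : set R) (f g : R -> R) : measurable D ->
  mu.-integrable D (EFin \o f) -> mu.-integrable D (EFin \o g) ->
  mu.-integrable D (EFin \o (fun x => f x - g x)).
Proof.
move=> mD fi gi; have := @integrableB _ _ R mu D mD _ _ fi gi.
by apply: eq_integrable => // x _ /=; rewrite EFinB.
Qed.

Lemma integrable_RD (D : set R) (f g : R -> R) : measurable D ->
  mu.-integrable D (EFin \o f) -> mu.-integrable D (EFin \o g) ->
  mu.-integrable D (EFin \o (fun x => f x + g x)).
Proof.
move=> mD fi gi; have := @integrableD _ _ R mu D mD _ _ fi gi.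
by apply: eq_integrable => // x _ /=; rewrite EFinD.
Qed.

Lemma integrable_RZ (D : set R) (k : R) (f : R -> R) : measurable D ->
  mu.-integrable D (EFin \o f) -> mu.-integrable D (EFin \o (fun x => k * f x)).
Proof.
move=> mD fi; have := @integrableZl _ _ R mu D mD k _ fi.
by apply: eq_integrable => // x _ /=; rewrite EFinM.
Qed.

Lemma integrable_normal_cos s phi :
  mu.-integrable setT (EFin \o (fun x => w x * cos (s * x + phi))).
Proof.
apply: (@integrable_normal_le _ _ 1).
  apply: measurable_funM; first exact: measurable_w.
  exact: continuous_measurable_fun (@continuous_cos_affine s phi).
move=> x; rewrite mul1r normrM (ger0_norm (normal_pdf01_ge0 x)).
rewrite ler_wpM2l ?normal_pdf01_ge0//.
by apply: le_trans (norm_cos_le1 _) _; rewrite lerDl.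
Qed.

Lemma integrable_normal_sin1 s phi :
  mu.-integrable setT (EFin \o (fun x => x * w x * sin (s * x + phi))).
Proof.
apply: (@integrable_normal_le _ _ 1).
  apply: measurable_funM.
    by apply: measurable_funM => //; exact: measurable_w.
  exact: continuous_measurable_fun (@continuous_sin_affine s phi).
move=> x; rewrite mul1r !normrM (ger0_norm (normal_pdf01_ge0 x)).
apply: (@le_trans _ _ (`|x| * w x * 1)).
  by rewrite ler_wpM2l ?norm_sin_le1// mulr_ge0 ?normal_pdf01_ge0.
by rewrite mulr1 mulrC ler_wpM2l ?normal_pdf01_ge0// lerDr.
Qed.

Lemma normal_pdf01N x : w (- x) = w x.
Proof. by rewrite !normal_pdf01E sqrrN. Qed.

Lemma cvg0_le_inv (u : R ^nat) (c : R) :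
  (forall n, (0 < n)%N -> `|u n| <= c / n%:R) -> u n @[n --> \oo] --> 0.
Proof.
move=> h; apply/cvgr0Pnorm_le => e e0; near=> n.
have n0 : (0 < n)%N by near: n; exact: nbhs_infty_gt.
apply: (le_trans (h n n0)); rewrite ler_pdivrMr ?ltr0n// mulrC -ler_pdivrMr//.
by near: n; exact: nbhs_infty_ger.
Unshelve. all: end_near. Qed.

Lemma normal_pdf01_le_inv (n : nat) : (n > 0)%N -> w n%:R <= 2 * normal_peak 1 / n%:R.
Proof.
move=> n0; have n1 : 0 < n%:R :> R by rewrite ltr0n.
have n2 : 1 <= n%:R :> R by rewrite ler1n.
rewrite normal_pdf01E [leRHS](_ : _ = normal_peak 1 * (2 / n%:R)); last by ring.
rewrite ler_wpM2l ?normal_peak_ge0//.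
rewrite expRN ler_pdivlMr// mulrC ler_pdivrMr ?expR_gt0//.
have := expR_ge1Dx (n%:R ^+ 2 / 2 : R).
have : n%:R <= n%:R ^+ 2 :> R by rewrite expr2 ler_peMr// ltW.
lra.
Qed.

(** Characteristic function of the standard normal law, with a phase that covers
    cosines and sines at once: the integral solves [c' = - s c], by
    differentiation under the integral sign and integration by parts. *)
Lemma is_derive_normal_cf s phi :
  is_derive s 1 (fun s => \int[mu]_x (w x * cos (s * x + phi)))%R
   (- (s * \int[mu]_x (w x * cos (s * x + phi))))%R.
Proof.
pose f (s x : R) : R := w x * cos (s * x + phi).
have df (u x : R) : is_derive u 1 (f ^~ x) (- (x * w x * sin (u * x + phi))).
  by rewrite /f; apply: is_derive_eq; rewrite /GRing.scale /=; ring.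
have d1E (u x : R) : partial1of2 f u x = - (x * w x * sin (u * x + phi)).
  by rewrite partial1of2E; case: (df u x).
have sI : `]s - 1, s + 1[%classic s by rewrite /= in_itv /=; apply/andP; split; lra.
have intf (u : R) : `]s - 1, s + 1[%classic u -> mu.-integrable setT (EFin \o f u).
  by move=> _; exact: integrable_normal_cos.
have derf (u x : R) : `]s - 1, s + 1[%classic u -> setT x -> derivable (f ^~ x) u 1.
  by move=> _ _; case: (df u x).
have G0 x : 0 <= w x * (1 + `|x|) by rewrite mulr_ge0 ?normal_pdf01_ge0// addr_ge0.
have Gub (u x : R) : `]s - 1, s + 1[%classic u -> setT x ->
    `|partial1of2 f u x| <= w x * (1 + `|x|).
  move=> _ _; rewrite d1E normrN !normrM (ger0_norm (normal_pdf01_ge0 x)).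
  apply: (@le_trans _ _ (`|x| * w x * 1)).
    by rewrite ler_wpM2l ?norm_sin_le1// mulr_ge0 ?normal_pdf01_ge0.
  by rewrite mulr1 mulrC ler_wpM2l ?normal_pdf01_ge0// lerDr.
have D1 := derivable_under_integral measurableT sI intf derf G0
  integrable_normal_moment1 Gub.
have D2 := differentiation_under_integral measurableT sI intf derf G0
  integrable_normal_moment1 Gub.
apply: DeriveDef; first exact: D1.
rewrite -derive1E D2.
under eq_Rintegral do rewrite d1E.
have ibp : (\int[mu]_x (s * (w x * cos (s * x + phi))
    - x * w x * sin (s * x + phi)) = 0)%R.
  have dH x : is_derive x 1 (fun x => w x * sin (s * x + phi))
      (s * (w x * cos (s * x + phi)) - x * w x * sin (s * x + phi)).
    move: (is_derive_normal_pdf x); move: (normal_pdf 0 1) => v dv.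
    by apply: is_derive_eq; rewrite /GRing.scale /=; ring.
  refine (Rintegral_derivative0 _ _ dH _ _).
  - move=> x; apply: cvgB; apply: cvgM.
    + exact: cvg_cst.
    + by apply: cvgM; [exact: continuous_normal_pdf01|exact: continuous_cos_affine].
    + by apply: cvgM; [exact: cvg_id|exact: continuous_normal_pdf01].
    + exact: continuous_sin_affine.
  - apply: integrable_RB => //; last exact: integrable_normal_sin1.
    by apply: integrable_RZ => //; exact: integrable_normal_cos.
  - apply: (@cvg0_le_inv _ (2 * normal_peak 1)) => n n0.
    rewrite normrM (ger0_norm (normal_pdf01_ge0 _)).
    apply: le_trans (normal_pdf01_le_inv n0).
    by rewrite ler_piMr ?normal_pdf01_ge0// norm_sin_le1.
  - apply: (@cvg0_le_inv _ (2 * normal_peak 1)) => n n0.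
    rewrite normrM (ger0_norm (normal_pdf01_ge0 _)) normal_pdf01N.
    apply: le_trans (normal_pdf01_le_inv n0).
    by rewrite ler_piMr ?normal_pdf01_ge0// norm_sin_le1.
rewrite RintegralB// in ibp; last 2 first.
  by apply: integrable_RZ => //; exact: integrable_normal_cos.
  exact: integrable_normal_sin1.
rewrite RintegralZl// in ibp; last exact: integrable_normal_cos.
have -> : (\int[mu]_x - (x * w x * sin (s * x + phi)) =
  - \int[mu]_x (x * w x * sin (s * x + phi)))%R.
  under eq_Rintegral do rewrite -mulN1r.
  by rewrite RintegralZl// ?mulN1r//; exact: integrable_normal_sin1.
move: ibp => /eqP; rewrite subr_eq0 => /eqP ->; exact: erefl.
Qed.

(** The equation [c' = - s c] makes [c exp (s^2 / 2)] constant. *)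
Lemma normal_cf s phi : 0 <= s ->
  (\int[mu]_x (w x * cos (s * x + phi)) = cos phi * expR (- (s ^+ 2 / 2)))%R.
Proof.
move=> s0; pose c (s : R) : R := (\int[mu]_x (w x * cos (s * x + phi)))%R.
pose q (u : R) := c u * expR (u ^+ 2 / 2).
have dq (u : R) : is_derive u 1 q 0.
  have dc := is_derive_normal_cf u phi.
  by rewrite /q /c; apply: is_derive_eq; rewrite /GRing.scale /=; field.
have dqN (u : R) : is_derive u 1 (fun u => - q u) 0.
  by have h := dq u; apply: is_derive_eq; rewrite oppr0.
have c0 : c 0 = cos phi.
  rewrite /c; under eq_Rintegral do rewrite mul0r add0r mulrC.
  rewrite RintegralZl//; last exact: integrable_normal_pdf.
  by rewrite /Rintegral integral_normal_pdf mulr1.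
have qs : q s = q 0.
  apply/eqP; rewrite eq_le; apply/andP; split.
    rewrite -lerN2.
    exact: (@derive_ge0_le _ (fun u => - q u) (fun=> 0)).
  exact: (@derive_ge0_le _ q (fun=> 0)).
move: qs; rewrite /q c0 expr0n mul0r expR0 mulr1 -/(c s) => <-.
by rewrite expRN mulfK// gt_eqF// expR_gt0.
Qed.

End gaussian_cf.

(** * Band-limited kernels *)
Section kernels.
Context {R : realType}.
Implicit Types (x y s t a : R).
Notation mu := (@lebesgue_measure R).
Notation D := (`]0, 1]%classic : set R).

Lemma integrable_D_continuous (f : R -> R) : continuous f -> mu.-integrable D (EFin \o f).
Proof.
move=> cf; apply: (@integrableS _ _ R mu `[0, 1]).
- exact: measurable_itv.
- exact: measurable_itv.
- by move=> x /=; rewrite !in_itv /= => /andP[/ltW -> ->].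
apply: continuous_compact_integrable; first exact: segment_compact.
exact: continuous_subspaceT.
Qed.

Lemma Rintegral_D_FTC (f F : R -> R) : continuous f ->
  (forall t, is_derive t 1 F (f t)) -> (\int[mu]_(t in D) f t = F 1 - F 0)%R.
Proof.
move=> cf dF; rewrite Rintegral_itv_obnd_cbnd; last first.
  exact: integrable_D_continuous.
have cF : continuous F.
  by move=> x; apply: differentiable_continuous; apply/derivable1_diffP; case: (dF x).
rewrite /Rintegral (@continuous_FTC2 _ f F)//.
- exact: continuous_subspaceT.
- split.
  + by move=> x _; case: (dF x).
  + by apply: cvg_at_right_filter; exact: cF.
  + by apply: cvg_at_left_filter; exact: cF.
- by move=> x _; rewrite derive1E; case: (dF x).
Qed.

(** Fourier weights, supported in the unit interval.  Both vanish at 1 to an order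
    that makes the kernels decay: [Bk x] is of order [x^-2], and [Sk x] differs
    from its limit by [O (x^-3)].  Their values are elementary ([BkE], [psiE]). *)
Definition kB t : R := (1 - t) ^+ 2.
Definition kS t : R := (1 - t) ^+ 3 * (1 + 3 * t).

Definition Bk x : R := (\int[mu]_(t in D) (kB t * cos (t * x)))%R.
Definition Sk x : R := (\int[mu]_(t in D) (kS t * (sin (t * x) / t)))%R.
(** The derivative of [Sk]. *)
Definition psi x : R := (\int[mu]_(t in D) (kS t * cos (t * x)))%R.

Lemma continuous_kB : continuous kB.
Proof.
move=> t; apply: (@cvgM _ _ _ _ (fun t => 1 - t) (fun t => 1 - t));
  by apply: cvgB; [exact: cvg_cst|exact: cvg_id].
Qed.

Lemma continuous_kS : continuous kS.
Proof.
have c1 : continuous (fun t : R => 1 - t).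
  by move=> t; apply: cvgB; [exact: cvg_cst|exact: cvg_id].
move=> t; apply: cvgM; last first.
  by apply: cvgD; [exact: cvg_cst|apply: cvgM; [exact: cvg_cst|exact: cvg_id]].
rewrite /continuous_at; under eq_fun do rewrite exprS expr2.
rewrite exprS expr2.
by apply: cvgM; [exact: c1|apply: cvgM; exact: c1].
Qed.

Lemma continuous_cosM x : continuous (fun t : R => cos (t * x)).
Proof.
move=> t; apply: continuous_comp; last exact: continuous_cos.
by apply: cvgM; [exact: cvg_id|exact: cvg_cst].
Qed.

Lemma continuous_sinM x : continuous (fun t : R => sin (t * x)).
Proof.
move=> t; apply: continuous_comp; last exact: continuous_sin.
by apply: cvgM; [exact: cvg_id|exact: cvg_cst].
Qed.

(** Repeated integration by parts; [F] is the resulting primitive in [t]. *)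
Lemma BkE x : x != 0 -> Bk x = 2 * (x - sin x) / x ^+ 3.
Proof.
move=> x0; pose F (t : R) := (1 - t) ^+ 2 * (sin (t * x) * x^-1)
   - 2 * (1 - t) * (cos (t * x) * x ^- 2) - 2 * (sin (t * x) * x ^- 3).
have cf : continuous (fun t => kB t * cos (t * x)).
  by move=> t; apply: cvgM; [exact: continuous_kB|exact: continuous_cosM].
have dF (t : R) : is_derive t 1 F (kB t * cos (t * x)).
  by rewrite /F /kB; apply: is_derive_eq; rewrite /GRing.scale /=; field.
rewrite /Bk (Rintegral_D_FTC cf dF) /F.
by rewrite !mul0r !mul1r subr0 sin0 cos0 subrr expr1n; field.
Qed.

Lemma psiE x : x != 0 -> psi x = 24 * (2 * x + x * cos x - 3 * sin x) / x ^+ 5.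
Proof.
move=> x0; pose F (t : R) := kS t * (sin (t * x) * x^-1)
   - 12 * t * (1 - t) ^+ 2 * (cos (t * x) * x ^- 2)
   + 12 * (1 - t) * (1 - 3 * t) * (sin (t * x) * x ^- 3)
   - (48 - 72 * t) * (cos (t * x) * x ^- 4)
   - 72 * (sin (t * x) * x ^- 5).
have cf : continuous (fun t => kS t * cos (t * x)).
  by move=> t; apply: cvgM; [exact: continuous_kS|exact: continuous_cosM].
have dF (t : R) : is_derive t 1 F (kS t * cos (t * x)).
  by rewrite /F /kS; apply: is_derive_eq; rewrite /GRing.scale /=; field.
rewrite /psi (Rintegral_D_FTC cf dF) /F.
by rewrite /kS !mul0r !mul1r !subr0 sin0 cos0 subrr expr1n; field.
Qed.

Lemma norm_sin_le x : `|sin x| <= `|x|.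
Proof.
wlog x0 : x / 0 <= x.
  move=> h; have [|xn] := leP 0 x; first exact: h.
  by rewrite -(normrN (sin x)) -sinN -(normrN x); apply: h; rewrite oppr_ge0 ltW.
rewrite (ger0_norm x0) ler_norml sin_le// andbT.
have := sin_ge x0; have [x1|x1] := leP x 1.
  have : x ^+ 3 <= x by rewrite exprS ler_piMr// expr_le1.
  lra.
by have := sin_geN1 x; lra.
Qed.

Lemma kB_bounds t : D t -> 0 <= kB t <= 1.
Proof.
rewrite /= in_itv /= => /andP[t0 t1]; rewrite sqr_ge0 /=.
by rewrite expr_le1//; lra.
Qed.

Lemma kS_bounds t : D t -> 0 <= kS t <= 1.
Proof.
rewrite /= in_itv /= => /andP[t0 t1]; apply/andP; split.
  by rewrite mulr_ge0 ?exprn_ge0//; lra.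
rewrite -subr_ge0.
have -> : 1 - kS t = t ^+ 2 * (3 * (1 - t) ^+ 2 + 2 * (1 - t) + 1) by rewrite /kS; ring.
by rewrite mulr_ge0 ?sqr_ge0//; have := sqr_ge0 (1 - t); lra.
Qed.

Lemma measurable_D_sinc x : measurable_fun D (fun t : R => sin (t * x) / t).
Proof.
apply: subspace_continuous_measurable_fun; first exact: measurable_itv.
apply: continuous_in_subspaceT => t; rewrite inE /= in_itv /= => /andP[t0 _].
apply: cvgM; first exact: continuous_sinM.
by apply: cvgV; [rewrite gt_eqF|exact: cvg_id].
Qed.

Lemma integrable_D_bounded (f : R -> R) c : measurable_fun D f ->
  (forall t, D t -> `|f t| <= c) -> mu.-integrable D (EFin \o f).
Proof.
move=> mf fc; apply: (@measurable_bounded_integrable _ _ R mu f D) => //.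
- have := @lebesgue_measure_itv R `]0, 1]; rewrite /= lte_fin ltr01 => e.
  by rewrite [X in (X < _)%E]e oppr0 adde0 ltry.
- exists c; split; first exact: num_real.
  by move=> M cM t Dt; apply: le_trans (ltW cM); exact: fc.
Qed.

Lemma sinc_bound x t : D t -> `|sin (t * x) / t| <= `|x|.
Proof.
rewrite /= in_itv /= => /andP[t0 _]; rewrite normrM normfV ler_pdivrMr ?normr_gt0 ?gt_eqF//.
by rewrite -normrM mulrC norm_sin_le.
Qed.

Lemma integrable_sinc (k : R -> R) c x : measurable_fun D k ->
  (forall t, D t -> `|k t| <= c) -> 0 <= c ->
  mu.-integrable D (EFin \o (fun t => k t * (sin (t * x) / t))).
Proof.
move=> mk kc c0; apply: (@integrable_D_bounded _ (c * `|x|)).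
  by apply: measurable_funM => //; exact: measurable_D_sinc.
by move=> t Dt; rewrite normrM ler_pM// ?kc// sinc_bound.
Qed.

Lemma measurable_D_kS : measurable_fun D kS.
Proof.
apply: subspace_continuous_measurable_fun; first exact: measurable_itv.
exact: continuous_subspaceT continuous_kS.
Qed.

Lemma norm_kS_le1 t : D t -> `|kS t| <= 1.
Proof. by move=> /kS_bounds/andP[h1 h2]; rewrite ger0_norm. Qed.

(** Differentiation under the integral removes the factor [1 / t]. *)
Lemma is_derive_Sk x : is_derive x 1 Sk (psi x).
Proof.
pose f (u t : R) : R := kS t * (sin (t * u) / t).
have df (u t : R) : D t -> is_derive u 1 (f ^~ t) (kS t * cos (t * u)).
  rewrite /= in_itv /= => /andP[t0 _]; rewrite /f; move: (kS t) => k.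
  by apply: is_derive_eq; rewrite /GRing.scale /=; field; rewrite gt_eqF.
have d1E u t : D t -> partial1of2 f u t = kS t * cos (t * u).
  by move=> Dt; rewrite partial1of2E; case: (df u t Dt).
have xI : `]x - 1, x + 1[%classic x by rewrite /= in_itv /=; apply/andP; split; lra.
have intf (u : R) : `]x - 1, x + 1[%classic u -> mu.-integrable D (EFin \o f u).
  by move=> _; apply: (@integrable_sinc _ 1) => //;
    [exact: measurable_D_kS|exact: norm_kS_le1].
have derf (u t : R) : `]x - 1, x + 1[%classic u -> D t -> derivable (f ^~ t) u 1.
  by move=> _ Dt; case: (df u t Dt).
have G0 (t : R) : (0 : R) <= cst 1 t by rewrite /cst.
have intG : mu.-integrable D (EFin \o (cst 1 : R -> R)).
  by apply: integrable_D_continuous; exact: cst_continuous.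
have Gub (u t : R) : `]x - 1, x + 1[%classic u -> D t -> `|partial1of2 f u t| <= cst 1 t.
  move=> _ Dt; rewrite d1E// normrM -[leRHS]mulr1 ler_pM//; first exact: norm_kS_le1.
  exact: norm_cos_le1.
have mD : measurable D by exact: measurable_itv.
have D1 := derivable_under_integral (mu := mu) mD xI intf derf G0 intG Gub.
have D2 := differentiation_under_integral (mu := mu) mD xI intf derf G0 intG Gub.
apply: DeriveDef; first exact: D1.
rewrite -derive1E D2; apply: eq_Rintegral => t; rewrite inE => Dt; exact: d1E.
Qed.

End kernels.

(** * Approximation of a half-line by band-limited functions *)
Section step.
Context {R : realType}.
Implicit Types (x y s t a : R).
Notation mu := (@lebesgue_measure R).
Notation D := (`]0, 1]%classic : set R).

(** The Cusa-Huygens inequality, by repeated differentiation up to [pi] and by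
    trivial bounds beyond; it says that [psi] is nonnegative. *)
Lemma cusa_huygens x : 0 <= x -> 3 * sin x <= 2 * x + x * cos x.
Proof.
move=> x0.
have h2 (u : R) : 0 <= u -> u <= pi -> 0 <= sin u - u * cos u.
  move=> u0 up.
  have dh (v : R) : is_derive v 1 (fun v => sin v - v * cos v) (v * sin v).
    by apply: is_derive_eq; rewrite /GRing.scale /=; ring.
  have := @derive_ge0_le _ (fun v => sin v - v * cos v) (fun v => v * sin v) 0 u u0 (fun v _ => dh v).
  rewrite sin0 mul0r subr0; apply=> // v /andP[v0 vu].
  by rewrite mulr_ge0 ?(ltW v0)//; apply: sin_ge0_pi; lra.
have h1 (u : R) : 0 <= u -> u <= pi -> 0 <= 2 - 2 * cos u - u * sin u.
  move=> u0 up.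
  have dh (v : R) : is_derive v 1 (fun v => 2 - 2 * cos v - v * sin v) (sin v - v * cos v).
    by apply: is_derive_eq; rewrite /GRing.scale /=; ring.
  have := @derive_ge0_le _ (fun v => 2 - 2 * cos v - v * sin v)
    (fun v => sin v - v * cos v) 0 u u0 (fun v _ => dh v).
  rewrite cos0 mulr1 mul0r subr0 subrr; apply=> // v /andP[v0 vu].
  by apply: h2; lra.
rewrite -subr_ge0; have [xp|xp] := leP x pi.
  have dh (v : R) : is_derive v 1 (fun v => 2 * v + v * cos v - 3 * sin v)
      (2 - 2 * cos v - v * sin v).
    by apply: is_derive_eq; rewrite /GRing.scale /=; ring.
  have := @derive_ge0_le _ (fun v => 2 * v + v * cos v - 3 * sin v)
    (fun v => 2 - 2 * cos v - v * sin v) 0 x x0 (fun v _ => dh v).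
  rewrite sin0 !mulr0 mul0r subr0 addr0; apply=> // v /andP[v0 vu].
  by apply: h1; lra.
have p2 := pi_ge2 R; have c1 := cos_geN1 x.
have xc : x <= 2 * x + x * cos x by nra.
rewrite subr_ge0; apply: le_trans xc.
have [x2|x2] := leP x (2 * pi); last by have := sin_le1 x; lra.
have : 0 <= sin (x - pi) by apply: sin_ge0_pi; lra.
have e : sin x = - sin (x - pi) by rewrite -sinDpi subrK.
by rewrite e; lra.
Qed.

Lemma psi_ge0 x : 0 < x -> 0 <= psi x.
Proof.
move=> x0; rewrite psiE ?gt_eqF// divr_ge0 ?exprn_ge0 ?(ltW x0)// mulr_ge0//.
by rewrite subr_ge0 cusa_huygens// ltW.
Qed.

Lemma psi_le x : 0 < x -> psi x <= 144 / x ^+ 4.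
Proof.
move=> x0; rewrite psiE ?gt_eqF// exprSr.
have -> : 144 / x ^+ 4 = 24 * (6 * x) / (x ^+ 4 * x) by field; rewrite gt_eqF.
rewrite ler_pM2r ?invr_gt0 ?mulr_gt0 ?exprn_gt0// ler_pM2l//.
have := norm_sin_le x; rewrite (gtr0_norm x0) ler_norml => /andP[? ?].
have := cos_le1 x; nra.
Qed.

(** With oddness, this makes [Sk] a smoothed multiple of the sign function. *)
Lemma Sk_nondecreasing x y : 0 <= x -> x <= y -> Sk x <= Sk y.
Proof.
move=> x0 xy; apply: (derive_ge0_le xy (fun u _ => is_derive_Sk u)).
by move=> u /andP[xu _]; apply: psi_ge0; exact: le_lt_trans xu.
Qed.

(** The tail [psi <= 144 / u^4] integrates to [48 / x^3]. *)
Lemma Sk_tail x y : 0 < x -> x <= y -> Sk y <= Sk x + 48 / x ^+ 3.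
Proof.
move=> x0 xy.
have dh (u : R) : x <= u <= y ->
    is_derive u 1 (fun u => - (Sk u + 48 * u ^- 3)) (144 / u ^+ 4 - psi u).
  move=> /andP[xu _]; have u0 : u != 0 by rewrite gt_eqF// (lt_le_trans x0).
  have u3 : u ^+ 3 != 0 by rewrite expf_neq0.
  have dS := is_derive_Sk u.
  by apply: is_derive_eq; rewrite /GRing.scale /=; field.
have := derive_ge0_le xy dh.
have h : forall u, x < u < y -> 0 <= 144 / u ^+ 4 - psi u.
  by move=> u /andP[xu _]; rewrite subr_ge0 psi_le// (lt_trans x0).
move=> /(_ h); rewrite lerN2 => {}h; apply: le_trans h.
by rewrite lerDl mulr_ge0// invr_ge0 exprn_ge0// (le_trans (ltW x0)).
Qed.

Lemma integrable_kS_sinc x :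
  mu.-integrable D (EFin \o (fun t => kS t * (sin (t * x) / t))).
Proof.
by apply: (@integrable_sinc _ _ 1) => //; [exact: measurable_D_kS|exact: norm_kS_le1].
Qed.

Lemma SkN x : Sk (- x) = - Sk x.
Proof.
have iS := integrable_kS_sinc x.
have mD : measurable D by exact: measurable_itv.
have := @RintegralZl _ _ R mu D _ (-1) mD iS; rewrite mulN1r => <-.
by apply: eq_Rintegral => t _; rewrite mulrN sinN; ring.
Qed.

Lemma BkN x : Bk (- x) = Bk x.
Proof. by apply: eq_Rintegral => t _; rewrite mulrN cosN. Qed.

Lemma integrable_kB_cos x :
  mu.-integrable D (EFin \o (fun t => kB t * cos (t * x))).
Proof.
apply: integrable_D_continuous => t.
by apply: cvgM; [exact: continuous_kB|exact: continuous_cosM].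
Qed.

Lemma Sk1_gt0 : 0 < Sk 1 :> R.
Proof.
have cf : continuous (fun t : R => 1 / 2 * kS t).
  by move=> t; apply: cvgM; [exact: cvg_cst|exact: continuous_kS].
pose F (t : R) := 1 / 2 * (- (1 - t) ^+ 4 + 3 / 5 * (1 - t) ^+ 5).
have dF (t : R) : is_derive t 1 F (1 / 2 * kS t).
  by rewrite /F /kS; apply: is_derive_eq; rewrite /GRing.scale /=; field.
apply: (@lt_le_trans _ _ (\int[mu]_(t in D) (1 / 2 * kS t))%R).
  rewrite (Rintegral_D_FTC cf dF) /F subrr subr0 !expr1n !expr0n /= ; lra.
apply: le_Rintegral => //.
- exact: integrable_D_continuous.
- exact: integrable_kS_sinc.
move=> t Dt; have /andP[k0 _] := kS_bounds Dt; rewrite mulrC ler_wpM2l//.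
move: Dt; rewrite /= in_itv /= => /andP[t0 t1]; rewrite mulr1 ler_pdivlMr//.
have := sin_ge (ltW t0); have : t ^+ 3 <= t by rewrite exprS ler_piMr ?(ltW t0)// expr_le1// ltW.
lra.
Qed.

Lemma Bk_small x : 0 <= x <= 6 / 5 -> 1 / 12 <= Bk x.
Proof.
move=> /andP[x0 x1].
have cf : continuous (fun t : R => 1 / 4 * kB t).
  by move=> t; apply: cvgM; [exact: cvg_cst|exact: continuous_kB].
pose F (t : R) := 1 / 4 * (- (1 - t) ^+ 3 / 3).
have dF (t : R) : is_derive t 1 F (1 / 4 * kB t).
  by rewrite /F /kB; apply: is_derive_eq; rewrite /GRing.scale /=; field.
apply: (@le_trans _ _ (\int[mu]_(t in D) (1 / 4 * kB t))%R).
  rewrite (Rintegral_D_FTC cf dF) /F subrr subr0 !expr1n !expr0n /= ; lra.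
apply: le_Rintegral => //.
- exact: integrable_D_continuous.
- exact: integrable_kB_cos.
move=> t Dt; have /andP[k0 _] := kB_bounds Dt; rewrite mulrC ler_wpM2l//.
move: Dt; rewrite /= in_itv /= => /andP[t0 t1].
have tx0 : 0 <= t * x by rewrite mulr_ge0// ltW.
have tx1 : t * x <= 6 / 5 by apply: le_trans x1; rewrite ler_piMl.
by have := cos_ge tx0; nra.
Qed.

Lemma Bk_large x : 6 / 5 <= x -> 1 / (3 * x ^+ 2) <= Bk x.
Proof.
move=> x1; have x0 : 0 < x by lra.
rewrite BkE ?gt_eqF//.
have -> : 1 / (3 * x ^+ 2) = 2 * (x / 6) / x ^+ 3 by field; rewrite gt_eqF.
rewrite ler_pM2r ?invr_gt0 ?exprn_gt0// ler_pM2l//.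
by have := sin_le1 x; lra.
Qed.

(** The half-line indicator differs from the band-limited function
    [1/2 - Sk / (2 kap)] by at most a multiple of the nonnegative band-limited
    function [Bk].  Here [kap] is the limit of [Sk] at infinity; near 0 the error is
    bounded and [Bk] is bounded below, and beyond it is [O (y^-3)] against a
    [Bk] of order [y^-2]. *)
Lemma step_kernel : exists kap gam : R, [/\ 0 < kap, 0 < gam &
  forall y, `|(y <= 0)%R%:R - (1 / 2 - Sk y / (2 * kap))| <= gam * Bk y].
Proof.
pose E := [set Sk x | x in [set x : R | 0 <= x]].
have ubE : ubound E (Sk 1 + 48).
  move=> _ [x /= x0 <-]; have [x1|x1] := leP x 1.
    by have := Sk_nondecreasing x0 x1; lra.
  by have := Sk_tail ltr01 (ltW x1); rewrite expr1n; lra.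
have E1 : E (Sk 1) by exists 1 => //=; exact: ler01.
have hs : has_sup E by split; [exists (Sk 1)|exists (Sk 1 + 48)].
pose kap := sup E.
have le_kap x : 0 <= x -> Sk x <= kap.
  by move=> x0; apply: ub_le_sup; [exists (Sk 1 + 48)|exists x].
have kap0 : 0 < kap by apply: lt_le_trans Sk1_gt0 (le_kap _ ler01).
have kap_le x : 0 < x -> kap <= Sk x + 48 / x ^+ 3.
  move=> x0; apply: ge_sup; first by exists (Sk 1).
  move=> _ [y /= y0 <-]; have [yx|yx] := leP x y; first exact: Sk_tail.
  apply: le_trans (Sk_nondecreasing y0 (ltW yx)) _.
  by rewrite lerDl divr_ge0// exprn_ge0// ltW.
have Sk00 : Sk 0 = 0 :> R.
  by have := SkN 0; rewrite oppr0 => h; lra.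
pose g := 12 * kap + 144.
have main x : 0 <= x -> kap - Sk x <= g * Bk x.
  move=> x0; have [x1|x1] := leP x (6 / 5).
    have := @Bk_small x; rewrite x0 x1 => /(_ isT) h.
    have := Sk_nondecreasing (lexx 0) x0; rewrite Sk00 => h2.
    have : (12 * kap) * (1 / 12) <= 12 * kap * Bk x by rewrite ler_wpM2l// mulr_ge0// ltW.
    rewrite /g mulrDl; lra.
  have x00 : 0 < x by lra.
  have h := Bk_large (ltW x1); have h2 := kap_le x x00.
  have h3 : 48 / x ^+ 3 <= 144 * (1 / (3 * x ^+ 2)).
    have -> : 144 * (1 / (3 * x ^+ 2)) = 48 / x ^+ 3 * x by field; rewrite gt_eqF.
    rewrite ler_peMr ?divr_ge0 ?exprn_ge0 ?(ltW x00)//; lra.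
  have h4 : 144 * (1 / (3 * x ^+ 2)) <= 144 * Bk x by rewrite ler_wpM2l.
  have B0 : 0 <= Bk x.
    by apply: le_trans h; rewrite divr_ge0// mulr_ge0// exprn_ge0// ltW.
  have : 0 <= 12 * kap * Bk x by rewrite !mulr_ge0// ltW.
  rewrite /g mulrDl; lra.
exists kap, (g / (2 * kap)); split=> //.
  by rewrite divr_gt0 ?mulr_gt0// /g addr_gt0// mulr_gt0.
have e1 z : g / (2 * kap) * z = g * z / (2 * kap) by rewrite mulrAC.
have k2 : 0 < 2 * kap by rewrite mulr_gt0.
move=> y; rewrite e1; have [y0|y0] := leP y 0.
  have y0' : 0 <= - y by rewrite oppr_ge0.
  have := main _ y0'; rewrite BkN SkN => h.
  have -> : true%:R - (1 / 2 - Sk y / (2 * kap)) = (kap - - Sk y) / (2 * kap).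
    by rewrite /=; field; rewrite gt_eqF.
  rewrite normrM normfV (gtr0_norm k2) ler_pM2r ?invr_gt0// ger0_norm//.
  by rewrite subr_ge0 -SkN le_kap.
have -> : false%:R - (1 / 2 - Sk y / (2 * kap)) = - ((kap - Sk y) / (2 * kap)).
  by rewrite /=; field; rewrite gt_eqF.
rewrite normrN normrM normfV (gtr0_norm k2) ler_pM2r ?invr_gt0// ger0_norm.
  exact: main (ltW y0).
by rewrite subr_ge0 le_kap// ltW.
Qed.

End step.

(** * Gaussian averages of the kernels *)
Section fubini.
Context {R : realType}.
Implicit Types (x y s t a : R).
Notation mu := (@lebesgue_measure R).
Notation D := (`]0, 1]%classic : set R).
Notation w := (@normal_pdf R 0 1).

(** The weight [1 + |x|] allows for the kernel [sin (t x) / t], which is not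
    bounded uniformly in [x]. *)
Lemma normal_fubini (h : R -> R) (tau : R -> R -> R) c :
  measurable_fun D h ->
  measurable_fun setT (fun z : measurableTypeR R * measurableTypeR R => tau z.2 z.1) ->
  0 <= c -> (forall t x, `|tau t x| <= 1) ->
  (forall t x, D t -> `|h t * tau t x| <= c * (1 + `|x|)) ->
  mu.-integrable setT (EFin \o (fun x => w x * \int[mu]_(t in D) (h t * tau t x)))%R /\
  (\int[mu]_x (w x * \int[mu]_(t in D) (h t * tau t x)) =
   \int[mu]_(t in D) (h t * \int[mu]_x (w x * tau t x)))%R.
Proof.
move=> mh mtau c0 tau1 htau.
have mD : measurable (D : set (measurableTypeR R)) by exact: measurable_itv.
pose hD : measurableTypeR R -> R := h \_ D.
have mhD : measurable_fun setT hD by exact/(measurable_restrictT _ _).1.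
pose f (z : measurableTypeR R * measurableTypeR R) := ((w z.1 * (hD z.2 * tau z.2 z.1))%:E)%E.
have mf : measurable_fun setT f.
  apply/measurable_EFinP; apply: measurable_funM.
    by apply: (measurableT_comp (@measurable_w R)); exact: measurable_fst.
  apply: measurable_funM => //.
  by apply: (measurableT_comp mhD); exact: measurable_snd.
have fb x t : (`|f (x, t)| <= (w x * (c * (1 + `|x|)) * \1_D t)%:E)%E.
  rewrite /f /hD /= lee_fin normrM (ger0_norm (normal_pdf01_ge0 x)) -mulrA.
  rewrite ler_wpM2l ?normal_pdf01_ge0// patchE indicE; case: ifPn => tD.
    by rewrite mulr1; apply: htau; rewrite inE in tD.
  by rewrite mul0r normr0 mulr0.
have muD : (mu D = 1)%E.
  by have := @lebesgue_measure_itv R `]0, 1]; rewrite /= lte_fin ltr01 oppr0 adde0.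
have inner x : (\int[mu]_t `|f (x, t)| <= (c * (w x * (1 + `|x|)))%:E)%E.
  apply: (@le_trans _ _ (\int[mu]_t ((w x * (c * (1 + `|x|)) * \1_D t)%:E))%E).
    apply: ge0_le_integral => //.
    - apply: measurableT_comp => //.
      exact: (measurableT_comp mf (measurable_pair1 x)).
    - apply/measurable_EFinP; apply: measurable_funM => //.
  under eq_integral do rewrite EFinM.
  rewrite ge0_integralZl//; last 2 first.
    by apply/measurable_EFinP.
    by rewrite lee_fin !mulr_ge0 ?normal_pdf01_ge0.
  by rewrite integral_indic// setIT; rewrite [X in (_ * X)%E]muD mule1 lee_fin mulrCA.
have mom : mu.-integrable setT (EFin \o (fun x : R => c * (w x * (1 + `|x|)))).
  by apply: integrable_RZ => //; exact: integrable_normal_moment1.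
have mmom : measurable_fun setT (fun x : R => (c * (w x * (1 + `|x|)))%:E).
  by case/integrableP: mom.
have imf : (mu \x mu)%E.-integrable setT f.
  apply/(integrable12ltyP mu mu mf).
  apply: (@le_lt_trans _ _ (\int[mu]_x (c * (w x * (1 + `|x|)))%:E)%E).
    apply: ge0_le_integral => //.
    - by move=> y _; apply: integral_ge0 => ? _.
    - apply: (measurable_fun_fubini_tonelli_F (abse \o f)) => //=.
      exact: measurableT_comp.
  have /integrableP[_ fin] := mom.
  apply: le_lt_trans _ fin; apply: ge0_le_integral => //.
  - by move=> x _; rewrite lee_fin !mulr_ge0 ?normal_pdf01_ge0// addr_ge0.
  - exact: measurableT_comp.
  - by move=> x _; rewrite /= lee_fin ler_norm.
have F : (\int[mu]_x (\int[mu]_t f (x, t)) = \int[mu]_t (\int[mu]_x f (x, t)))%E :=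
  @Fubini _ _ _ _ R mu mu f imf.
have LE x : (\int[mu]_t (f (x, t)) = (w x * \int[mu]_(t in D) (h t * tau t x))%:E)%E.
  have mtx : measurable_fun setT (fun t : measurableTypeR R => tau t x).
    exact: (measurableT_comp mtau (measurable_pair1 x)).
  have ih : mu.-integrable D (EFin \o (fun t => h t * tau t x)).
    apply: (@integrable_D_bounded _ _ (c * (1 + `|x|))).
      by apply: measurable_funM => //; exact: measurable_funTS.
    by move=> t Dt; exact: htau.
  rewrite EFinM /Rintegral fineK; last exact: integrable_fin_num ih.
  rewrite -(@integralZl _ _ R mu D mD _ ih) integral_mkcond.
  apply: eq_integral => t _.
  rewrite /f /hD /= !patchE; case: ifPn => _; first by rewrite EFinM.
  by rewrite mul0r mulr0.
have RE t : (\int[mu]_x (f (x, t)) = (hD t * \int[mu]_x (w x * tau t x))%:E)%E.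
  have mtx : measurable_fun setT (fun x : measurableTypeR R => tau t x).
    exact: (measurableT_comp mtau (measurable_pair2 t)).
  have ih : mu.-integrable setT (EFin \o (fun x => w x * tau t x)).
    apply: (@integrable_normal_le _ _ 1).
      by apply: measurable_funM => //; exact: measurable_w.
    move=> x; rewrite mul1r normrM (ger0_norm (normal_pdf01_ge0 x)).
    rewrite ler_wpM2l ?normal_pdf01_ge0//.
    by apply: le_trans (tau1 _ _) _; rewrite lerDl.
  rewrite EFinM /Rintegral fineK; last exact: integrable_fin_num ih.
  rewrite -(@integralZl _ _ R mu setT measurableT _ ih).
  by apply: eq_integral => x _; rewrite /f /= -EFinM mulrCA.
split.
  have := integrable_fubini_F imf; apply: eq_integrable => // x _.
  by rewrite /fubini_F LE.
rewrite /Rintegral; congr fine.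
transitivity (\int[mu]_x (\int[mu]_t f (x, t)))%E.
  by apply: eq_integral => x _; rewrite LE.
rewrite F [RHS]integral_mkcond; apply: eq_integral => t _.
rewrite RE.
rewrite /hD !patchE; case: ifPn => // _; by rewrite mul0r.
Qed.

Lemma measurable_shift_phase T a :
  measurable_fun setT (fun z : measurableTypeR R * measurableTypeR R => z.2 * (T * (z.1 - a))).
Proof.
apply: measurable_funM; first exact: measurable_snd.
by apply: measurable_funM => //; apply: measurable_funB => //; exact: measurable_fst.
Qed.

Lemma normal_Bk T a : 0 < T ->
  mu.-integrable setT (EFin \o (fun x => w x * Bk (T * (x - a)))) /\
  (\int[mu]_x (w x * Bk (T * (x - a))) =
   \int[mu]_(t in D) (kB t * (cos (t * T * a) * expR (- ((t * T) ^+ 2 / 2)))))%R.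
Proof.
move=> T0; have [|||||i e] := @normal_fubini kB (fun t x => cos (t * (T * (x - a)))) 1.
- apply: subspace_continuous_measurable_fun; first exact: measurable_itv.
  exact: continuous_subspaceT continuous_kB.
- apply: measurableT_comp (@measurable_shift_phase T a).
  exact: continuous_measurable_fun (@continuous_cos R).
- by [].
- by move=> t x; exact: norm_cos_le1.
- move=> t x /kB_bounds/andP[k0 k1]; rewrite mul1r normrM (ger0_norm k0).
  apply: (@le_trans _ _ (1 * 1)); first by rewrite ler_pM// norm_cos_le1.
  by rewrite mul1r lerDl.
split; first exact: i.
rewrite e; apply: eq_Rintegral => t; rewrite inE /= in_itv /= => /andP[t0 _].
congr (_ * _); have -> : cos (t * T * a) = cos (- (t * T * a)) by rewrite cosN.
rewrite -normal_cf; last by rewrite mulr_ge0// ltW.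
by apply: eq_Rintegral => x _; congr (_ * cos _); ring.
Qed.

(** The sine is handled as a cosine with phase [- pi / 2]. *)
Lemma normal_Sk T a : 0 < T ->
  mu.-integrable setT (EFin \o (fun x => w x * Sk (T * (x - a)))) /\
  (\int[mu]_x (w x * Sk (T * (x - a))) =
   \int[mu]_(t in D) (kS t / t * (- sin (t * T * a) * expR (- ((t * T) ^+ 2 / 2)))))%R.
Proof.
move=> T0; have [|||||i e] :=
  @normal_fubini (fun t => kS t / t) (fun t x => sin (t * (T * (x - a)))) (T * (1 + `|a|)).
- apply: subspace_continuous_measurable_fun; first exact: measurable_itv.
  apply: continuous_in_subspaceT => t; rewrite inE /= in_itv /= => /andP[t0 _].
  by apply: cvgM; [exact: continuous_kS|apply: cvgV; [rewrite gt_eqF|exact: cvg_id]].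
- apply: measurableT_comp (@measurable_shift_phase T a).
  exact: continuous_measurable_fun (@continuous_sin R).
- by rewrite mulr_ge0 ?addr_ge0// ltW.
- by move=> t x; exact: norm_sin_le1.
- move=> t x Dt; rewrite mulrAC -mulrA normrM.
  apply: (@le_trans _ _ (1 * `|T * (x - a)|)).
    by rewrite ler_pM// ?norm_kS_le1 ?sinc_bound.
  rewrite mul1r normrM (gtr0_norm T0) -mulrA ler_pM2l//.
  have := ler_normB x a; have : 0 <= `|a| * `|x| by rewrite mulr_ge0.
  lra.
have SE x : Sk (T * (x - a)) = (\int[mu]_(t in D) (kS t / t * sin (t * (T * (x - a)))))%R.
  by apply: eq_Rintegral => t _; rewrite mulrA mulrAC.
split.
  by move: i; apply: eq_integrable => // x _; rewrite /= SE.
under eq_Rintegral do rewrite SE.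
rewrite e; apply: eq_Rintegral => t; rewrite inE /= in_itv /= => /andP[t0 _].
congr (_ * _).
have -> : - sin (t * T * a) = cos (- (t * T * a) - pi / 2) by rewrite cosBpihalf sinN.
rewrite -normal_cf; last by rewrite mulr_ge0// ltW.
apply: eq_Rintegral => x _; congr (_ * _).
by rewrite addrA cosBpihalf; congr sin; ring.
Qed.

End fubini.

(** * Smoothing inequality *)
Section smoothing.
Context {R : realType}.
Implicit Types (x y s t a T : R).
Notation mu := (@lebesgue_measure R).
Notation D := (`]0, 1]%classic : set R).
Notation w := (@normal_pdf R 0 1).

Lemma Rintegral_sum (I : Type) (r : seq I) (A : set R) (f : I -> R -> R) :
  measurable A -> (forall i, mu.-integrable A (EFin \o f i)) ->
  mu.-integrable A (EFin \o (fun t => \sum_(i <- r) f i t)) /\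
  (\int[mu]_(t in A) \sum_(i <- r) f i t = \sum_(i <- r) \int[mu]_(t in A) f i t)%R.
Proof.
move=> mA fi; elim: r => [|i r [ih eh]].
  split.
    have := @integrable0 _ _ R mu A; apply: eq_integrable => // t _.
    by rewrite /= big_nil.
  under eq_Rintegral do rewrite big_nil.
  by rewrite big_nil /Rintegral integral0.
split.
  have := integrable_RD mA (fi i) ih; apply: eq_integrable => // t _.
  by rewrite /= big_cons.
under eq_Rintegral do rewrite big_cons.
by rewrite big_cons -eh RintegralD.
Qed.

(** The bound is integrated exactly, as an arctangent; this is where the rate
    [1 / T] of the smoothing inequality comes from. *)
Lemma Rintegral_lorentz (f : R -> R) c T : 0 < T -> 0 <= c ->
  mu.-integrable D (EFin \o f) ->
  (forall t, D t -> `|f t| <= c / (1 + (t * T) ^+ 2)) ->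
  `|\int[mu]_(t in D) f t|%R <= 2 * c / T.
Proof.
move=> T0 c0 fi fc.
have mD : measurable (D : set R) by exact: measurable_itv.
have den t : 0 < 1 + (t * T) ^+ 2 by rewrite ltr_pwDl ?sqr_ge0.
pose g t := c / (1 + (t * T) ^+ 2).
have cg : continuous g.
  move=> t; apply: cvgM; first exact: cvg_cst.
  apply: cvgV; first by rewrite gt_eqF.
  apply: cvgD; first exact: cvg_cst.
  rewrite /continuous_at expr2; under eq_fun do rewrite expr2.
  by apply: cvgM; (apply: cvgM; [exact: cvg_id|exact: cvg_cst]).
apply: (@le_trans _ _ (\int[mu]_(t in D) g t)%R).
  apply: le_trans (@le_normr_Rintegral _ _ R mu D f mD fi) _.
  apply: (@le_Rintegral _ _ R mu D _ _ mD) => //; last exact: integrable_D_continuous.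
  have := @integrable_norm _ _ R mu D _ fi; exact.
have dg (t : R) : is_derive t 1 (fun t => c / T * atan (t * T)) (g t).
  apply: is_derive_eq; rewrite /GRing.scale /= /g; field.
  by rewrite !gt_eqF.
rewrite (Rintegral_D_FTC cg dg) mul0r atan0 mulr0 subr0 mul1r.
rewrite mulrAC ler_pM2r ?invr_gt0// mulrC ler_wpM2r//.
have := atan_ltpi2 T; have := @pihalf_lt2 R; lra.
Qed.

Lemma sqr_expR_le s : s ^+ 2 * expR (- (s ^+ 2 / 4)) <= 64 / (1 + s ^+ 2).
Proof.
set u := s ^+ 2; have u0 : 0 <= u by exact: sqr_ge0.
rewrite expRN ler_pdivlMr; last by lra.
rewrite mulrAC ler_pdivrMr ?expR_gt0//.
have -> : expR (u / 4) = expR (u / 8) ^+ 2.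
  by rewrite expr2 -expRD; congr expR; field.
have h := expR_ge1Dx (u / 8).
have : (1 + u / 8) ^+ 2 <= expR (u / 8) ^+ 2.
  by rewrite ler_sqr ?nnegrE ?expR_ge0//; lra.
nra.
Qed.

Lemma gauss_le_lorentz s : expR (- (s ^+ 2 / 2)) <= 2 / (1 + s ^+ 2).
Proof.
have u0 : 0 <= s ^+ 2 by exact: sqr_ge0.
rewrite expRN -[leLHS]mul1r ler_pdivrMr ?expR_gt0// mulrAC ler_pdivlMr; last by lra.
have := expR_ge1Dx (s ^+ 2 / 2); lra.
Qed.

(** Averages of the kernels over a finite law only involve its characteristic
    function, given here by its cosine and sine sums. *)
Lemma sum_Bk (I : finType) (p x : I -> R) T a :
  mu.-integrable D (EFin \o (fun t => kB t *
    (cos (t * T * a) * (\sum_i p i * cos (t * T * x i)) +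
     sin (t * T * a) * (\sum_i p i * sin (t * T * x i))))) /\
  \sum_i p i * Bk (T * (x i - a)) = (\int[mu]_(t in D) (kB t *
    (cos (t * T * a) * (\sum_i p i * cos (t * T * x i)) +
     sin (t * T * a) * (\sum_i p i * sin (t * T * x i)))))%R.
Proof.
have mD : measurable (D : set R) by exact: measurable_itv.
pose f i t := p i * (kB t * cos (t * (T * (x i - a)))).
have fi i : mu.-integrable D (EFin \o f i).
  by apply: integrable_RZ => //; exact: integrable_kB_cos.
have fE t : \sum_i f i t = kB t *
    (cos (t * T * a) * (\sum_i p i * cos (t * T * x i)) +
     sin (t * T * a) * (\sum_i p i * sin (t * T * x i))).
  rewrite !mulr_sumr -big_split /= mulr_sumr; apply: eq_bigr => i _.
  rewrite /f (_ : t * (T * (x i - a)) = t * T * x i - t * T * a); last by ring.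
  by rewrite cosB; ring.
have [ih eh] := Rintegral_sum (index_enum I) mD fi.
split; first by move: ih; apply: eq_integrable => // t _; rewrite /= fE.
under eq_Rintegral do rewrite -fE.
rewrite eh; apply: eq_bigr => i _.
rewrite /f (@RintegralZl _ _ R mu D _ _ mD)//; exact: integrable_kB_cos.
Qed.

Lemma sum_Sk (I : finType) (p x : I -> R) T a :
  mu.-integrable D (EFin \o (fun t => kS t / t *
    (cos (t * T * a) * (\sum_i p i * sin (t * T * x i)) -
     sin (t * T * a) * (\sum_i p i * cos (t * T * x i))))) /\
  \sum_i p i * Sk (T * (x i - a)) = (\int[mu]_(t in D) (kS t / t *
    (cos (t * T * a) * (\sum_i p i * sin (t * T * x i)) -
     sin (t * T * a) * (\sum_i p i * cos (t * T * x i)))))%R.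
Proof.
have mD : measurable (D : set R) by exact: measurable_itv.
pose f i t := p i * (kS t * (sin (t * (T * (x i - a))) / t)).
have fi i : mu.-integrable D (EFin \o f i).
  by apply: integrable_RZ => //; exact: integrable_kS_sinc.
have fE t : \sum_i f i t = kS t / t *
    (cos (t * T * a) * (\sum_i p i * sin (t * T * x i)) -
     sin (t * T * a) * (\sum_i p i * cos (t * T * x i))).
  rewrite !mulr_sumr -sumrB /= mulr_sumr; apply: eq_bigr => i _.
  rewrite /f (_ : t * (T * (x i - a)) = t * T * x i - t * T * a); last by ring.
  by rewrite sinB; ring.
have [ih eh] := Rintegral_sum (index_enum I) mD fi.
split; first by move: ih; apply: eq_integrable => // t _; rewrite /= fE.
under eq_Rintegral do rewrite -fE.
rewrite eh; apply: eq_bigr => i _.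
rewrite /f (@RintegralZl _ _ R mu D _ _ mD)//; exact: integrable_kS_sinc.
Qed.

Lemma continuous_gauss_scale T : continuous (fun t : R => expR (- ((t * T) ^+ 2 / 2))).
Proof.
move=> t; apply: continuous_comp; last exact: continuous_expR.
apply: cvgN; apply: cvgM; last exact: cvg_cst.
rewrite /continuous_at expr2; under eq_fun do rewrite expr2.
by apply: cvgM; (apply: cvgM; [exact: cvg_id|exact: cvg_cst]).
Qed.

Lemma normal_cdfE a : mu.-integrable setT (EFin \o (fun x => w x * (x <= a)%R%:R)) /\
  fine (normal_prob 0 1 `]-oo, a]) = (\int[mu]_x (w x * (x <= a)%R%:R))%R.
Proof.
have E y : (y <= a)%R%:R = \1_(`]-oo, a]%classic : set R) y :> R.
  by rewrite indicE mem_setE in_itv.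
split.
  apply: (@integrable_normal_le R _ 1).
    apply: measurable_funM; first exact: measurable_w.
    under eq_fun do rewrite E.
    by apply: measurable_indic; exact: measurable_itv.
  move=> y; rewrite mul1r normrM (ger0_norm (normal_pdf01_ge0 y)).
  rewrite ler_wpM2l ?normal_pdf01_ge0//; apply: (@le_trans _ _ 1).
    by case: (y <= a); rewrite ?normr1 ?normr0.
  by rewrite lerDl.
rewrite /normal_prob /Rintegral; congr fine.
rewrite [LHS]integral_mkcond; apply: eq_integral => y _.
by rewrite patchE E indicE; case: ifP => _; rewrite ?mulr1 ?mulr0.
Qed.

(** A finite law with atoms [x i] of mass [p i], whose characteristic function is
    close to the Gaussian one up to the frequency [T]. *)
Section law.
Variables (I : finType) (p x : I -> R) (T K : R).
Hypotheses (T0 : 0 < T) (K0 : 0 <= K).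
Let E1 s := \sum_i p i * cos (s * x i).
Let E2 s := \sum_i p i * sin (s * x i).
Let err s := K / T * s ^+ 3 * expR (- (s ^+ 2 / 4)).
Hypothesis near_gauss : forall s, 0 < s <= T ->
  `|E1 s - expR (- (s ^+ 2 / 2))| <= err s /\ `|E2 s| <= err s.

Let D_scale t : D t -> 0 < t * T <= T.
Proof.
rewrite /= in_itv /= => /andP[t0 t1].
by rewrite mulr_gt0//= ler_piMl// ltW.
Qed.

Let err_le_scaled s : 0 < s -> err s <= s / T * (64 * K / (1 + s ^+ 2)).
Proof.
move=> s0; rewrite /err.
have -> : K / T * s ^+ 3 * expR (- (s ^+ 2 / 4)) =
    s / T * (K * (s ^+ 2 * expR (- (s ^+ 2 / 4)))) by ring.
rewrite ler_wpM2l//; first by rewrite divr_ge0// ltW.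
rewrite (_ : 64 * K / (1 + s ^+ 2) = K * (64 / (1 + s ^+ 2))); last by ring.
by rewrite ler_wpM2l// sqr_expR_le.
Qed.

Let err_le s : 0 < s <= T -> err s <= 64 * K / (1 + s ^+ 2).
Proof.
move=> /andP[s0 sT]; apply: le_trans (err_le_scaled s0) _.
rewrite ler_piMl//; last by rewrite ler_pdivrMr// mul1r.
by rewrite divr_ge0 ?mulr_ge0// addr_ge0// sqr_ge0.
Qed.

Lemma sum_Bk_le a : \sum_i p i * Bk (T * (x i - a)) <= 2 * (2 + 128 * K) / T.
Proof.
have [ih ->] := sum_Bk p x T a.
apply: le_trans (ler_norm _) _; apply: Rintegral_lorentz => //; first by rewrite addr_ge0 ?mulr_ge0.
move=> t Dt; have sT := D_scale Dt; have [h1 h2] := near_gauss sT.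
have h3 := err_le sT; have h4 := gauss_le_lorentz (t * T).
have /andP[k0 k1] := kB_bounds Dt.
rewrite -/(E1 _) -/(E2 _) normrM (ger0_norm k0).
apply: (@le_trans _ _ (1 * (1 * `|E1 (t * T)| + 1 * `|E2 (t * T)|))).
  rewrite ler_pM//; apply: le_trans (ler_normD _ _) _.
  by rewrite !normrM lerD// ler_wpM2r// ?norm_cos_le1 ?norm_sin_le1.
have h5 : `|E1 (t * T)| <= err (t * T) + expR (- ((t * T) ^+ 2 / 2)).
  rewrite -(subrK (expR (- ((t * T) ^+ 2 / 2))) (E1 _)).
  by apply: le_trans (ler_normD _ _) _; rewrite lerD// ger0_norm ?expR_ge0.
have -> : (2 + 128 * K) / (1 + (t * T) ^+ 2) = 2 / (1 + (t * T) ^+ 2) +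
    (64 * K / (1 + (t * T) ^+ 2) + 64 * K / (1 + (t * T) ^+ 2)) by ring.
lra.
Qed.

Lemma normal_Bk_le a : (\int[mu]_x (w x * Bk (T * (x - a))))%R <= 2 * 2 / T.
Proof.
have [_ ->] := normal_Bk a T0.
apply: le_trans (ler_norm _) _; apply: Rintegral_lorentz => //.
  apply: integrable_D_continuous => t; apply: cvgM; first exact: continuous_kB.
  apply: (@cvgM _ _ _ _ (fun t => cos (t * T * a)) (fun t => expR (- ((t * T) ^+ 2 / 2)))).
    under eq_fun do rewrite -mulrA; rewrite -mulrA; exact: continuous_cosM.
  exact: continuous_gauss_scale.
move=> t Dt; have h4 := gauss_le_lorentz (t * T).
have /andP[] := kB_bounds Dt; move: (kB t) => k k0 k1.
rewrite !normrM (ger0_norm k0) (ger0_norm (expR_ge0 _)).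
apply: le_trans h4; rewrite -[leRHS]mul1r -[leRHS]mul1r.
by rewrite !ler_pM ?mulr_ge0 ?expR_ge0 ?norm_cos_le1// ler_wpM2r ?expR_ge0 ?norm_cos_le1.
Qed.

(** The factor [1 / t] of [Sk] is absorbed by the cubic vanishing of [err]. *)
Lemma sum_Sk_close a : `|\sum_i p i * Sk (T * (x i - a)) -
  \int[mu]_x (w x * Sk (T * (x - a)))|%R <= 2 * (128 * K) / T.
Proof.
have mD : measurable (D : set R) by exact: measurable_itv.
have [ih ->] := sum_Sk p x T a; have [_ ->] := normal_Sk a T0.
set f := fun t => _ in ih *.
set g := fun t => kS t / t * (- sin (t * T * a) * _).
have ig : mu.-integrable D (EFin \o g).
  have := @integrable_sinc R (fun t => - kS t * expR (- ((t * T) ^+ 2 / 2))) 1 (T * a).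
  have k1 t : D t -> `|- kS t * expR (- ((t * T) ^+ 2 / 2))| <= 1.
    move=> Dt; rewrite normrM normrN -[leRHS]mulr1 ler_pM ?norm_kS_le1//.
    by rewrite ger0_norm ?expR_ge0// expR_le1 oppr_le0 divr_ge0// sqr_ge0.
  have mk : measurable_fun D (fun t => - kS t * expR (- ((t * T) ^+ 2 / 2))).
    apply: subspace_continuous_measurable_fun; first exact: measurable_itv.
    apply: continuous_subspaceT => t; apply: cvgM; last exact: continuous_gauss_scale.
    by apply: cvgN; exact: continuous_kS.
  move=> /(_ mk k1 ler01); apply: eq_integrable => // t _.
  congr EFin; rewrite /g (mulrA t).
  by move: (kS t) (sin _) (expR _) => u v z; ring.
rewrite -(@RintegralB _ _ R mu D f g mD)//.
apply: Rintegral_lorentz => //; [by rewrite !mulr_ge0|exact: integrable_RB|].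
move=> t Dt; have sT := D_scale Dt; have [h1 h2] := near_gauss sT.
have h3 := err_le sT.
have /andP[k0 k1] := kS_bounds Dt.
have /andP[s0 s1] := sT.
have t0 : 0 < t by move: s0; rewrite pmulr_lgt0.
have e0 : f t - g t = kS t * ((cos (t * T * a) * E2 (t * T) - sin (t * T * a) *
    (E1 (t * T) - expR (- ((t * T) ^+ 2 / 2)))) / t).
  rewrite /f /g -/(E1 _) -/(E2 _); move: (kS t) (E1 _) (E2 _) (expR _) (sin _) (cos _).
  by move=> *; ring.
rewrite e0 normrM (ger0_norm k0).
have h5 := err_le_scaled s0; rewrite mulfK ?gt_eqF// in h5.
rewrite -[leRHS]mul1r ler_pM// normrM normfV (gtr0_norm t0) ler_pdivrMr//.
apply: le_trans (ler_normB _ _) _; rewrite !normrM.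
have h6 : `|cos (t * T * a)| * `|E2 (t * T)| <= 1 * err (t * T).
  by rewrite ler_pM// norm_cos_le1.
have h7 : `|sin (t * T * a)| * `|E1 (t * T) - expR (- ((t * T) ^+ 2 / 2))| <= 1 * err (t * T).
  by rewrite ler_pM// norm_sin_le1.
have -> : 128 * K / (1 + (t * T) ^+ 2) * t = 2 * (t * (64 * K / (1 + (t * T) ^+ 2))) by ring.
lra.
Qed.

Hypotheses (p0 : forall i, 0 <= p i) (p1 : \sum_i p i = 1).

(** Both distribution functions are replaced by averages of the band-limited
    step; the error of the replacement is an average of [Bk]. *)
Lemma smoothing_inequality kap gam a : 0 < kap -> 0 < gam ->
  (forall y, `|(y <= 0)%R%:R - (1/2 - Sk y/(2*kap))| <= gam * Bk y) ->
  `|\sum_i p i * (x i <= a)%R%:R - fine (normal_prob 0 1 `]-oo, a])| <=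
    1 / (2 * kap) * (2 * (128 * K) / T) +
    gam * (2 * (2 + 128 * K) / T + 2 * 2 / T).
Proof.
move=> kap0 gam0 step.
have stepT y : `|(y <= a)%R%:R - (1/2 - Sk (T * (y - a))/(2*kap))| <=
    gam * Bk (T * (y - a)).
  by have := step (T * (y - a)); rewrite pmulr_rle0// subr_le0.
set U := \sum_i p i * (x i <= a)%R%:R.
have [iV eV] := normal_cdfE a; rewrite eV; set V := (\int[mu]_x (w x * _))%R.
set SX := \sum_i p i * Sk (T * (x i - a)).
set SZ := (\int[mu]_x (w x * Sk (T * (x - a))))%R.
have hX : `|U - (1 / 2 - SX / (2 * kap))| <= gam * (2 * (2 + 128 * K) / T).
  apply: (@le_trans _ _ (gam * \sum_i p i * Bk (T * (x i - a)))); last first.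
    by rewrite ler_pM2l// sum_Bk_le.
  have -> : U - (1 / 2 - SX / (2 * kap)) =
      \sum_i p i * ((x i <= a)%R%:R - (1/2 - Sk (T * (x i - a))/(2*kap))).
    transitivity (\sum_i (p i * (x i <= a)%R%:R -
        (p i * (1 / 2) - p i * Sk (T * (x i - a)) / (2 * kap)))).
      by rewrite !sumrB -!mulr_suml p1 !mul1r.
    by apply: eq_bigr => i _; move: (Sk _) => u; ring.
  rewrite mulr_sumr; apply: le_trans (ler_norm_sum _ _ _) _.
  by apply: ler_sum => i _; rewrite normrM (ger0_norm (p0 i)) mulrCA ler_wpM2l.
have hZ : `|V - (1 / 2 - SZ / (2 * kap))| <= gam * (2 * 2 / T).
  have [iB _] := normal_Bk a T0; have [iS _] := normal_Sk a T0.
  have iw : mu.-integrable setT (EFin \o w) by exact: integrable_normal_pdf.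
  apply: (@le_trans _ _ (gam * \int[mu]_x (w x * Bk (T * (x - a))))%R); last first.
    by rewrite ler_pM2l// normal_Bk_le.
  have iQ : mu.-integrable setT (EFin \o (fun y =>
      w y * (y <= a)%R%:R - (1/2 * w y - 1/(2*kap) * (w y * Sk (T * (y - a)))))).
    by do 2?[apply: integrable_RB => //]; apply: integrable_RZ.
  have -> : V - (1 / 2 - SZ / (2 * kap)) = (\int[mu]_y
      (w y * (y <= a)%R%:R - (1/2 * w y - 1/(2*kap) * (w y * Sk (T * (y - a))))))%R.
    rewrite RintegralB//; last first.
      by apply: integrable_RB => //; apply: integrable_RZ.
    rewrite RintegralB//; [|exact: integrable_RZ|exact: integrable_RZ].
    rewrite !RintegralZl// -/V -/SZ.
    have -> : (\int[mu]_x w x = 1)%R by rewrite /Rintegral integral_normal_pdf.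
    by rewrite mulr1 -/V -/SZ [1 / (2 * kap)]mul1r (mulrC SZ).
  apply: le_trans (le_normr_Rintegral measurableT iQ) _.
  rewrite -RintegralZl//; apply: le_Rintegral => //.
  - exact: integrable_norm iQ.
  - exact: integrable_RZ.
  move=> y _.
  have -> : w y * (y <= a)%R%:R - (1/2 * w y - 1/(2*kap) * (w y * Sk (T * (y - a)))) =
    w y * ((y <= a)%R%:R - (1/2 - Sk (T * (y - a))/(2*kap))).
    by move: (w y) (Sk _) => u v; field; rewrite gt_eqF.
  by rewrite normrM (ger0_norm (normal_pdf01_ge0 y)) mulrCA ler_wpM2l ?normal_pdf01_ge0.
have hS : `|(SZ - SX) / (2 * kap)| <= 1 / (2 * kap) * (2 * (128 * K) / T).
  rewrite normrM mulrC -[1 / _]mul1r mul1r div1r ger0_norm ?invr_ge0 ?mulr_ge0 ?(ltW kap0)//.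
  by rewrite ler_wpM2l ?invr_ge0 ?mulr_ge0 ?(ltW kap0)// distrC sum_Sk_close.
have -> : U - V = (U - (1 / 2 - SX / (2 * kap))) - (V - (1 / 2 - SZ / (2 * kap)))
    + (SZ - SX) / (2 * kap) by ring.
apply: le_trans (ler_normD _ _) _; apply: le_trans (lerD (ler_normB _ _) hS) _.
rewrite addrC lerD2l mulrDr lerD//.
Qed.

End law.

End smoothing.

(** * Normal approximation for the coefficients of a polynomial *)
Section polynomial.
Context {R : realType}.
Implicit Types (d rho a : R) (p : {poly R}).

Lemma poly_berry_esseen : exists C : R, 0 < C /\
  forall d rho p n a, zeros_in d rho p -> 0 < d <= pi -> 1 <= rho ->
  (forall k, 0 <= p`_k) -> 0 < p`_0 -> size p = n.+2 -> p.[1] = 1 ->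
  `|\sum_(i < n.+2) p`_i * ((i%:R - kap1 p 1) / Num.sqrt (kap2 p 1) <= a)%R%:R -
    fine (normal_prob 0 1 `]-oo, a])|
  <= C * d^-1 * rho `^ (pi / d) * n.+1%:R `^ (- (1 / 2)).
Proof.
have [kap [gam [kap0 gam0 step]]] := @step_kernel R.
have pi0 := pi_gt0 R.
(* The constant of [charfun_estimate], with [T = r sigma / 10] factored out. *)
pose K : R := 7 / 30.
pose C0 : R := 1 / (2 * kap) * (2 * (128 * K)) + gam * (2 * (2 + 128 * K) + 2 * 2).
have K0 : 0 < K by rewrite /K; lra.
have C00 : 0 < C0.
  apply: addr_gt0; first by rewrite mulr_gt0 ?divr_gt0 ?mulr_gt0.
  by rewrite mulr_gt0// addr_gt0 ?mulr_gt0 ?addr_gt0 ?mulr_gt0.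
pose c1 : R := expR (- (2 * pi)) / 2.
have c10 : 0 < c1 by rewrite /c1 divr_gt0 ?expR_gt0.
exists (10 * C0 * (5 / 4 * pi) / Num.sqrt c1); split.
  by rewrite divr_gt0 ?sqrtr_gt0// !mulr_gt0.
move=> d rho p n a pz /andP[d0 dpi] rho1 p0 p00 sp p1.
set m := kap1 p 1; set s2 := kap2 p 1.
have s20 : 0 < s2 by apply: kap2_gt0 sp.
set sg := Num.sqrt s2; have sg0 : 0 < sg by rewrite sqrtr_gt0.
have sgE : sg ^+ 2 = s2 by rewrite sqr_sqrtr ?(ltW s20).
(* The sector argument needs an opening of at most [pi / 2]; the lower bound for
   the variance uses the original [d]. *)
pose d' := Num.min d (pi / 2).
have d'0 : 0 < d' by rewrite lt_min d0 divr_gt0.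
have d'pi : d' <= pi / 2 by rewrite ge_min lexx orbT.
have d'd : d' <= d by rewrite ge_min lexx.
have d'2 : d / 2 <= d' by rewrite le_min; apply/andP; split; lra.
pose r := 4 * d' / (2 * pi + d').
have /andP[r0 rsin] : 0 < r < sin d' by apply: radius_lt_sin; rewrite d'0.
have rinv : r^-1 <= 5 / 4 * pi / d.
  rewrite /r invf_div ler_pdivrMr ?mulr_gt0//.
  have -> : 5 / 4 * pi / d * (4 * d') = 5 * pi * d' / d by field; rewrite gt_eqF.
  by rewrite ler_pdivlMr//; nra.
pose T := r * sg / 10.
have T0 : 0 < T by rewrite divr_gt0// mulr_gt0.
have sf := sector_freeW d'd (zeros_in_sector_free pz dpi p0 p00).
pose q (i : 'I_n.+2) : R := p`_i.
pose x (i : 'I_n.+2) : R := (i%:R - m) / sg.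
have near_gauss s : 0 < s <= T ->
    `|\sum_i q i * cos (s * x i) - expR (- (s ^+ 2 / 2))| <=
      K / T * s ^+ 3 * expR (- (s ^+ 2 / 4)) /\
    `|\sum_i q i * sin (s * x i)| <= K / T * s ^+ 3 * expR (- (s ^+ 2 / 4)).
  move=> /andP[s0 sT]; have t1 : 0 <= s / sg <= r / 10.
    rewrite divr_ge0 ?(ltW s0) ?(ltW sg0)//= ler_pdivrMr//.
    by rewrite (_ : r / 10 * sg = T)// /T; ring.
  have := charfun_estimate sf sp _ _ p1 t1; rewrite d'0 d'pi r0 rsin => /(_ isT isT) /=.
  rewrite -/m -/s2 -sgE.
  have e1 i : s / sg * (i%:R - m) = s * ((i%:R - m) / sg) by ring.
  have e2 c : sg ^+ 2 * (s / sg) ^+ 2 / c = s ^+ 2 / c.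
    by rewrite expr_div_n [sg ^+ 2 * _]mulrC divfK// sqrf_eq0 gt_eqF.
  rewrite !e2.
  have -> : 7 / 3 * sg ^+ 2 / r * (s / sg) ^+ 3 = K / T * s ^+ 3.
    by rewrite /K /T; field; rewrite !gt_eqF.
  move=> [h1 h2]; split; [move: h1|move: h2]; by under eq_bigr do rewrite e1.
have q1 : \sum_i q i = 1.
  have [|h _ _] := @moments_1 R p n; last by rewrite -p1 h.
  by rewrite sp.
have := smoothing_inequality T0 (ltW K0) near_gauss (fun i => p0 i) q1 a kap0 gam0 step.
move=> h; apply: le_trans h _.
have -> : 1 / (2 * kap) * (2 * (128 * K) / T) +
    gam * (2 * (2 + 128 * K) / T + 2 * 2 / T) = C0 / T.
  by rewrite /C0; field; rewrite !gt_eqF.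
have n0 : 0 < n.+1%:R :> R by rewrite ltr0n.
set L := rho `^ (pi / d); set N := n.+1%:R `^ _.
have L0 : 0 < L by rewrite powR_gt0//; lra.
have NE : N = (Num.sqrt n.+1%:R)^-1 by rewrite /N powRN mul1r powR12_sqrt// ltW.
have lb := variance_lower_bound pz p0 p00 sp _ rho1; rewrite d0 dpi in lb; move: (lb isT) => {}lb.
have L2 : rho `^ (2 * pi / d) = L ^+ 2.
  by rewrite -powR_mulrn ?(ltW L0)// /L -powRrM; congr (_ `^ _); ring.
have sginv : sg^-1 <= L * N / Num.sqrt c1.
  rewrite NE !ler_pdivlMr ?sqrtr_gt0// -mulrA mulrC ler_pdivrMr//.
  rewrite -sqrtrM ?(ltW c10)// -(@ler_pXn2r _ 2) ?nnegrE ?sqrtr_ge0 ?mulr_ge0 ?(ltW sg0) ?(ltW L0)//.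
  by rewrite sqr_sqrtr ?mulr_ge0 ?(ltW c10)// exprMn sgE -L2 [leRHS]mulrC.
have -> : C0 / T = 10 * C0 * r^-1 * sg^-1.
  by rewrite /T; field; rewrite !gt_eqF.
apply: (@le_trans _ _ (10 * C0 * (5 / 4 * pi / d) * (L * N / Num.sqrt c1))); last first.
  by rewrite le_eqVlt; apply/orP; left; apply/eqP; ring.
by rewrite ler_pM ?mulr_ge0 ?invr_ge0 ?(ltW C00) ?(ltW r0) ?(ltW sg0)// ler_wpM2l ?mulr_ge0 ?(ltW C00).
Qed.

End polynomial.

(** * Laws on the first integers *)
Section moments.
Context {R : realType} {disp : measure_display} {T : measurableType disp}.
Variables (P : probability T R) (X : {RV P >-> R}) (n : nat).
Hypothesis supp : forall w : T, exists2 k : nat, (k <= n)%N & X w = k%:R.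
Let A (k : nat) : set T := [set w | X w = k%:R].
Let pk (k : nat) : R := fine (P (A k)).

Let mA k : measurable (A k).
Proof.
have -> : A k = X @^-1` [set k%:R] by [].
by apply: measurable_funPTI; exact: measurable_set1.
Qed.

Let PE k : P (A k) = (pk k)%:E.
Proof. by rewrite fineK ?fin_num_measure. Qed.

Lemma integral_finite_law (g : nat -> R) (f : T -> R) :
  (forall w k, X w = k%:R -> f w = g k) -> (forall k, 0 <= g k) ->
  (\int[P]_w (f w)%:E = (\sum_(k < n.+1) pk k * g k)%:E)%E.
Proof.
move=> fg g0.
have fE w : (f w)%:E = (\sum_(k < n.+1) (g k * \1_(A k) w)%:E)%E.
  have [k kn Xw] := supp w; rewrite (fg _ _ Xw) sumEFin; congr EFin.
  rewrite (bigD1 (Ordinal (kn : (k < n.+1)%N)))//= big1 ?addr0.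
    by rewrite indicE mem_set ?mulr1.
  move=> i ik; rewrite indicE memNset ?mulr0// /A /= Xw => /eqP.
  rewrite eqr_nat => /eqP ki; move/eqP: ik; apply; exact/val_inj.
under eq_integral do rewrite fE.
rewrite ge0_integral_sum//; last 2 first.
- by move=> k; apply/measurable_EFinP; apply: measurable_funM.
- by move=> k w _; rewrite lee_fin mulr_ge0.
rewrite -sumEFin; apply: eq_bigr => k _.
under eq_integral do rewrite EFinM.
rewrite ge0_integralZl ?lee_fin//; last first.
  by apply/measurable_EFinP; exact: measurable_indic.
by rewrite integral_indic// setIT mulrC EFinM; congr (_ * _)%E; exact: PE.
Qed.

Let pkp : {poly R} := \poly_(k < n.+1) pk k.

Lemma polyRC_pgf : polyRC pkp = pgf X n.
Proof.
apply/polyP => i; rewrite coef_map !coef_poly.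
by case: ifP.
Qed.

Lemma sum_finite_law : \sum_(k < n.+1) pk k = 1.
Proof.
apply: EFin_inj; transitivity (\int[P]_w (1%R)%:E)%E; last first.
  by rewrite integral_cst// mul1e; exact: probability_setT.
rewrite (@integral_finite_law (fun=> 1))//.
by congr EFin; apply: eq_bigr => k _; rewrite mulr1.
Qed.

Lemma mean_finite_law : mean X = \sum_(k < n.+1) pk k * k%:R.
Proof. by rewrite /mean unlock (@integral_finite_law (fun k => k%:R)). Qed.

Lemma variance_finite_law :
  fine 'V_P[X] = \sum_(k < n.+1) pk k * (k%:R - mean X) ^+ 2.
Proof.
have em : fine (\int[P]_w (X w)%:E)%E = mean X by rewrite /mean unlock.
rewrite /variance unlock unlock em.
rewrite (@integral_finite_law (fun k => (k%:R - mean X) ^+ 2))//.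
  move=> w k Xw; transitivity ((X w - mean X) * (X w - mean X)); first by [].
  by rewrite Xw expr2.
by move=> k; exact: sqr_ge0.
Qed.

Lemma cdf_finite_law (a m s : R) : P [set w | (X w - m) / s <= a]%R =
  (\sum_(k < n.+1) pk k * ((k%:R - m) / s <= a)%R%:R)%:E.
Proof.
set B := [set w | _].
have mB : measurable B.
  have -> : B = (fun w => (X w - m) / s) @^-1` `]-oo, a].
    by apply/seteqP; split => w /=; rewrite in_itv.
  rewrite -[_ @^-1` _]setTI.
  have mf : measurable_fun setT (fun w => (X w - m) / s).
    by apply: measurable_funM => //; apply: measurable_funB.
  by apply: mf => //; exact: measurable_itv.
rewrite -[B]setIT -integral_indic//.
rewrite -(@integral_finite_law (fun k => ((k%:R - m) / s <= a)%R%:R) \1_B)//.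
move=> w k Xw; rewrite indicE; congr ((nat_of_bool _)%:R).
by apply/idP/idP; rewrite inE /B /= Xw.
Qed.

End moments.

(** There is at least one zero, and arguments are at most [pi]. *)
Lemma zeros_in_le_pi (R : realType) (d rho : R) (p : {poly R}) n : 1 <= rho ->
  zeros_in d rho p -> size p = n.+2 -> d <= pi.
Proof.
move=> rho1 pz sp.
have [z /[dup] zr /pz[dz /andP[zl _]]] : exists z, root (polyRC p) z.
  by apply/closed_rootP; rewrite size_map_poly sp.
have [th [th1 ht]] : exists th, is_arg z th.
  apply: is_arg_exists; apply: contraTneq zl => ->.
  rewrite -ltNge /md /sqn /= expr0n addr0 sqrtr0 invr_gt0; lra.
apply: le_trans dz _; rewrite (norm_argE (conj th1 ht)); by rewrite ler_norml.
Qed.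

Theorem corollary3 (R : realType) :
  exists c : R, 0 < c /\
  forall (n : nat) (d : measure_display) (T : measurableType d)
    (P : probability T R) (X : {RV P >-> R}) (delta rho : R),
    (1 <= n)%N ->
    (forall w : T, exists2 k : nat, (k <= n)%N & X w = k%:R) ->
    (0 < P [set w | (X w = 0)%R] * P [set w | (X w = n%:R)%R])%E ->
    0 < delta ->
    1 <= rho ->
    (forall zeta : R[i], root (pgf X n) zeta ->
       delta <= `|arg zeta| /\ (rho^-1)%:C <= `|zeta| <= rho%:C) ->
    (ereal_sup [set `|P [set w | (standardized X w <= t)%R]
                      - normal_prob 0 1 `]-oo, t]| | t in [set: R]]
     <= (c * delta^-1 * rho `^ (pi / delta) * n%:R `^ (- (1 / 2)))%:E)%E.
Proof.
have [C [C0 main]] := @poly_berry_esseen R.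
exists C; split => //.
move=> [//|n] d T P X delta rho _ supp pos delta0 rho1 zeros.
pose p : {poly R} := \poly_(k < n.+2) fine (P [set w | X w = k%:R]).
have pgfE : polyRC p = pgf X n.+1 := polyRC_pgf X n.+1.
have pE (i : 'I_n.+2) : p`_i = fine (P [set w | X w = i%:R]).
  by rewrite coef_poly ltn_ord.
have p0 k : 0 <= p`_k by rewrite coef_poly; case: ifP => // _; exact: fine_ge0.
have fin k : P [set w | X w = k%:R] = (fine (P [set w | X w = k%:R]))%:E.
  by rewrite fineK// fin_num_measure//; exact: (measurable_funPTI X (measurable_set1 _)).
have [p00 pn] : 0 < p`_0 /\ 0 < p`_n.+1.
  move: pos; rewrite (fin 0%N) (fin n.+1) -EFinM lte_fin.
  have := p0 0%N; have := p0 n.+1; rewrite (pE ord0) (pE ord_max) /=.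
  rewrite !le_eqVlt => /orP[/eqP<-|->]; first by rewrite mulr0 ltxx.
  by move=> /orP[/eqP<-|->//]; rewrite mul0r ltxx.
have sp : size p = n.+2.
  by rewrite size_poly_eq// gt_eqF//; move: pn; rewrite (pE ord_max).
have p1E : p.[1] = 1.
  have [|-> _ _] := @moments_1 R p n; first by rewrite sp.
  by under eq_bigr do rewrite pE; exact: sum_finite_law supp.
have mE : kap1 p 1 = mean X.
  have [|_ e _] := @moments_1 R p n; first by rewrite sp.
  rewrite /kap1 p1E e divr1 (mean_finite_law supp).
  by apply: eq_bigr => i _; rewrite pE.
have vE : kap2 p 1 = fine 'V_P[X].
  have [|e0 e1 e2] := @moments_1 R p n; first by rewrite sp.
  rewrite (variance_finite_law supp) /kap2 p1E divr1 mE e2.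
  transitivity (\sum_(i < n.+2) (p`_i * i%:R ^+ 2 - 2 * mean X * (p`_i * i%:R)
     + mean X ^+ 2 * p`_i)).
    rewrite big_split sumrB -!mulr_sumr -e1 -e0 p1E /=.
    by move: mE; rewrite /kap1 p1E divr1 => ->; ring.
  by apply: eq_bigr => i _; rewrite pE; ring.
have pz : zeros_in delta rho p.
  move=> z; rewrite pgfE => /zeros[h1 /andP[h2 h3]]; split => //.
  by rewrite mdE !lecR in h2 h3; rewrite h2.
have dpi := zeros_in_le_pi rho1 pz sp.
apply: ge_ereal_sup => _ [t _ <-].
have := main _ _ _ n t pz _ rho1 p0 p00 sp p1E; rewrite delta0 dpi => /(_ isT) h.
have -> : P [set w | standardized X w <= t] =
    (\sum_(i < n.+2) p`_i * ((i%:R - kap1 p 1) / Num.sqrt (kap2 p 1) <= t)%R%:R)%:E.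
  rewrite mE vE (cdf_finite_law supp); congr EFin.
  by apply: eq_bigr => i _; rewrite pE.
have -> : normal_prob 0 1 `]-oo, t] = (fine (@normal_prob R 0 1 `]-oo, t]))%:E.
  by rewrite fineK// fin_num_measure//; exact: measurable_itv.
by rewrite -EFinB /= lee_fin.
Qed.
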